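(* Let $\Lambda$ be a G-semisimple algebra. Then any indecomposable non-projective object in $\mathcal{S}(\mathrm{Gprj}\text{-}\Lambda)$ is isomorphic to either $(0\to G)$, or $(G\xrightarrow{1}G)$, or $(\Omega_\Lambda(G)\xrightarrow{i}P)$, where $i$ is the kernel of the projective cover $P\to G$, for some indecomposable non-projective Gorenstein projective $\Lambda$-module $G$. In particular, $\mathcal{S}(\mathrm{Gprj}\text{-}\Lambda)$ is of finite representation type (has finitely many indecomposable objects up to isomorphism), or equivalently $T_2(\Lambda)=\left[\begin{smallmatrix}\Lambda&\Lambda\\0&\Lambda\end{smallmatrix}\right]$ is CM-finite.
   Context: $\Lambda$ is an Artin algebra, modules are finitely generated right modules. A module is Gorenstein projective if it is a syzygy of an acyclic complex $\mathbf{P}^\bullet$ of projective modules such that $\mathrm{Hom}_\Lambda(\mathbf{P}^\bullet,Q)$ is acyclic for every projective module $Q$. $\mathrm{Gprj}\text{-}\Lambda$ is the category of Gorenstein projective modules and $\underline{\mathrm{Gprj}}\text{-}\Lambda$ its stable category modulo projectives. Standing assumption: $\mathrm{Gprj}\text{-}\Lambda$ is contravariantly finite in $\mathrm{mod}\text{-}\Lambda$. For an additive category $\mathcal{X}$, $\mathrm{mod}\text{-}\mathcal{X}$ denotes the category of finitely presented contravariant additive functors from $\mathcal{X}$ to abelian groups. $\Lambda$ is G-semisimple if $\mathrm{mod}\text{-}(\underline{\mathrm{Gprj}}\text{-}\Lambda)$ is a semisimple abelian category, i.e. all its objects are projective. An algebra is CM-finite if it has only finitely many isomorphism classes of indecomposable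 finitely generated Gorenstein projective modules. $\mathrm{H}(\Lambda)$ is the morphism category: objects are $\Lambda$-homomorphisms $(A\xrightarrow{f}B)$, morphisms are commutative squares; it is equivalent to the category of finitely generated $T_2(\Lambda)$-modules. $\mathcal{S}(\mathrm{Gprj}\text{-}\Lambda)$ is the full subcategory of $\mathrm{H}(\Lambda)$ consisting of the monomorphisms $(A\xrightarrow{f}B)$ such that $A$, $B$ and $\mathrm{cok} f$ are Gorenstein projective. *)

(* Defs.v *)
From HB Require Import structures.
From mathcomp Require Import all_boot all_order all_algebra.
From mathcomp Require Import generic_quotient ring_quotient.
From mathcomp Require Import boolp.

Set Implicit Arguments.
Unset Strict Implicit.
Unset Printing Implicit Defensive.

Import GRing.Theory.
Local Open Scope ring_scope.
Local Open Scope quotient_scope.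

Definition surj (A B : Type) (f : A -> B) : Prop := forall y, exists x, f x = y.

Definition exact_at (A : Type) (B C : zmodType) (f : A -> B) (g : B -> C) : Prop :=
  forall y, g y = 0 <-> exists x, f x = y.

Record preadditive := Preadditive {
  obj :> Type;
  hom : obj -> obj -> zmodType;
  idm : forall X, hom X X;
  comp : forall X Y Z, hom Y Z -> hom X Y -> hom X Z;
  compA : forall X Y Z T (h : hom Z T) (g : hom Y Z) (f : hom X Y),
    comp h (comp g f) = comp (comp h g) f;
  comp1m : forall X Y (f : hom X Y), comp (idm Y) f = f;
  compm1 : forall X Y (f : hom X Y), comp f (idm X) = f;
  compDl : forall X Y Z (g g' : hom Y Z) (f : hom X Y),
    comp (g + g') f = comp g f + comp g' f;
  compDr : forall X Y Z (g : hom Y Z) (f f' : hom X Y),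
    comp g (f + f') = comp g f + comp g f' }.

Arguments hom {p} X Y.
Arguments idm {p} X.
Arguments comp {p X Y Z} g f.

Notation "g \oc f" := (comp g f) (at level 40, left associativity).

Section PreadditiveTheory.
Variable C : preadditive.
Implicit Types X Y Z : C.

Lemma comp0m X Y Z (f : hom X Y) : (0 : hom Y Z) \oc f = 0.
Proof. by apply: (addIr (0 \oc f)); rewrite -compDl !add0r. Qed.

Lemma compm0 X Y Z (g : hom Y Z) : g \oc (0 : hom X Y) = 0.
Proof. by apply: (addIr (g \oc 0)); rewrite -compDr !add0r. Qed.

Lemma compNm X Y Z (g : hom Y Z) (f : hom X Y) : (- g) \oc f = - (g \oc f).
Proof. by apply: (addIr (g \oc f)); rewrite -compDl !addNr comp0m. Qed.

Lemma compmN X Y Z (g : hom Y Z) (f : hom X Y) : g \oc (- f) = - (g \oc f).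
Proof. by apply: (addIr (g \oc f)); rewrite -compDr !addNr compm0. Qed.

Lemma compBl X Y Z (g g' : hom Y Z) (f : hom X Y) :
  (g - g') \oc f = g \oc f - g' \oc f.
Proof. by rewrite compDl compNm. Qed.

Lemma compBr X Y Z (g : hom Y Z) (f f' : hom X Y) :
  g \oc (f - f') = g \oc f - g \oc f'.
Proof. by rewrite compDr compmN. Qed.

Definition iso X Y : Prop :=
  exists (f : hom X Y) (g : hom Y X), g \oc f = idm X /\ f \oc g = idm Y.

Definition zero_obj X : Prop := idm X = 0.

Definition is_biproduct X A B : Prop :=
  exists (iA : hom A X) (iB : hom B X) (pA : hom X A) (pB : hom X B),
    [/\ pA \oc iA = idm A, pB \oc iB = idm B, pA \oc iB = 0, pB \oc iA = 0
      & iA \oc pA + iB \oc pB = idm X].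

Definition indecomposable X : Prop :=
  ~ zero_obj X /\
  forall A B : C, is_biproduct X A B -> zero_obj A \/ zero_obj B.

Definition epi X Y (e : hom X Y) : Prop :=
  forall Z (u v : hom Y Z), u \oc e = v \oc e -> u = v.

Definition projective_obj X : Prop :=
  forall Y Z (e : hom Y Z), epi e ->
  forall f : hom X Z, exists g : hom X Y, e \oc g = f.

(* Indecomposability is tested in C, not in the full subcategory cut out by Q. *)
Definition finitely_many_indec (Q : C -> Prop) : Prop :=
  exists (n : nat) (M : 'I_n -> C),
    forall X, Q X -> indecomposable X -> exists i, iso X (M i).

Definition contravariantly_finite (Q : C -> Prop) : Prop :=
  forall M : C, exists (X : C) (f : hom X M),
    Q X /\ forall X' (f' : hom X' M), Q X' -> exists g : hom X' X, f \oc g = f'.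

Definition finite_representation_type : Prop :=
  finitely_many_indec (fun _ => True).

End PreadditiveTheory.

Section FullSubcategory.
Variables (C : preadditive) (Q : C -> Prop).

Definition fullsub : preadditive :=
  @Preadditive {X : C | Q X} (fun X Y => hom (sval X) (sval Y))
    (fun X => idm (sval X)) (fun X Y Z g f => g \oc f)
    (fun X Y Z T => @compA C _ _ _ _) (fun X Y => @comp1m C _ _)
    (fun X Y => @compm1 C _ _) (fun X Y Z => @compDl C _ _ _)
    (fun X Y Z => @compDr C _ _ _).

End FullSubcategory.

(* Two-sided ideal of morphisms of an additive category. *)
Record ideal (C : preadditive) := Ideal {
  in_ideal : forall X Y : C, hom X Y -> Prop;
  ideal0 : forall X Y : C, in_ideal (0 : hom X Y);
  idealB : forall (X Y : C) (f g : hom X Y),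
    in_ideal f -> in_ideal g -> in_ideal (f - g);
  idealM : forall (X Y Z T : C) (h : hom Z T) (f : hom Y Z) (g : hom X Y),
    in_ideal f -> in_ideal (h \oc f \oc g) }.

Arguments in_ideal {C} i {X Y} f.

Section QuotientCategory.
Variables (C : preadditive) (I : ideal C).

Definition ideal_pred (X Y : C) : {pred hom X Y} := fun f => `[< in_ideal I f >].

Lemma ideal_predP (X Y : C) (f : hom X Y) :
  reflect (in_ideal I f) (f \in @ideal_pred X Y).
Proof. exact: asboolP. Qed.

Lemma ideal_pred_closed (X Y : C) : zmod_closed (@ideal_pred X Y).
Proof.
split=> [|f g /ideal_predP If /ideal_predP Ig]; apply/ideal_predP.
  exact: ideal0.
exact: idealB.
Qed.

HB.instance Definition _ (X Y : C) :=
  GRing.isZmodClosed.Build (hom X Y) (@ideal_pred X Y) (@ideal_pred_closed X Y).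

Definition qhom (X Y : C) : zmodType := {ideal_quot (@ideal_pred X Y)}.

Definition qpi (X Y : C) (f : hom X Y) : qhom X Y := \pi f.

Lemma qpiP (X Y : C) (f g : hom X Y) : qpi f = qpi g <-> in_ideal I (f - g).
Proof.
rewrite /qpi; split=> [/eqP|H].
  by rewrite -Quotient.idealrBE => /ideal_predP.
by apply/eqP; rewrite -Quotient.idealrBE; apply/ideal_predP.
Qed.

Lemma qpi_surj (X Y : C) : surj (@qpi X Y).
Proof. by move=> f; exists (repr f); rewrite /qpi reprK. Qed.

Lemma qpiD (X Y : C) (f g : hom X Y) : qpi (f + g) = qpi f + qpi g.
Proof. by rewrite /qpi !piE. Qed.

Definition qcomp (X Y Z : C) (g : qhom Y Z) (f : qhom X Y) : qhom X Z :=
  qpi (repr g \oc repr f).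

Lemma qcompE (X Y Z : C) (g : hom Y Z) (f : hom X Y) :
  qcomp (qpi g) (qpi f) = qpi (g \oc f).
Proof.
apply/qpiP; set g' := repr _; set f' := repr _.
have Ig : in_ideal I (g' - g) by apply/qpiP; rewrite /qpi reprK.
have If : in_ideal I (f' - f) by apply/qpiP; rewrite /qpi reprK.
have -> : g' \oc f' - g \oc f = (g' - g) \oc f' - g \oc (f - f').
  by rewrite compBl compBr opprB addrA subrK.
apply: idealB.
  by have := idealM (idm Z) f' Ig; rewrite comp1m.
have := idealM g (idm X) (idealB (ideal0 I X Y) If).
by rewrite compm1 sub0r opprB.
Qed.

Lemma qcompA (X Y Z T : C) (h : qhom Z T) (g : qhom Y Z) (f : qhom X Y) :
  qcomp h (qcomp g f) = qcomp (qcomp h g) f.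
Proof.
by have [[h' <-] [[g' <-] [f' <-]]] := (qpi_surj h, (qpi_surj g, qpi_surj f));
  rewrite !qcompE compA.
Qed.

Lemma qcomp1m (X Y : C) (f : qhom X Y) : qcomp (qpi (idm Y)) f = f.
Proof. by have [f' <-] := qpi_surj f; rewrite qcompE comp1m. Qed.

Lemma qcompm1 (X Y : C) (f : qhom X Y) : qcomp f (qpi (idm X)) = f.
Proof. by have [f' <-] := qpi_surj f; rewrite qcompE compm1. Qed.

Lemma qcompDl (X Y Z : C) (g g' : qhom Y Z) (f : qhom X Y) :
  qcomp (g + g') f = qcomp g f + qcomp g' f.
Proof.
have [f1 <-] := qpi_surj f; have [g1 <-] := qpi_surj g.
by have [g1' <-] := qpi_surj g'; rewrite -qpiD !qcompE compDl qpiD.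
Qed.

Lemma qcompDr (X Y Z : C) (g : qhom Y Z) (f f' : qhom X Y) :
  qcomp g (f + f') = qcomp g f + qcomp g f'.
Proof.
have [f1 <-] := qpi_surj f; have [g1 <-] := qpi_surj g.
by have [f1' <-] := qpi_surj f'; rewrite -qpiD !qcompE compDr qpiD.
Qed.

Definition quotcat : preadditive :=
  Preadditive qcompA qcomp1m qcompm1 qcompDl qcompDr.

End QuotientCategory.

Section ArrowCategory.
Variable C : preadditive.

Record arrow := Arrow { asrc : C; atgt : C; amap : hom asrc atgt }.

Section Squares.
Variables a b : arrow.

Definition square : {pred hom (asrc a) (asrc b) * hom (atgt a) (atgt b)} :=
  fun p => p.2 \oc amap a == amap b \oc p.1.

Lemma square_closed : zmod_closed square.
Proof.
split=> [|p q]; rewrite !unfold_in /= ?comp0m ?compm0 //.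
by move=> /eqP pE /eqP qE; rewrite compBl compBr pE qE.
Qed.

HB.instance Definition _ := GRing.isZmodClosed.Build _ square square_closed.

Record ahom := Ahom { ahom_val :> hom (asrc a) (asrc b) * hom (atgt a) (atgt b);
                      ahomP : ahom_val \in square }.

HB.instance Definition _ := [isSub for ahom_val].
HB.instance Definition _ := [Choice of ahom by <:].
HB.instance Definition _ := [SubChoice_isSubZmodule of ahom by <:].

End Squares.

Arguments square : clear implicits.

Lemma arrow_id_subproof (a : arrow) :
  (idm (asrc a), idm (atgt a)) \in square a a.
Proof. by rewrite unfold_in /= comp1m compm1. Qed.

Definition arrow_id (a : arrow) : ahom a a := Ahom (arrow_id_subproof a).

Lemma arrow_comp_subproof (a b c : arrow) (g : ahom b c) (f : ahom a b) :
  (g.1 \oc f.1, g.2 \oc f.2) \in square a c.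
Proof.
have /eqP gP := ahomP g; have /eqP fP := ahomP f.
by rewrite unfold_in /= -compA fP compA gP compA.
Qed.

Definition arrow_comp (a b c : arrow) (g : ahom b c) (f : ahom a b) : ahom a c :=
  Ahom (arrow_comp_subproof g f).

Lemma arrow_compA (a b c d : arrow) (h : ahom c d) (g : ahom b c) (f : ahom a b) :
  arrow_comp h (arrow_comp g f) = arrow_comp (arrow_comp h g) f.
Proof. by apply: val_inj; rewrite /= !compA. Qed.

Lemma arrow_comp1m (a b : arrow) (f : ahom a b) : arrow_comp (arrow_id b) f = f.
Proof. by apply: val_inj; rewrite /= !comp1m -surjective_pairing. Qed.

Lemma arrow_compm1 (a b : arrow) (f : ahom a b) : arrow_comp f (arrow_id a) = f.
Proof. by apply: val_inj; rewrite /= !compm1 -surjective_pairing. Qed.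

Lemma arrow_compDl (a b c : arrow) (g g' : ahom b c) (f : ahom a b) :
  arrow_comp (g + g') f = arrow_comp g f + arrow_comp g' f.
Proof. by apply: val_inj; rewrite /= !compDl. Qed.

Lemma arrow_compDr (a b c : arrow) (g : ahom b c) (f f' : ahom a b) :
  arrow_comp g (f + f') = arrow_comp g f + arrow_comp g f'.
Proof. by apply: val_inj; rewrite /= !compDr. Qed.

Definition arrowcat : preadditive :=
  @Preadditive arrow (fun a b => ahom a b : zmodType) arrow_id arrow_comp
    arrow_compA arrow_comp1m arrow_compm1 arrow_compDl arrow_compDr.

End ArrowCategory.

Section FunctorsToAb.
Variable C : preadditive.

Record cofunctor := Cofunctor {
  fob :> C -> zmodType;
  fmap : forall X Y : C, hom X Y -> {additive fob Y -> fob X};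
  fmap1 : forall X x, fmap (idm X) x = x;
  fmapM : forall (X Y Z : C) (g : hom Y Z) (f : hom X Y) x,
    fmap (g \oc f) x = fmap f (fmap g x);
  fmapD : forall (X Y : C) (f f' : hom X Y) x,
    fmap (f + f') x = fmap f x + fmap f' x }.

Record nattrans (F G : cofunctor) := Nattrans {
  nt :> forall X : C, {additive F X -> G X};
  ntP : forall (X Y : C) (f : hom X Y) (x : F Y),
    nt X (fmap F f x) = fmap G f (nt Y x) }.

End FunctorsToAb.

Section FinitelyPresentedFunctors.
Variable C : preadditive.

Section Yoneda.
Variable X : C.

Section Precomposition.
Variables (Y Z : C) (f : hom Y Z).

Definition precomp (g : hom Z X) : hom Y X := g \oc f.

Lemma precomp_is_additive : zmod_morphism precomp.
Proof. by move=> g g'; rewrite /precomp compBl. Qed.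

HB.instance Definition _ :=
  GRing.isZmodMorphism.Build (hom Z X) (hom Y X) precomp precomp_is_additive.

End Precomposition.

Definition yoneda : cofunctor C :=
  @Cofunctor C (fun Y => hom Y X) (fun Y Z f => precomp f)
    (fun Y => @compm1 C Y X) (fun Y Z T g f x => @compA C _ _ _ _ x g f)
    (fun Y Z f f' x => @compDr C _ _ _ x f f').

End Yoneda.

(* Exactness of Hom(-, X1) -> Hom(-, X0) -> F -> 0. *)
Definition finitely_presented (F : cofunctor C) : Prop :=
  exists (X1 X0 : C) (a : nattrans (yoneda X1) (yoneda X0))
         (e : nattrans (yoneda X0) F),
    forall Y : C, exact_at (a Y) (e Y) /\ surj (e Y).

(* Epimorphisms of the full subcategory of finitely presented functors. *)
Definition fp_epi (F G : cofunctor C) (e : nattrans F G) : Prop :=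
  forall H : cofunctor C, finitely_presented H ->
  forall u v : nattrans G H,
    (forall X x, u X (e X x) = v X (e X x)) -> forall X x, u X x = v X x.

Definition fp_projective (F : cofunctor C) : Prop :=
  forall G H : cofunctor C, finitely_presented G -> finitely_presented H ->
  forall e : nattrans G H, fp_epi e ->
  forall f : nattrans F H, exists g : nattrans F G,
    forall X x, e X (g X x) = f X x.

(* Semisimplicity of mod-C, the category of finitely presented functors, in the
   sense that all its objects are projective. For C = stable_Gprj below, mod-C is
   automatically abelian, since C is triangulated and hence has weak kernels. *)
Definition semisimple_mod : Prop :=
  forall F : cofunctor C, finitely_presented F -> fp_projective F.

End FinitelyPresentedFunctors.

Definition finitely_generated (R : pzRingType) (V : lmodType R) : Prop :=
  exists (n : nat) (v : 'I_n -> V),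
    forall x, exists c : 'I_n -> R, x = \sum_i c i *: v i.

Definition is_ideal (k : comNzRingType) (I : k -> Prop) : Prop :=
  [/\ I 0, forall x y, I x -> I y -> I (x + y) & forall a x, I x -> I (a * x)].

Definition artinian (k : comNzRingType) : Prop :=
  forall I : nat -> k -> Prop,
    (forall n, is_ideal (I n)) -> (forall n x, I n.+1 x -> I n x) ->
    exists N, forall n x, (N <= n)%N -> (I n x <-> I N x).

Definition artin_algebra (k : comNzRingType) (L : algType k) : Prop :=
  artinian k /\ finitely_generated L.

Section RightModules.
Variable R : nzRingType.

(* A right R-module is a left module over the converse ring R^c. *)
Record fgmod := Fgmod {
  fgmod_sort :> lmodType R^c;
  fgmodP : finitely_generated fgmod_sort }.

Section LinearMaps.
Variables M N : lmodType R^c.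

Definition lhom := {linear M -> N}.
Definition lhom_fun (f : lhom) : {linear M -> N} := f.
Coercion lhom_fun : lhom >-> GRing.Linear.type.

Lemma lhomP (f g : lhom) : f =1 g -> f = g.
Proof.
move=> /funext; case: f g => [f [[fA] [fS]]] [g [[gA] [gS]]] /= fg.
by move: fA fS gA gS; rewrite fg => *; do 3!f_equal; exact: Prop_irrelevance.
Qed.

HB.instance Definition _ := gen_eqMixin lhom.
HB.instance Definition _ := gen_choiceMixin lhom.

Definition lhom0 : lhom := (\0 : {linear M -> N}).
Definition lhomN (f : lhom) : lhom := (\- f : {linear M -> N}).
Definition lhomD (f g : lhom) : lhom := (f \+ g : {linear M -> N}).

Lemma lhom_addA : associative lhomD.
Proof. by move=> f g h; apply: lhomP => x /=; rewrite addrA. Qed.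
Lemma lhom_addC : commutative lhomD.
Proof. by move=> f g; apply: lhomP => x /=; rewrite addrC. Qed.
Lemma lhom_add0 : left_id lhom0 lhomD.
Proof. by move=> f; apply: lhomP => x /=; rewrite add0r. Qed.
Lemma lhom_addN : left_inverse lhom0 lhomN lhomD.
Proof. by move=> f; apply: lhomP => x /=; rewrite addNr. Qed.

HB.instance Definition _ :=
  GRing.isZmodule.Build lhom lhom_addA lhom_addC lhom_add0 lhom_addN.

End LinearMaps.

Definition lhom_id (M : lmodType R^c) : lhom M M := (idfun : {linear M -> M}).
Definition lhom_comp (M N K : lmodType R^c) (g : lhom N K) (f : lhom M N) :
  lhom M K := (g \o f : {linear M -> K}).


Lemma lhom_compA (M N K T : fgmod) (h : lhom K T) (g : lhom N K) (f : lhom M N) :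
  lhom_comp h (lhom_comp g f) = lhom_comp (lhom_comp h g) f.
Proof. exact: lhomP. Qed.
Lemma lhom_comp1m (M N : fgmod) (f : lhom M N) : lhom_comp (lhom_id N) f = f.
Proof. exact: lhomP. Qed.
Lemma lhom_compm1 (M N : fgmod) (f : lhom M N) : lhom_comp f (lhom_id M) = f.
Proof. exact: lhomP. Qed.
Lemma lhom_compDl (M N K : fgmod) (g g' : lhom N K) (f : lhom M N) :
  lhom_comp (g + g') f = lhom_comp g f + lhom_comp g' f.
Proof. exact: lhomP. Qed.
Lemma lhom_compDr (M N K : fgmod) (g : lhom N K) (f f' : lhom M N) :
  lhom_comp g (f + f') = lhom_comp g f + lhom_comp g f'.
Proof. by apply: lhomP => x /=; rewrite raddfD. Qed.

Definition modcat : preadditive :=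
  @Preadditive fgmod (fun M N => lhom M N : zmodType)
    (fun M => lhom_id M) (fun M N K => @lhom_comp M N K)
    lhom_compA lhom_comp1m lhom_compm1 lhom_compDl lhom_compDr.

Lemma zero_fg : finitely_generated 'rV[R^c]_0.
Proof. by exists 0%N, (fun=> 0) => x; exists (fun=> 0); apply/rowP => -[]. Qed.

Definition zero_mod : fgmod := Fgmod zero_fg.

Lemma prod_fg (M N : lmodType R^c) :
  finitely_generated M -> finitely_generated N ->
  finitely_generated (M * N)%type.
Proof.
move=> [m [u uP]] [n [v vP]].
exists (m + n)%N, (fun i => match split i with inl j => (u j, 0) | inr j => (0, v j) end).
move=> [x y]; have [c ->] := uP x; have [d ->] := vP y.
exists (fun i => match split i with inl j => c j | inr j => d j end).
have sl i : split (lshift n i : 'I_(m + n)) = inl i by exact: (unsplitK (inl i)).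
have sr i : split (rshift m i : 'I_(m + n)) = inr i by exact: (unsplitK (inr i)).
rewrite big_split_ord /=.
by apply: injective_projections; rewrite /= !raddf_sum -?big_split_ord /=;
  [rewrite [X in _ + X]big1 ?addr0|rewrite [X in X + _]big1 ?add0r];
  do ?[apply: eq_bigr => i _]; move=> *; rewrite ?(sl, sr) /= ?scaler0.
Qed.

Definition prod_mod (M N : fgmod) : fgmod := Fgmod (prod_fg (fgmodP M) (fgmodP N)).

Definition projective (P : lmodType R^c) : Prop :=
  forall (M N : lmodType R^c) (e : {linear M -> N}), surj e ->
  forall f : {linear P -> N}, exists g : {linear P -> M}, forall x, e (g x) = f x.

Lemma prod_projective (P Q : lmodType R^c) :
  projective P -> projective Q -> projective (P * Q)%type.
Proof.
move=> hP hQ M N e es f.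
pose iP (x : P) : P * Q := (x, 0); pose iQ (y : Q) : P * Q := (0, y).
have iPl : linear iP by move=> a x y; rewrite /iP; congr pair; rewrite /= scaler0 addr0.
have iQl : linear iQ by move=> a x y; rewrite /iQ; congr pair; rewrite /= scaler0 addr0.
pose iPL : {linear P -> (P * Q)%type} :=
  HB.pack iP (GRing.isLinear.Build R^c P (P * Q)%type *:%R iP iPl).
pose iQL : {linear Q -> (P * Q)%type} :=
  HB.pack iQ (GRing.isLinear.Build R^c Q (P * Q)%type *:%R iQ iQl).
have [gP gPE] := hP _ _ e es (f \o iPL).
have [gQ gQE] := hQ _ _ e es (f \o iQL).
exists ((gP \o fst) \+ (gQ \o snd)) => -[x y] /=.
rewrite raddfD /= gPE gQE /= -raddfD /=; congr (f _).
by apply: injective_projections; rewrite /= ?addr0 ?add0r.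
Qed.

Lemma zero_projective : projective 'rV[R^c]_0.
Proof.
by move=> M N e _ f; exists \0 => x; rewrite (thinmx0 x) !raddf0.
Qed.

Definition is_kernel (M N K : fgmod) (i : lhom K M) (f : lhom M N) : Prop :=
  injective i /\ exact_at i f.

Definition is_cokernel (M N K : fgmod) (f : lhom M N) (c : lhom N K) : Prop :=
  exact_at f c /\ surj c.

(* As all modules here are finitely generated, so are the projectives P i and Q. *)
Definition gorenstein_projective (G : fgmod) : Prop :=
  exists (P : int -> fgmod) (d : forall i : int, lhom (P i) (P (i + 1))),
    [/\ forall i, projective (P i),
        forall i, exact_at (d i) (d (i + 1)),
        forall Q : fgmod, projective Q -> forall i,
          exact_at (fun h : lhom (P (i + 1 + 1)) Q => lhom_comp h (d (i + 1)))
                   (fun h : lhom (P (i + 1)) Q => lhom_comp h (d i))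
      & exists (i : int) (j : lhom G (P i)), is_kernel j (d i)].

(* A projective cover is an essential epimorphism from a projective module. *)
Definition proj_cover (P G : fgmod) (p : lhom P G) : Prop :=
  [/\ projective P, surj p
    & forall (M : fgmod) (h : lhom M P), surj (lhom_comp p h) -> surj h].

Definition Gprj : preadditive := @fullsub modcat gorenstein_projective.

Definition through_projective (M N : fgmod) (f : lhom M N) : Prop :=
  exists (P : fgmod) (g : lhom P N) (h : lhom M P),
    projective P /\ f = lhom_comp g h.

Lemma through_projective0 (M N : Gprj) :
  through_projective (0 : lhom (sval M) (sval N)).
Proof.
exists zero_mod, 0, 0; split; first exact: zero_projective.
exact: lhomP.
Qed.

Lemma through_projectiveB (M N : Gprj) (f g : lhom (sval M) (sval N)) :
  through_projective f -> through_projective g -> through_projective (f - g).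
Proof.
move=> [P [a [b [Pp ->]]]] [Q [c [d [Qp ->]]]].
exists (prod_mod P Q).
exists (((a : {linear P -> sval N}) \o fst) \- ((c : {linear Q -> sval N}) \o snd)
        : {linear (P * Q)%type -> sval N}).
pose bd (x : sval M) : P * Q := (b x, d x).
have bdl : linear bd by move=> t x y; rewrite /bd !linearP.
pose bdL : {linear sval M -> (P * Q)%type} :=
  HB.pack bd (GRing.isLinear.Build R^c (sval M) (P * Q)%type *:%R bd bdl).
exists bdL.
split; first exact: prod_projective.
exact: lhomP.
Qed.

Lemma through_projectiveM (X Y Z T : Gprj) (h : hom Z T) (f : hom Y Z) (g : hom X Y) :
  through_projective f -> through_projective (h \oc f \oc g).
Proof.
move=> [P [a [b [Pp ->]]]]; exists P, (lhom_comp h a), (lhom_comp b g).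
by split => //; apply: lhomP.
Qed.

Definition projective_ideal : ideal Gprj :=
  @Ideal Gprj (fun M N => @through_projective (sval M) (sval N))
    through_projective0 through_projectiveB through_projectiveM.

Definition stable_Gprj : preadditive := quotcat projective_ideal.

Definition CM_finite : Prop :=
  @finitely_many_indec modcat gorenstein_projective.

Definition G_semisimple : Prop := semisimple_mod stable_Gprj.

(* The morphism category H(R). *)
Definition morcat : preadditive := arrowcat modcat.

Definition in_SGprj (X : morcat) : Prop :=
  [/\ injective (amap X : lhom _ _),
      gorenstein_projective (asrc X), gorenstein_projective (atgt X)
    & exists (K : fgmod) (c : lhom (atgt X) K),
        is_cokernel (amap X) c /\ gorenstein_projective K].

(* The category S(Gprj-R). *)
Definition SGprj : preadditive := @fullsub morcat in_SGprj.

Definition mor (M N : fgmod) (f : lhom M N) : morcat := @Arrow modcat M N f.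

End RightModules.

Section UpperTriangular.
Variable R : nzRingType.

(* With this shape a right T2-module is a pair of right R-modules with a linear
   map from the first (cut out by e_11) to the second (cut out by e_22). *)
Definition upper2 : {pred 'M[R]_2} := fun A => A 1 0 == 0.

Lemma upper2_closed : subring_closed upper2.
Proof.
split=> [|A B|A B]; rewrite !unfold_in /=; first by rewrite mxE.
  by move=> /eqP A0 /eqP B0; rewrite !mxE A0 B0 subrr.
move=> /eqP A0 /eqP B0.
rewrite mxE big_ord_recl big_ord1 A0 mul0r add0r.
by rewrite [X in _ * B X _](_ : _ = 1) ?B0 ?mulr0 //; apply: val_inj.
Qed.

HB.instance Definition _ := GRing.isSubringClosed.Build _ upper2 upper2_closed.

Record T2 := MkT2 { T2_val :> 'M[R]_2; T2P : T2_val \in upper2 }.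

HB.instance Definition _ := [isSub for T2_val].
HB.instance Definition _ := [Choice of T2 by <:].
HB.instance Definition _ := [SubChoice_isSubNzRing of T2 by <:].

End UpperTriangular.

(* Main.v *)
From Stdlib Require List.
From HB Require Import structures.
Require Import Defs.
From mathcomp Require Import all_boot all_order all_algebra.
From mathcomp Require Import generic_quotient ring_quotient boolp classical_sets.
(* The names hom and comp are those of preadditive categories from here on. *)
Import Defs.

(** Write G for the category of Gorenstein projective modules.

    Semisimplicity.  Let f : A -> B be a map of the stable category of G.  The
    cokernel of Hom(-,A) -> Hom(-,B) is projective in the category of finitely
    presented functors, hence a summand of Hom(-,B); by Yoneda this says that
    f = f g f for some g : B -> A ([semisimple_mod_regular]).  So for modules A
    and B in G, f agrees with f g f up to a map through a projective module
    ([stable_regular]).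

    Classification ([sgprj_classification]).  Let f : A -> B be an
    indecomposable monomorphism with cokernel C, all in G.  Endomorphism rings
    are modules of finite type over the Artinian base ring, and G is closed under
    direct summands ([retract_gp]), so every endomorphism of the arrow f is
    nilpotent or invertible ([fitting_sgprj]).  Apply this to (g f, f g).  If it
    is invertible, f is an isomorphism.  If it is nilpotent, then f = f (g f)^n
    modulo projectives factors through a projective module Q.  Since
    Ext^1(C, Q) = 0, the map A -> Q extends to B, whence an endomorphism (1, u)
    of f with u factoring through Q.  It is nilpotent only if A = 0, and
    otherwise B is a summand of Q, hence projective.  In this last case
    endomorphisms of C lift to the arrow, and the same dichotomy shows that
    B -> C is a projective cover of an indecomposable non-projective module.

    Finiteness ([cm_finite_list]).  There are finitely many simple modules S, each
    with a right approximation X -> S by a module of G.  A non-projective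
    indecomposable module M of G maps onto some S; this map factors as
    M -> X -> S and does not factor through a projective module.  Hence M -> X is
    stably nonzero, by regularity M is a direct summand of X, and X has finitely
    many indecomposable summands up to isomorphism.  With the classification this
    bounds the number of indecomposable arrows, as projective covers are unique.

    Triangular matrices ([triangular_cm_finite]).  Modules over the triangular
    matrix ring are the same as arrows of modules.  A complete resolution of the
    module of f : A -> B consists of arrows P -> Q that are split monomorphisms
    of projectives with projective cokernel, so it induces complete resolutions of
    B, of the cokernel of f and of A ([tgp_sgprj]).  So f is one of the arrows
    that have just been counted. *)

Set Implicit Arguments.
Unset Strict Implicit.
Unset Printing Implicit Defensive.

Import GRing.Theory.
Local Open Scope ring_scope.

(** * Idempotents, chain conditions and the Fitting lemma *)

Section Idempotents.
Variable C : preadditive.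
Implicit Types X Y : C.

Definition idempotents_split : Prop :=
  forall X (e : hom X X), e \oc e = e ->
  exists Y (i : hom Y X) (p : hom X Y), p \oc i = idm Y /\ i \oc p = e.

(** The images of e and 1 - e are complementary summands of X. *)
Lemma indecomposable_idem X (e : hom X X) :
  idempotents_split -> indecomposable X -> e \oc e = e -> e = 0 \/ e = idm X.
Proof.
move=> spl [_ indX] ee; set e' := idm X - e.
have e'e' : e' \oc e' = e'.
  by rewrite /e' compBl !compBr !(compm1, comp1m) ee subrr subr0.
have ee' : e \oc e' = 0 by rewrite /e' compBr compm1 ee subrr.
have e'e : e' \oc e = 0 by rewrite /e' compBl comp1m ee subrr.
have [Y [i [p [pi ip]]]] := spl _ _ ee.
have [Y' [i' [p' [pi' ip']]]] := spl _ _ e'e'.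
have pe : p \oc e = p by rewrite -ip compA pi comp1m.
have ei : e \oc i = i by rewrite -ip -compA pi compm1.
have pe' : p' \oc e' = p' by rewrite -ip' compA pi' comp1m.
have ei' : e' \oc i' = i' by rewrite -ip' -compA pi' compm1.
have [|Y0|Y'0] := indX Y Y'.
- exists i, i', p, p'; split; [by []|by []|..].
  + by rewrite -pe -ei' compA -(compA p) ee' compm0 comp0m.
  + by rewrite -pe' -ei compA -(compA p') e'e compm0 comp0m.
  + by rewrite ip ip' /e' addrC subrK.
- by left; rewrite -ip -(comp1m p) Y0 comp0m compm0.
- right; have : e' = 0 by rewrite -ip' -(comp1m p') Y'0 comp0m compm0.
  by move/eqP; rewrite /e' subr_eq0 => /eqP.
Qed.

Fixpoint cpow X (f : hom X X) (n : nat) : hom X X :=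
  if n is m.+1 then f \oc cpow f m else idm X.

Lemma cpowS X (f : hom X X) n : cpow f n.+1 = f \oc cpow f n.
Proof. by []. Qed.

Lemma cpowD X (f : hom X X) m n : cpow f (m + n) = cpow f m \oc cpow f n.
Proof. by elim: m => [|m IH] /=; rewrite ?comp1m // IH compA. Qed.

Lemma cpowSr X (f : hom X X) n : cpow f n.+1 = cpow f n \oc f.
Proof. by rewrite -addn1 cpowD /= compm1. Qed.

End Idempotents.

Lemma iso_refl (C : preadditive) (X : C) : iso X X.
Proof. by exists (idm X), (idm X); rewrite comp1m. Qed.

Lemma iso_sym (C : preadditive) (X Y : C) : iso X Y -> iso Y X.
Proof. by move=> [f [g [gf fg]]]; exists g, f. Qed.

Lemma iso_trans (C : preadditive) (X Y Z : C) : iso X Y -> iso Y Z -> iso X Z.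
Proof.
move=> [f [g [gf fg]]] [f' [g' [gf' fg']]]; exists (f' \oc f), (g \oc g').
by rewrite -!compA (compA g') (compA f) gf' fg !comp1m.
Qed.

Lemma indecomposable_of_idem (C : preadditive) (X : C) : ~ zero_obj X ->
  (forall e : hom X X, e \oc e = e -> e = 0 \/ e = idm X) -> indecomposable X.
Proof.
move=> nz idX; split=> // A B [i1 [i2 [p1 [p2 [e1 e2 e12 e21 one]]]]].
have [|e0|eX] := idX (i1 \oc p1).
- by rewrite -compA (compA p1) e1 comp1m.
- left; rewrite /zero_obj -e1 -[p1]comp1m -e1 -compA -(compA p1) (compA i1).
  by rewrite e0 comp0m compm0.
right; have i20 : i2 = 0 by rewrite -[i2]comp1m -eX -compA e12 compm0.
by rewrite /zero_obj -e2 i20 compm0.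
Qed.

Lemma projective_obj_iso (C : preadditive) (X Y : C) :
  iso X Y -> projective_obj Y -> projective_obj X.
Proof.
move=> [u [v [vu _]]] pY Z W e epie f; have [g gE] := pY _ _ e epie (f \oc v).
by exists (g \oc u); rewrite compA gE -compA vu compm1.
Qed.

Lemma indecomposable_iso (C : preadditive) (X Y : C) :
  iso X Y -> indecomposable X -> indecomposable Y.
Proof.
move=> [u [v [vu uv]]] [nz indX]; split=> [Y0|A B [iA [iB [pA [pB [e1 e2 e3 e4 e5]]]]]].
  by apply: nz; rewrite /zero_obj -vu -[u]comp1m Y0 comp0m compm0.
apply: indX; exists (v \oc iA), (v \oc iB), (pA \oc u), (pB \oc u).
have K (Z W : C) (g : hom Y Z) (h : hom W Y) : (g \oc u) \oc (v \oc h) = g \oc h.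
  by rewrite -compA (compA u) uv comp1m.
split; rewrite ?K //.
by rewrite !compA -compDl -!(compA v) -compDr e5 compm1.
Qed.

Section Dcc.
Variable K : Type.

(** Additive groups with an arbitrary family of operators treat ideals of the
    base ring, submodules and one-sided ideals of endomorphism rings alike. *)
Definition opsub (V : zmodType) (act : K -> V -> V) (U : V -> Prop) : Prop :=
  [/\ U 0, forall x y, U x -> U y -> U (x - y) & forall c x, U x -> U (act c x)].

Definition dcc (V : zmodType) (act : K -> V -> V) : Prop :=
  forall U : nat -> V -> Prop, (forall n, opsub act (U n)) ->
  (forall n x, U n.+1 x -> U n x) ->
  exists N, forall n x, (N <= n)%N -> U N x -> U n x.

Lemma chain_le (V : Type) (U : nat -> V -> Prop) :
  (forall n x, U n.+1 x -> U n x) -> forall m n x, (m <= n)%N -> U n x -> U m x.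
Proof.
move=> Udec m n x /subnK <-; elim: (n - m)%N => // d IH Ux.
exact/IH/Udec.
Qed.

Lemma dcc_surj (V W : zmodType) (aV : K -> V -> V) (aW : K -> W -> W)
    (q : {additive V -> W}) :
  (forall c x, q (aV c x) = aW c (q x)) -> surj q -> dcc aV -> dcc aW.
Proof.
move=> qa qs dV U Uop Udec.
have [|n x|N NP] := dV (fun n x => U n (q x)); last 1 first.
- by exists N => n y le; have [x <-] := qs y; exact: NP.
- move=> n; have [U0 UB UA] := Uop n; split; first by rewrite raddf0.
    by move=> x y Ux Uy; rewrite raddfB; exact: UB.
  by move=> c x Ux; rewrite qa; exact: UA.
- exact: Udec.
Qed.

Lemma opsubD (V : zmodType) (act : K -> V -> V) (U : V -> Prop) x y :
  opsub act U -> U x -> U y -> U (x + y).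
Proof.
move=> [U0 UB _] Ux Uy; rewrite -(opprK y); apply: (UB) => //.
by rewrite -sub0r; exact: UB.
Qed.

(** The common kernels of the maps p i with i >= m form a finite filtration of V
    whose layers embed into W; the descending chain condition passes through it
    one layer at a time. *)
Lemma dcc_joint (V W : zmodType) (aV : K -> V -> V) (aW : K -> W -> W) (n : nat)
    (p : 'I_n -> {additive V -> W}) :
  (forall i c x, p i (aV c x) = aW c (p i x)) -> (forall c, aW c 0 = 0) ->
  (forall x, (forall i, p i x = 0) -> x = 0) -> dcc aW -> dcc aV.
Proof.
move=> pa aW0 pinj dW.
suff H m : forall U : nat -> V -> Prop, (forall n, opsub aV (U n)) ->
    (forall n x, U n.+1 x -> U n x) ->
    (forall j x, U j x -> forall i : 'I_n, (m <= i)%N -> p i x = 0) ->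
    exists N, forall n x, (N <= n)%N -> U N x -> U n x.
  move=> U Uop Udec; apply: (H n U Uop Udec) => j x _ i.
  by rewrite leqNgt ltn_ord.
elim: m => [|m IH] U Uop Udec Uk.
  exists 0%N => j x _ Ux; rewrite (pinj x); last by move=> i; exact: Uk Ux _ _.
  by have [] := Uop j.
have [lt_mn|ge_mn] := ltnP m n; last first.
  apply: IH => // j x Ux i le_mi; move: (ltn_ord i).
  by rewrite ltnNge (leq_trans ge_mn).
pose pm := p (Ordinal lt_mn).
have [|||N1 N1P] := IH (fun j x => U j x /\ pm x = 0).
- move=> j; have [U0 UB UA] := Uop j; split; first by split; rewrite ?raddf0.
    by move=> x y [Ux x0] [Uy y0]; split; [exact: UB|rewrite raddfB x0 y0 subrr].
  by move=> c x [Ux x0]; split; [exact: UA|rewrite /pm pa -/pm x0 aW0].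
- by move=> j x [/Udec Ux x0].
- move=> j x [Ux x0] i; rewrite leq_eqVlt => /orP[/eqP im|]; last exact: Uk Ux i.
  by rewrite -x0 /pm; congr (p _ _); apply: val_inj.
have [||N2 N2P] := dW (fun j w => exists2 x, U j x & pm x = w).
- move=> j; have [U0 UB UA] := Uop j; split; first by exists 0; rewrite ?raddf0.
    move=> _ _ [x Ux <-] [y Uy <-]; exists (x - y); [exact: UB|by rewrite raddfB].
  by move=> c _ [x Ux <-]; exists (aV c x); [exact: UA|rewrite /pm pa].
- by move=> j w [x /Udec Ux <-]; exists x.
exists (maxn N1 N2) => j x; rewrite geq_max => /andP[le1 le2] Ux.
have [|x' Ux' xx'] := N2P j (pm x) le2.
  by exists x => //; apply: chain_le Ux => //; exact: leq_maxr.
rewrite -(subrK x' x); apply: opsubD => //.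
have [] // := N1P j (x - x') le1; split; last by rewrite raddfB xx' subrr.
have [_ UB _] := Uop N1; apply: UB.
  by apply: chain_le Ux => //; exact: leq_maxl.
exact: chain_le Ux'.
Qed.

End Dcc.

(** A family without a minimal member yields a strictly descending chain. *)
Lemma dcc_min (K : Type) (V : zmodType) (act : K -> V -> V)
    (P : (V -> Prop) -> Prop) :
  dcc act -> (exists U, opsub act U /\ P U) ->
  exists U, [/\ opsub act U, P U & forall U', opsub act U' -> P U' ->
    (forall x, U' x -> U x) -> forall x, U x -> U' x].
Proof.
move=> dV [U0 [opU0 PU0]]; apply: contrapT => nomin.
pose T := {U : V -> Prop | opsub act U /\ P U}.
have /choice[next nextP] : forall t : T, exists t' : T,
    (forall x, sval t' x -> sval t x) /\ ~ (forall x, sval t x -> sval t' x).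
  move=> [U [opU PU]]; apply: contrapT => nex; apply: nomin; exists U; split=> //.
  move=> U' opU' PU' U'U; apply: contrapT => nUU'; apply: nex.
  by exists (exist _ U' (conj opU' PU')).
pose u n := iter n next (exist _ U0 (conj opU0 PU0)).
have [n|n x|N NP] := dV (fun n => sval (u n)).
- by have [] := svalP (u n).
- by have [+ _] := nextP (u n); apply.
by have [_ []] := nextP (u N) => x; apply: (NP N.+1).
Qed.

Section Fitting.
Variables (C : preadditive) (X : C) (K : Type) (act : K -> hom X X -> hom X X).
Hypothesis actl : forall c f g, act c (f \oc g) = act c f \oc g.
Hypothesis actr : forall c f g, act c (f \oc g) = f \oc act c g.

(** The chains of one-sided ideals generated by the powers of f stabilize on both
    sides, so some power p of f satisfies p = p^2 a = b p^2.  Then p a = b p is an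
    idempotent: it is 0 when f is nilpotent and 1 when f is invertible. *)
Lemma fitting_lemma (f : hom X X) :
  idempotents_split C -> indecomposable X -> dcc act ->
  (exists n, cpow f n = 0) \/ (exists g, g \oc f = idm X /\ f \oc g = idm X).
Proof.
move=> spl indX dX.
have [||N1 N1P] := dX (fun n h => exists g, h = cpow f n \oc g).
- move=> n; split; first by exists 0; rewrite compm0.
    by move=> _ _ [g ->] [h ->]; exists (g - h); rewrite compBr.
  by move=> c _ [g ->]; exists (act c g); rewrite actr.
- by move=> n _ [g ->]; exists (f \oc g); rewrite cpowSr compA.
have [||N2 N2P] := dX (fun n h => exists g, h = g \oc cpow f n).
- move=> n; split; first by exists 0; rewrite comp0m.
    by move=> _ _ [g ->] [h ->]; exists (g - h); rewrite compBl.
  by move=> c _ [g ->]; exists (act c g); rewrite actl.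
- by move=> n _ [g ->]; exists (g \oc f); rewrite /= compA.
(* A positive exponent, so that invertibility of p gives that of f. *)
pose N := maxn N1 N2; pose p := cpow f N.+1.
have le1 : (N1 <= N.+1)%N by rewrite leqW ?leq_maxl.
have le2 : (N2 <= N.+1)%N by rewrite leqW ?leq_maxr.
have [a aE] : exists a, p = p \oc p \oc a.
  have [||a aE] := N1P (N1 + N.+1)%N (cpow f N1); first exact: leq_addr.
    by exists (idm X); rewrite compm1.
  exists a; rewrite {1}/p -(subnK le1) cpowD aE cpowD !compA -cpowD.
  by rewrite (subnK le1).
have [b bE] : exists b, p = b \oc (p \oc p).
  have [||b bE] := N2P (N2 + N.+1)%N (cpow f N2); first exact: leq_addr.
    by exists (idm X); rewrite comp1m.
  exists b; rewrite {1}/p -(subnKC le2) cpowD bE (addnC N2) cpowD -!compA.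
  by rewrite -cpowD (subnKC le2).
have ab : p \oc a = b \oc p.
  by rewrite [in LHS]bE [in RHS]aE !compA.
have ee : (p \oc a) \oc (p \oc a) = p \oc a.
  by rewrite {1}ab [in RHS]bE !compA.
have [e0|e1] := indecomposable_idem spl indX ee.
  by left; exists N.+1; rewrite -/p bE compA -ab e0 comp0m.
right; have l1 : (b \oc cpow f N) \oc f = idm X by rewrite -compA -cpowSr -/p -ab.
have r1 : f \oc (cpow f N \oc a) = idm X by rewrite compA.
exists (b \oc cpow f N); split => //.
have -> : b \oc cpow f N = cpow f N \oc a; last exact: r1.
by rewrite -[LHS]compm1 -r1 compA l1 comp1m.
Qed.

End Fitting.

Section VonNeumannRegular.
Variables (C : preadditive) (A B : C) (f : hom A B).

Definition image_pred (Y : C) : {pred hom Y B} :=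
  fun h => `[< exists g : hom Y A, h = f \oc g >].

Lemma image_predP Y (h : hom Y B) :
  reflect (exists g : hom Y A, h = f \oc g) (h \in @image_pred Y).
Proof. exact: asboolP. Qed.

Lemma image_pred_closed Y : zmod_closed (@image_pred Y).
Proof.
split=> [|g h /image_predP[g' ->] /image_predP[h' ->]]; apply/image_predP.
  by exists 0; rewrite compm0.
by exists (g' - h'); rewrite compBr.
Qed.

HB.instance Definition _ Y :=
  GRing.isZmodClosed.Build (hom Y B) (@image_pred Y) (@image_pred_closed Y).

Definition coker_ob (Y : C) : zmodType := {ideal_quot (@image_pred Y)}.
Definition coker_pi (Y : C) (h : hom Y B) : coker_ob Y := (\pi h)%qT.

Lemma coker_piP Y (g h : hom Y B) :
  coker_pi g = coker_pi h <-> exists u : hom Y A, g - h = f \oc u.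
Proof.
rewrite /coker_pi; split=> [/eqP|H].
  by rewrite -Quotient.idealrBE => /image_predP.
by apply/eqP; rewrite -Quotient.idealrBE; apply/image_predP.
Qed.

Lemma coker_pi_is_additive Y : zmod_morphism (@coker_pi Y).
Proof. by move=> g h; rewrite /coker_pi !piE. Qed.

HB.instance Definition _ Y :=
  GRing.isZmodMorphism.Build (hom Y B) (coker_ob Y) (@coker_pi Y)
    (@coker_pi_is_additive Y).

Lemma coker_piK Y (x : coker_ob Y) : coker_pi (repr x) = x.
Proof. by rewrite /coker_pi reprK. Qed.

Definition coker_map (Y Z : C) (u : hom Y Z) (x : coker_ob Z) : coker_ob Y :=
  coker_pi (repr x \oc u).

Lemma coker_mapE (Y Z : C) (u : hom Y Z) (h : hom Z B) :
  coker_map u (coker_pi h) = coker_pi (h \oc u).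
Proof.
apply/coker_piP; have /coker_piP[v vE] := coker_piK (coker_pi h).
by exists (v \oc u); rewrite -compBl vE compA.
Qed.

Lemma coker_map_is_additive (Y Z : C) (u : hom Y Z) : zmod_morphism (coker_map u).
Proof.
move=> x y; rewrite -(coker_piK x) -(coker_piK y) -raddfB !coker_mapE.
by rewrite compBl raddfB.
Qed.

HB.instance Definition _ (Y Z : C) (u : hom Y Z) :=
  GRing.isZmodMorphism.Build (coker_ob Z) (coker_ob Y) (coker_map u)
    (coker_map_is_additive u).

Lemma coker_map1 Y (x : coker_ob Y) : coker_map (idm Y) x = x.
Proof. by rewrite -(coker_piK x) coker_mapE compm1. Qed.

Lemma coker_mapM (Y Z T : C) (v : hom Z T) (u : hom Y Z) (x : coker_ob T) :
  coker_map (v \oc u) x = coker_map u (coker_map v x).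
Proof. by rewrite -(coker_piK x) !coker_mapE compA. Qed.

Lemma coker_mapD (Y Z : C) (u u' : hom Y Z) (x : coker_ob Z) :
  coker_map (u + u') x = coker_map u x + coker_map u' x.
Proof. by rewrite -(coker_piK x) !coker_mapE compDr raddfD. Qed.

Definition coker : cofunctor C :=
  @Cofunctor C coker_ob (fun Y Z u => coker_map u) coker_map1 coker_mapM coker_mapD.

Definition coker_proj : nattrans (yoneda B) coker :=
  @Nattrans C (yoneda B) coker (fun Y => @coker_pi Y : {additive _ -> _})
    (fun X Y u x => esym (coker_mapE u x)).

Section Postcomp.
Variable Y : C.
Definition postcomp (g : hom Y A) : hom Y B := f \oc g.
Lemma postcomp_is_additive : zmod_morphism postcomp.
Proof. by move=> g h; rewrite /postcomp compBr. Qed.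
HB.instance Definition _ :=
  GRing.isZmodMorphism.Build (hom Y A) (hom Y B) postcomp postcomp_is_additive.
End Postcomp.

Definition postcomp_trans : nattrans (yoneda A) (yoneda B) :=
  @Nattrans C (yoneda A) (yoneda B) (fun Y => @postcomp Y : {additive _ -> _})
    (fun X Y u x => compA f x u).

Lemma coker_fp : finitely_presented coker.
Proof.
exists A, B, postcomp_trans, coker_proj => Y; split; last first.
  by move=> x; exists (repr x); exact: coker_piK.
move=> h; rewrite -[0](raddf0 (@coker_pi Y)); split=> [/coker_piP[u]|[u <-]].
  by rewrite subr0 => ->; exists u.
by apply/coker_piP; exists u; rewrite subr0.
Qed.

Lemma yoneda_fp : finitely_presented (yoneda B).
Proof.
pose z Y : {additive hom Y B -> hom Y B} := \0.
have zP X Y (u : hom X Y) (x : hom Y B) :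
  z X (fmap (yoneda B) u x) = fmap (yoneda B) u (z Y x) by rewrite raddf0.
pose o Y : {additive hom Y B -> hom Y B} := idfun.
exists B, B, (@Nattrans C (yoneda B) (yoneda B) z zP),
  (@Nattrans C (yoneda B) (yoneda B) o (fun _ _ _ _ => erefl)) => Y.
split=> x; last by exists x.
by split=> [/= ->|[y <-] //]; exists 0.
Qed.

(** Projectivity of the cokernel of Hom(-,A) -> Hom(-,B) provides a section of
    Hom(-,B) -> coker; by Yoneda it comes from an endomorphism e of B with
    e f = 0 such that 1 - e factors through f. *)
Lemma semisimple_mod_regular :
  semisimple_mod C -> exists g : hom B A, f \oc g \oc f = f.
Proof.
move=> ss.
have epi_pi : fp_epi coker_proj.
  move=> H _ u v uv Y x; rewrite -(coker_piK x); exact: uv.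
have [s sE] := ss _ coker_fp _ _ yoneda_fp coker_fp _ epi_pi
  (@Nattrans C coker coker (fun Y => idfun) (fun _ _ _ _ => erefl)).
pose e : hom B B := s B (coker_pi (idm B)).
have [g gE] : exists g : hom B A, e - idm B = f \oc g.
  by apply/coker_piP; rewrite -[RHS](sE B).
exists (- g); rewrite compmN -gE opprB compBl comp1m.
rewrite -[RHS]subr0; congr (_ - _).
have -> : e \oc f = s A (coker_pi f).
  rewrite -[in RHS](comp1m f) -coker_mapE.
  by rewrite (ntP s f (coker_pi (idm B))).
suff -> : coker_pi f = 0 by rewrite raddf0.
rewrite -[0](raddf0 (@coker_pi A)); apply/coker_piP.
by exists (idm A); rewrite subr0 compm1.
Qed.

End VonNeumannRegular.

(** * Linear maps, submodules and quotients *)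

Section Modules.
Variable R : nzRingType.
Implicit Types M N K : lmodType R^c.

Section LhomMorph.
Variables (M N : lmodType R^c) (f : lhom M N).

(** The generic morphism equations leave f in the form of an additive map, which
    hypotheses about f as an [lhom] do not match. *)
Lemma lmap0 : f 0 = 0. Proof. exact: raddf0. Qed.
Lemma lmapD x y : f (x + y) = f x + f y. Proof. exact: raddfD. Qed.
Lemma lmapN x : f (- x) = - f x. Proof. exact: raddfN. Qed.
Lemma lmapB x y : f (x - y) = f x - f y. Proof. exact: raddfB. Qed.
Lemma lmapZ a x : f (a *: x) = a *: f x. Proof. exact: linearZ. Qed.
Lemma lmapP a x y : f (a *: x + y) = a *: f x + f y. Proof. exact: linearP. Qed.
Lemma lmap_sum (I : finType) (v : I -> M) : f (\sum_i v i) = \sum_i f (v i).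
Proof. exact: raddf_sum. Qed.

End LhomMorph.

Lemma lhom_ex M N (f : M -> N) : linear f -> exists g : lhom M N, forall x, g x = f x.
Proof.
move=> fl; pose g : {linear M -> N} :=
  HB.pack f (GRing.isLinear.Build R^c M N *:%R f fl).
by exists g.
Qed.

(** For maps defined through a choice of preimages: linearity and the value at 0
    are enough to make the relation functional. *)
Lemma lhom_of_rel M N (r : M -> N -> Prop) :
  (forall x, exists y, r x y) ->
  (forall a x y x' y', r x y -> r x' y' -> r (a *: x + x') (a *: y + y')) ->
  (forall y, r 0 y -> y = 0) ->
  exists g : lhom M N, forall x y, r x y -> g x = y.
Proof.
move=> /choice[f fP] rl r0.
have func x y y' : r x y -> r x y' -> y = y'.
  move=> rxy rxy'; have := rl (-1) _ _ _ _ rxy' rxy.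
  by rewrite !scaleN1r addNr => /r0 /eqP; rewrite addrC subr_eq0 => /eqP.
have [g gE] : exists g : lhom M N, forall x, g x = f x.
  apply: lhom_ex => a x y; apply: func (fP _) _; exact: rl.
by exists g => x y rxy; rewrite gE; exact: func rxy.
Qed.

Lemma lhom_factor M N K (p : lhom M N) (h : lhom M K) :
  surj p -> (forall x, p x = 0 -> h x = 0) ->
  exists g : lhom N K, forall x, g (p x) = h x.
Proof.
move=> ps ph.
have [|||g gP] := @lhom_of_rel N K (fun y z => exists x, p x = y /\ h x = z).
- by move=> y; have [x <-] := ps y; exists (h x), x.
- move=> a _ _ _ _ [x [<- <-]] [x' [<- <-]]; exists (a *: x + x').
  by rewrite !lmapP.
- by move=> _ [x [px <-]]; exact: ph.
by exists g => x; apply: gP; exists x.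
Qed.

Lemma lhom_lift M N K (i : lhom M N) (h : lhom K N) :
  injective i -> (forall x, exists y, i y = h x) ->
  exists g : lhom K M, forall x, i (g x) = h x.
Proof.
move=> ii hi.
have [|||g gP] := @lhom_of_rel K M (fun x y => i y = h x) => //.
- by move=> a x y x' y' xy x'y'; rewrite !lmapP xy x'y'.
- by move=> y; rewrite lmap0 -[0](lmap0 i) => /ii.
by exists g => x; have [y yx] := hi x; rewrite (gP x y).
Qed.

Lemma lhom_inj M N (f : lhom M N) : (forall x, f x = 0 -> x = 0) -> injective f.
Proof.
move=> f0 x y /eqP; rewrite -subr_eq0 -lmapB => /eqP /f0 /eqP.
by rewrite subr_eq0 => /eqP.
Qed.

Lemma lhom_inv M N (f : lhom M N) : injective f -> surj f ->
  exists g : lhom N M, (forall x, g (f x) = x) /\ (forall y, f (g y) = y).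
Proof.
move=> fi fs; have [g gf] := @lhom_lift _ _ _ f (lhom_id N) fi fs.
by exists g; split=> // x; apply: fi; rewrite gf.
Qed.

Section Submodule.
Variables (M : lmodType R^c) (U : M -> Prop).
Hypotheses (U0 : U 0) (UL : forall a x y, U x -> U y -> U (a *: x + y)).

Definition submod_pred : {pred M} := fun x => `[< U x >].

Lemma submod_pred_closed : submod_closed submod_pred.
Proof.
split=> [|a x y /asboolP Ux /asboolP Uy]; apply/asboolP => //; exact: UL.
Qed.

HB.instance Definition _ :=
  GRing.isSubmodClosed.Build R^c M submod_pred submod_pred_closed.

Record submod := Submod { submod_val :> M; submodP : submod_val \in submod_pred }.

HB.instance Definition _ := [isSub for submod_val].
HB.instance Definition _ := [Choice of submod by <:].
HB.instance Definition _ := [SubChoice_isSubLmodule of submod by <:].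

Lemma submod_ex : exists (S : lmodType R^c) (i : lhom S M),
  injective i /\ forall x, U x <-> exists s, i s = x.
Proof.
exists (submod : lmodType R^c), (val : {linear submod -> M}); split.
  exact: val_inj.
move=> x; split=> [Ux|[s <-]]; last exact/asboolP/(valP s).
by exists (Submod (asboolT Ux : x \in submod_pred)).
Qed.

End Submodule.

Section QuotientModule.
Variables (M : lmodType R^c) (U : M -> Prop).
Hypotheses (U0 : U 0) (UL : forall a x y, U x -> U y -> U (a *: x + y)).

Definition quotmod_pred : {pred M} := fun x => `[< U x >].

Lemma quotmod_pred_closed : zmod_closed quotmod_pred.
Proof.
split=> [|x y /asboolP Ux /asboolP Uy]; apply/asboolP => //.
by rewrite addrC -scaleN1r; exact: UL.
Qed.

HB.instance Definition _ :=
  GRing.isZmodClosed.Build M quotmod_pred quotmod_pred_closed.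

Definition quotmod : Type := {ideal_quot quotmod_pred}.
HB.instance Definition _ := GRing.Zmodule.on quotmod.
Definition quotmod_pi (x : M) : quotmod := (\pi_{ideal_quot quotmod_pred} x)%qT.

Lemma quotmod_piP x y : quotmod_pi x = quotmod_pi y <-> U (x - y).
Proof.
rewrite /quotmod_pi; split=> [/eqP|H].
  by rewrite -Quotient.idealrBE => /asboolP.
by apply/eqP; rewrite -Quotient.idealrBE; apply/asboolP.
Qed.

Lemma quotmod_piK (x : quotmod) : quotmod_pi (repr (x : {ideal_quot quotmod_pred})) = x.
Proof. by rewrite /quotmod_pi reprK. Qed.

Lemma quotmod_piD x y : quotmod_pi (x + y) = quotmod_pi x + quotmod_pi y.
Proof. by rewrite /quotmod_pi !piE. Qed.

Definition quotmod_scale (a : R^c) (x : quotmod) : quotmod :=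
  quotmod_pi (a *: repr (x : {ideal_quot quotmod_pred})).

Lemma quotmod_scaleE a x : quotmod_scale a (quotmod_pi x) = quotmod_pi (a *: x).
Proof.
apply/quotmod_piP; rewrite -scalerBr -[_ *: _]addr0; apply: UL => //.
by apply/quotmod_piP; exact: quotmod_piK.
Qed.

Lemma quotmod_scaleA a b x :
  quotmod_scale a (quotmod_scale b x) = quotmod_scale (a * b) x.
Proof. by rewrite -(quotmod_piK x) !quotmod_scaleE scalerA. Qed.

Lemma quotmod_scale1 : left_id 1 quotmod_scale.
Proof. by move=> x; rewrite -(quotmod_piK x) quotmod_scaleE scale1r. Qed.

Lemma quotmod_scaleDr : right_distributive quotmod_scale +%R.
Proof.
move=> a x y; rewrite -(quotmod_piK x) -(quotmod_piK y) -quotmod_piD.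
by rewrite !quotmod_scaleE scalerDr quotmod_piD.
Qed.

Lemma quotmod_scaleDl x : {morph quotmod_scale^~ x : a b / a + b}.
Proof.
by move=> a b; rewrite -(quotmod_piK x) !quotmod_scaleE scalerDl quotmod_piD.
Qed.

HB.instance Definition _ := GRing.Zmodule_isLmodule.Build R^c quotmod
  quotmod_scaleA quotmod_scale1 quotmod_scaleDr quotmod_scaleDl.

Lemma quot_ex : exists (Q : lmodType R^c) (c : lhom M Q),
  surj c /\ forall x, c x = 0 <-> U x.
Proof.
have [|c cE] := @lhom_ex M (quotmod : lmodType R^c) quotmod_pi.
  by move=> a x y; rewrite quotmod_piD -quotmod_scaleE.
exists (quotmod : lmodType R^c), c; split.
  by move=> y; exists (repr (y : {ideal_quot quotmod_pred})); rewrite cE quotmod_piK.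
move=> x; have <- : c 0 = 0 by exact: lmap0.
by rewrite !cE -{2}(subr0 x); exact: quotmod_piP.
Qed.

End QuotientModule.

Lemma fg_surj M N (f : lhom M N) :
  surj f -> finitely_generated M -> finitely_generated N.
Proof.
move=> fs [n [v vP]]; exists n, (fun i => f (v i)) => y.
have [x <-] := fs y; have [c ->] := vP x; exists c.
by rewrite lmap_sum; apply: eq_bigr => i _; rewrite lmapZ.
Qed.

Lemma fg_ext M N K (i : lhom M N) (p : lhom N K) :
  exact_at i p -> surj p -> finitely_generated M -> finitely_generated K ->
  finitely_generated N.
Proof.
move=> ip ps [m [u uP]] [n [w wP]].
have /choice[v vP] : forall j, exists x, p x = w j by move=> j; exact: ps.
exists (m + n)%N, (fun j => match split j with inl a => i (u a) | inr b => v b end).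
move=> x; have [d dE] := wP (p x).
have [y yE] : exists y, i y = x - \sum_j d j *: v j.
  apply/ip; rewrite lmapB dE lmap_sum.
  by under [X in _ - X]eq_bigr => j _ do rewrite lmapZ vP; rewrite subrr.
have [c cE] := uP y.
exists (fun j => match split j with inl a => c a | inr b => d b end).
have sl a : split (lshift n a : 'I_(m + n)) = inl a by exact: (unsplitK (inl a)).
have sr b : split (rshift m b : 'I_(m + n)) = inr b by exact: (unsplitK (inr b)).
rewrite big_split_ord /=; under eq_bigr => a _ do rewrite sl.
under [X in _ = _ + X]eq_bigr => b _ do rewrite sr.
apply/eqP; rewrite -subr_eq -yE cE lmap_sum; apply/eqP.
by apply: eq_bigr => a _; rewrite lmapZ.
Qed.

Lemma kernel_ex M N (f : lhom M N) :
  exists (K : lmodType R^c) (i : lhom K M), injective i /\ exact_at i f.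
Proof.
apply: (@submod_ex M (fun x => f x = 0)); first exact: lmap0.
by move=> a x y fx fy; rewrite lmapP fx fy scaler0 addr0.
Qed.

(** Images of finitely generated modules are finitely generated, in contrast to
    kernels over a ring that need not be Noetherian; so the kernels needed below
    are obtained as images or as extensions. *)
Lemma image_ex (M N : fgmod R) (f : lhom M N) :
  exists (K : fgmod R) (p : lhom M K) (i : lhom K N),
    [/\ surj p, injective i & forall x, i (p x) = f x].
Proof.
have [||I [i [ii iE]]] := @submod_ex N (fun y => exists x, f x = y).
- by exists 0; rewrite lmap0.
- by move=> a _ _ [x <-] [y <-]; exists (a *: x + y); rewrite lmapP.
have [p pE] : exists p : lhom M I, forall x, i (p x) = f x.
  by apply: lhom_lift => // x; apply/iE; exists x.
have ps : surj p.
  move=> s; have /iE[x xE] : exists s', i s' = i s by exists s.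
  by exists x; apply: ii; rewrite pE.
by exists (Fgmod (fg_surj ps (fgmodP M))), p, i.
Qed.

Lemma cokernel_ex (M N : fgmod R) (f : lhom M N) :
  exists (K : fgmod R) (c : lhom N K), is_cokernel f c.
Proof.
have [||Q [c [cs cE]]] := @quot_ex N (fun y => exists x, f x = y).
- by exists 0; rewrite lmap0.
- by move=> a _ _ [x <-] [y <-]; exists (a *: x + y); rewrite lmapP.
by exists (Fgmod (fg_surj cs (fgmodP N))), c.
Qed.

Definition submodule M (U : M -> Prop) : Prop :=
  U 0 /\ forall a x y, U x -> U y -> U (a *: x + y).

Lemma image_submodule M N (f : lhom M N) : submodule (fun y => exists x, f x = y).
Proof.
split; first by exists 0; exact: lmap0.
by move=> a _ _ [x <-] [y <-]; exists (a *: x + y); exact: lmapP.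
Qed.

Lemma modcat_split : idempotents_split (modcat R).
Proof.
move=> M e ee; have [K [p [i [ps ii ip]]]] := image_ex e.
exists K, i, p; split; last exact: lhomP.
apply: lhomP => y; apply: ii; have [x <-] := ps y; rewrite /= !ip.
exact: (congr1 (fun u : lhom M M => u x) ee).
Qed.

End Modules.

(** * Modules over Artin algebras *)

Section Scalars.
Variables (k : comNzRingType) (L : algType k).
Implicit Types M N : lmodType L^c.

Definition kact M (c : k) (x : M) : M := ((c%:A : L) : L^c) *: x.

Lemma kact_linear M c : linear (@kact M c).
Proof.
move=> a x y; rewrite /kact scalerDr !scalerA; congr (_ *: _ + _).
by rewrite -[LHS]/((a : L) * c%:A) -[RHS]/(c%:A * (a : L)) mulr_algl mulr_algr.
Qed.

HB.instance Definition _ M c :=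
  GRing.isLinear.Build L^c M M *:%R (@kact M c) (kact_linear c).

Definition kmul M (c : k) : lhom M M := (@kact M c : {linear M -> M}).

Lemma kact0 M c : @kact M c 0 = 0.
Proof. exact: scaler0. Qed.

Lemma lmap_kact M N (f : lhom M N) c x : f (kact c x) = kact c (f x).
Proof. exact: lmapZ. Qed.

Lemma submodule_opsub M (U : M -> Prop) : submodule U -> opsub (@kact M) U.
Proof.
move=> [U0 UL]; split=> // [x y Ux Uy|c x Ux].
  by rewrite addrC -scaleN1r; exact: UL.
by rewrite -[kact _ _]addr0; exact: UL.
Qed.

Lemma kmul_square (X : morcat L) c :
  (kmul (asrc X) c, kmul (atgt X) c) \in @square (modcat L) X X.
Proof.
by apply/eqP; apply: lhomP => x; rewrite /= (lmap_kact (amap X : lhom _ _)).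
Qed.

Definition karrow (X : morcat L) c : hom X X := Ahom (kmul_square X c).

Hypothesis hL : artin_algebra L.

Lemma dcc_scalars : dcc (fun c x : k => c * x).
Proof.
have [art _] := hL => U Uop Udec; have [|//|N NP] := art U.
  move=> n; have [U0 _ UA] := Uop n; split=> // x y Ux Uy.
  exact: opsubD (Uop n) Ux Uy.
by exists N => n x le Ux; apply/NP.
Qed.

Lemma dcc_ffun (W : zmodType) (aW : k -> W -> W) n : (forall c, aW c 0 = 0) ->
  dcc aW -> dcc (fun c (x : {ffun 'I_n -> W}) => [ffun i => aW c (x i)]).
Proof.
move=> aW0 dW; pose p (i : 'I_n) (x : {ffun 'I_n -> W}) := x i.
have pA i : zmod_morphism (p i) by move=> x y; rewrite /p !ffunE.
pose pL i : {additive {ffun 'I_n -> W} -> W} :=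
  HB.pack (p i) (GRing.isZmodMorphism.Build _ _ (p i) (pA i)).
apply: (@dcc_joint _ _ _ _ aW n pL) => // [i c x|x x0].
  by rewrite /= /p ffunE.
by apply/ffunP => i; rewrite ffunE; exact: x0 i.
Qed.

(** M is a quotient of the additive group of n x m matrices over the base ring. *)
Lemma dcc_fg M : finitely_generated M -> dcc (@kact M).
Proof.
move=> [n [v vP]]; have [_ [m [l lP]]] := hL.
pose V := {ffun 'I_n -> {ffun 'I_m -> k}}.
pose q (F : V) : M := \sum_i ((\sum_j F i j *: l j : L) : L^c) *: v i.
have qA : zmod_morphism q.
  move=> F G; rewrite /q -sumrB; apply: eq_bigr => i _.
  rewrite -scalerBl; congr (_ *: _); rewrite -[RHS]sumrB.
  by apply: eq_bigr => j _; rewrite !ffunE scalerBl.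
pose qL : {additive V -> M} := HB.pack q (GRing.isZmodMorphism.Build _ _ q qA).
have dV := dcc_ffun (n := n) _ (dcc_ffun (n := m) (fun c => mulr0 c) dcc_scalars).
apply: (dcc_surj (q := qL)) (dV _) => [c F||c].
- rewrite /kact /= /q scaler_sumr; apply: eq_bigr => i _.
  rewrite scalerA; congr (_ *: _).
  rewrite -[RHS]/((\sum_j F i j *: l j : L) * c%:A) mulr_algr scaler_sumr.
  by apply: eq_bigr => j _; rewrite !ffunE scalerA.
- move=> x; have [a ->] := vP x.
  have /choice[F FE] : forall i, exists f : 'I_m -> k, a i = \sum_j f j *: l j.
    by move=> i; exact: lP.
  exists [ffun i => [ffun j => F i j]]; apply: eq_bigr => i _.
  congr (_ *: _); rewrite FE; apply: eq_bigr => j _; by rewrite !ffunE.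
- by apply/ffunP => i; rewrite !ffunE mulr0.
Qed.

(** Evaluation at n generators of M embeds End(M) into n copies of M. *)
Lemma dcc_end (M : fgmod L) :
  dcc (fun c (f : lhom M M) => lhom_comp (kmul M c) f).
Proof.
have [n [v vP]] := fgmodP M; pose p (i : 'I_n) (f : lhom M M) := f (v i).
have pA i : zmod_morphism (p i) by [].
pose pL i : {additive lhom M M -> M} :=
  HB.pack (p i) (GRing.isZmodMorphism.Build _ _ (p i) (pA i)).
apply: (@dcc_joint _ _ _ _ (@kact M) n pL) => //; first exact: kact0.
  move=> f f0; apply: lhomP => x; have [c ->] := vP x.
  by rewrite lmap_sum; apply: big1 => i _; rewrite lmapZ (f0 i : f (v i) = 0) scaler0.
exact: dcc_fg (fgmodP M).
Qed.

(** An endomorphism of an arrow from A to B acts on A x B and is determined by its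
    values at generators of that product. *)
Lemma dcc_end_arrow (X : morcat L) :
  dcc (fun c (f : hom X X) => karrow X c \oc f).
Proof.
pose A : fgmod L := asrc X; pose B : fgmod L := atgt X.
have [n [v vP]] := fgmodP (prod_mod A B).
pose p (i : 'I_n) (g : hom X X) : prod_mod A B :=
  ((g.1 : lhom A A) (v i).1, (g.2 : lhom B B) (v i).2).
have pA i : zmod_morphism (p i) by [].
pose pL i : {additive hom X X -> prod_mod A B} :=
  HB.pack (p i) (GRing.isZmodMorphism.Build _ _ (p i) (pA i)).
apply: (@dcc_joint _ _ _ _ (@kact (prod_mod A B)) n pL) => //; first exact: kact0.
  move=> g g0; have g0' i : (g.1 : lhom A A) (v i).1 = 0 /\ (g.2 : lhom B B) (v i).2 = 0.
    by have [-> ->] : p i g = 0 := g0 i.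
  suff [g1 g2] : g.1 = 0 /\ g.2 = 0.
    by apply: val_inj; rewrite (surjective_pairing (val g)) g1 g2.
  split; apply: lhomP => x.
    have [c cE] := vP (x, 0); rewrite -[x]/((x, 0 : B).1) cE.
    rewrite (_ : (\sum_i _).1 = \sum_i c i *: (v i).1); last by rewrite raddf_sum.
    by rewrite lmap_sum; apply: big1 => i _; rewrite lmapZ (g0' i).1 scaler0.
  have [c cE] := vP (0, x); rewrite -[x]/((0 : A, x).2) cE.
  rewrite (_ : (\sum_i _).2 = \sum_i c i *: (v i).2); last by rewrite raddf_sum.
  by rewrite lmap_sum; apply: big1 => i _; rewrite lmapZ (g0' i).2 scaler0.
exact: dcc_fg (fgmodP _).
Qed.

Lemma cpow_iter (M : fgmod L) (f : lhom M M) n x :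
  (cpow (f : @hom (modcat L) M M) n : lhom M M) x = iter n f x.
Proof. by elim: n => //= n <-. Qed.

Lemma fitting_mod (M : fgmod L) (f : lhom M M) : @indecomposable (modcat L) M ->
  (exists n, forall x, iter n f x = 0) \/ (injective f /\ surj f).
Proof.
move=> indM.
have [||[n n0]|[g [gf fg]]] := @fitting_lemma (modcat L) M k
  (fun c f => (kmul M c : @hom (modcat L) M M) \oc f) _ _ f
  (@modcat_split L) indM (@dcc_end M).
- by move=> c u v; rewrite compA.
- by move=> c u v; apply: lhomP => x /=; rewrite lmap_kact.
- by left; exists n => x; rewrite -cpow_iter n0.
- right; split=> [x y fxy|y].
    have gfE z : (g : lhom M M) (f z) = z := congr1 (fun u : lhom M M => u z) gf.
    by rewrite -(gfE x) fxy gfE.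
  by exists ((g : lhom M M) y); exact: (congr1 (fun u : lhom M M => u y) fg).
Qed.

End Scalars.

(** * Gorenstein projective modules *)

Section Gorenstein.
Variable R : nzRingType.
Implicit Types (X Y G : fgmod R).

Definition ses (A B C : lmodType R^c) (i : lhom A B) (p : lhom B C) : Prop :=
  [/\ injective i, exact_at i p & surj p].

Lemma ses0 (A B C : lmodType R^c) (i : lhom A B) (p : lhom B C) x :
  ses i p -> p (i x) = 0.
Proof. by move=> [_ ip _]; apply/ip; exists x. Qed.

Lemma proj_lift (P M N : lmodType R^c) (e : lhom M N) (f : lhom P N) :
  projective P -> surj e -> exists g : lhom P M, forall x, e (g x) = f x.
Proof. by move=> pP es; have [g gE] := pP _ _ e es f; exists g. Qed.

Lemma pair_lhom (M A B : lmodType R^c) (f : lhom M A) (g : lhom M B) :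
  exists w : lhom M (A * B)%type, forall x, w x = (f x, g x).
Proof. by apply: lhom_ex => a x y; rewrite !lmapP. Qed.

Lemma copair_lhom (M A B : lmodType R^c) (f : lhom A M) (g : lhom B M) :
  exists w : lhom (A * B)%type M, forall x, w x = f x.1 + g x.2.
Proof.
by apply: lhom_ex => a x y; rewrite !lmapP scalerDr addrACA.
Qed.

(** One step of a complete resolution.  The extension property makes the step
    exact under Hom(-, Q) for all projective modules Q. *)
Definition gp_step X X' : Prop :=
  exists (P : fgmod R) (i : lhom X P) (p : lhom P X'),
    [/\ projective P, ses i p & forall Q : fgmod R, projective Q ->
        forall h : lhom X Q, exists g : lhom P Q, forall x, g (i x) = h x].

(** A complex indexed by the integers is built by choosing its syzygies first;
    as the relation takes values in propositions, no transport along equations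
    between integers is needed. *)
Lemma int_orbit (T : Type) (r : T -> T -> Prop) :
  (forall x, exists y, r x y) -> (forall x, exists y, r y x) ->
  forall x0, exists x : int -> T, (forall i, r (x i) (x (i + 1))) /\ x 0 = x0.
Proof.
move=> /choice[f fP] /choice[g gP] x0.
exists (fun i => match i with Posz n => iter n f x0 | Negz n => iter n.+1 g x0 end).
split=> // -[n|[|n]].
- by rewrite -PoszD addn1; exact: fP.
- by rewrite (_ : Negz 0 + 1 = 0) //; exact: gP.
- have -> : Negz n.+1 + 1 = Negz n by rewrite !NegzE (intS n.+1) opprD addrAC addNr add0r.
  exact: gP.
Qed.

(** A class of modules that can be continued by steps in both directions consists
    of Gorenstein projective modules: splice the steps into a complex. *)
Lemma gp_of_steps (S : fgmod R -> Prop) :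
  (forall X, S X -> exists Y, S Y /\ gp_step X Y) ->
  (forall X, S X -> exists Y, S Y /\ gp_step Y X) ->
  forall X, S X -> gorenstein_projective X.
Proof.
move=> fwd bwd X SX.
pose r (Y Y' : {Y | S Y}) := gp_step (sval Y) (sval Y').
have fwd' t : exists t', r t t'.
  by case: t => Y SY; have [Y' [SY' st]] := fwd Y SY; exists (exist S Y' SY').
have bwd' t : exists t', r t' t.
  by case: t => Y SY; have [Y' [SY' st]] := bwd Y SY; exists (exist S Y' SY').
have [Z [ZP Z0]] := int_orbit fwd' bwd' (exist S X SX).
pose x i := sval (Z i).
pose P i := sval (cid (ZP i)); pose io i := sval (cid (svalP (cid (ZP i)))).
pose pi i := sval (cid (svalP (cid (svalP (cid (ZP i)))))).
have PP i : [/\ projective (P i), ses (io i) (pi i) & forall Q : fgmod R,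
    projective Q -> forall h : lhom (x i) Q, exists g : lhom (P i) Q,
      forall z, g (io i z) = h z] := svalP (cid (svalP (cid (svalP (cid (ZP i)))))).
(* The differential is P i -> x (i + 1) -> P (i + 1). *)
pose d i : lhom (P i) (P (i + 1)) := lhom_comp (io (i + 1)) (pi i).
have d0 i y : d i y = 0 <-> pi i y = 0.
  have [_ [ii _ _] _] := PP (i + 1); split=> [|E]; last by rewrite /= E lmap0.
  by rewrite /= -[0](lmap0 (io (i + 1))) => /ii.
exists P, d; split=> [i|i y|Q pQ i h|].
- by have [] := PP i.
- rewrite d0; have [_ [_ -> _] _] := PP (i + 1); have [_ [_ _ ps] _] := PP i.
  split=> [[z <-]|[z <-]]; last by exists (pi i z).
  by have [u <-] := ps z; exists u.
- have [_ [_ ex ps] _] := PP (i + 1); have [_ [_ _ ps0] _] := PP i.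
  split=> [hd|[g <-]].
    have [|g gE] := lhom_factor (h := h) ps.
      move=> y /ex[z <-]; have [u <-] := ps0 z.
      exact: (congr1 (fun v : lhom _ Q => v u) hd).
    have [_ _ /(_ Q pQ g)[u uE]] := PP (i + 1 + 1); exists u.
    by apply: lhomP => z; rewrite /= uE gE.
  by apply: lhomP => z /=; rewrite (ses0 (pi i z)) ?lmap0 //; have [] := PP (i + 1).
- have [_ [ii ex _] _] := PP 0; rewrite /P in ii ex *.
  have E : x 0 = X by rewrite /x Z0.
  suff: exists j : lhom (x 0) (P 0), is_kernel j (d 0) by rewrite E => ?; exists 0.
  by exists (io 0); split=> // y; rewrite d0; exact: ex.
Qed.

Section Complex.
Variables (P : int -> fgmod R) (d : forall i : int, lhom (P i) (P (i + 1))).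
Hypotheses (Pproj : forall i, projective (P i))
  (Pex : forall i, exact_at (d i) (d (i + 1)))
  (Ptot : forall Q : fgmod R, projective Q -> forall i,
     exact_at (fun h : lhom (P (i + 1 + 1)) Q => lhom_comp h (d (i + 1)))
              (fun h : lhom (P (i + 1)) Q => lhom_comp h (d i))).

Lemma int_succ (i : int) : exists j, i = j + 1.
Proof. by exists (i - 1); rewrite subrK. Qed.

Lemma complex_kernel i : exists (K : fgmod R) (j : lhom K (P i)), is_kernel j (d i).
Proof.
have [m ->] := int_succ i.
have [K [p [j [ps ji pj]]]] := image_ex (d m); exists K, j; split=> // y.
rewrite Pex; split=> [[x <-]|[x <-]]; first by exists (p x).
by have [z <-] := ps x; exists z.
Qed.

(** Maps from the syzygy X to Q are maps h on the preceding term that vanish on the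
    boundary before it; exactness under Hom(-, Q) writes h as a map on the next
    term composed with the differential. *)
Lemma complex_step i X X' (j : lhom X (P i)) (j' : lhom X' (P (i + 1))) :
  is_kernel j (d i) -> is_kernel j' (d (i + 1)) -> gp_step X X'.
Proof.
have [m1 E1] := int_succ i; have [m E] := int_succ m1; subst m1; subst i.
move=> [ji jex] [ji' jex'].
have [p pE] : exists p : lhom (P (m + 1 + 1)) X', forall x, j' (p x) = d (m + 1 + 1) x.
  by apply: lhom_lift => // x; apply/jex'/Pex; exists x.
have [e eE] : exists e : lhom (P (m + 1)) X, forall x, j (e x) = d (m + 1) x.
  by apply: lhom_lift => // x; apply/jex/Pex; exists x.
exists (P (m + 1 + 1)), j, p; split=> // [|Q pQ h].
  split=> // [y|x].
    rewrite -jex -pE; split=> [->|]; first exact: lmap0.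
    by rewrite -[0](lmap0 j') => /ji'.
  have /Pex[y yE] : d (m + 1 + 1 + 1) (j' x) = 0 by apply/jex'; exists x.
  by exists y; apply: ji'; rewrite pE.
have [|g gE] := (Ptot pQ (lhom_comp h e)).1.
  apply: lhomP => x /=; have -> : e (d m x) = 0; last exact: lmap0.
  by apply: ji; rewrite eE lmap0; apply/Pex; exists x.
exists g => x; have /Pex[y yE] : d (m + 1 + 1) (j x) = 0 by apply/jex; exists x.
have -> : x = e y by apply: ji; rewrite eE.
by rewrite eE; exact: (congr1 (fun u : lhom _ Q => u y) gE).
Qed.

End Complex.

Lemma gp_succ X : gorenstein_projective X ->
  exists Y, gorenstein_projective Y /\ gp_step X Y.
Proof.
move=> [P [d [Pp Pex Pt [i [j jK]]]]].
have [Y [j' jK']] := complex_kernel Pex (i + 1).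
exists Y; split; last exact: complex_step jK jK'.
by exists P, d; split=> //; exists (i + 1), j'.
Qed.

Lemma gp_pred X : gorenstein_projective X ->
  exists Y, gorenstein_projective Y /\ gp_step Y X.
Proof.
move=> [P [d [Pp Pex Pt [i [j jK]]]]]; have [m E] := int_succ i; subst i.
have [Y [j' jK']] := complex_kernel Pex m.
exists Y; split; last exact: complex_step jK' jK.
by exists P, d; split=> //; exists m, j'.
Qed.

(** A presentation K -> P -> C for which maps K -> Q extend to P witnesses that
    Ext^1(C, Q) = 0, and then maps A -> Q extend to B for every extension B of C
    by A: compare the two sequences by lifting P -> C to P -> B. *)
Lemma step_extend (A B : lmodType R^c) (K C Q : fgmod R) (f : lhom A B)
    (c : lhom B C) (h : lhom A Q) :
  gp_step K C -> ses f c -> projective Q ->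
  exists g : lhom B Q, forall x, g (f x) = h x.
Proof.
move=> [P [i [p [pP sP ext]]]] sc pQ; have [fi fc cs] := sc.
have [ii ip ps] := sP.
have [t tE] := proj_lift p pP cs.
have [t0 t0E] : exists t0 : lhom K A, forall x, f (t0 x) = t (i x).
  by apply: (lhom_lift (h := lhom_comp t i)) => // x; apply/fc; rewrite tE (ses0 x sP).
have [u uE] := ext Q pQ (lhom_comp h t0).
have [b|a b q b' q'|q|g gP] := @lhom_of_rel _ B Q
  (fun b q => exists x y, b = t x + f y /\ q = u x + h y).
- have [x xE] := ps (c b); have /fc[y yE] : c (b - t x) = 0.
    by rewrite lmapB tE xE subrr.
  by exists (u x + h y), x, y; split=> //; rewrite yE addrC subrK.
- move=> [x [y [-> ->]]] [x' [y' [-> ->]]]; exists (a *: x + x'), (a *: y + y').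
  by rewrite !lmapP !scalerDr; split; rewrite addrACA.
- move=> [x [y [E ->]]]; have /ip[z zE] : p x = 0.
    by move/(congr1 c): E; rewrite lmap0 lmapD tE (ses0 y sc) addr0 => <-.
  have -> : y = - t0 z.
    by apply: fi; rewrite lmapN t0E zE; apply/eqP; rewrite -addr_eq0 addrC -E.
  by rewrite -zE uE lmapN subrr.
exists g => x; apply: gP; exists 0, x; by rewrite !lmap0 !add0r.
Qed.

Lemma gp_extend (A B : lmodType R^c) (C Q : fgmod R) (f : lhom A B)
    (c : lhom B C) (h : lhom A Q) :
  gorenstein_projective C -> ses f c -> projective Q ->
  exists g : lhom B Q, forall x, g (f x) = h x.
Proof. by move=> /gp_pred[K [_ st]]; exact: step_extend st. Qed.

(** The horseshoe construction in both directions; the map B -> P needed for the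
    forward direction exists because Ext^1(C, P) = 0. *)
Lemma gp_extension (A B C : fgmod R) (i : lhom A B) (p : lhom B C) : ses i p ->
  gorenstein_projective A -> gorenstein_projective C -> gorenstein_projective B.
Proof.
move=> s gA gC; apply: (gp_of_steps (S := fun B => exists (A C : fgmod R)
    (i : lhom A B) (p : lhom B C), [/\ ses i p, gorenstein_projective A
    & gorenstein_projective C])); last by exists A, C, i, p.
- move=> {A B C i p s gA gC} B [A [C [i [p [s gA gC]]]]].
  have [A' [gA' [P [iA [pA [pP sA extA]]]]]] := gp_succ gA.
  have [C' [gC' [Q [iC [pC [pQ sC extC]]]]]] := gp_succ gC.
  have [j jE] := gp_extend iA gC s pP.
  have [w wE] := pair_lhom j (lhom_comp iC p).
  have [B' [c [wc cs]]] := @cokernel_ex _ B (prod_mod P Q) w.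
  have [ii ip ps] := s; have [iAi iAp pAs] := sA; have [iCi iCp pCs] := sC.
  have [inl inlE] : exists f : lhom P (P * Q)%type, forall x, f x = (x, 0).
    by have [f fE] := pair_lhom (lhom_id P) (0 : lhom P Q); exists f.
  have [|i' i'E] := lhom_factor (h := lhom_comp c inl) pAs.
    move=> _ /iAp[a <-] /=; rewrite inlE; apply/wc; exists (i a).
    by rewrite wE /= jE (ses0 a s) lmap0.
  have [snd' snd'E] : exists f : lhom (P * Q)%type Q, forall x, f x = x.2.
    have [f fE] := copair_lhom (0 : lhom P Q) (lhom_id Q); exists f => x.
    by rewrite fE add0r.
  have [|p' p'E] := lhom_factor (h := lhom_comp pC snd') cs.
    by move=> _ /wc[b <-] /=; rewrite snd'E wE /= (ses0 _ sC).
  exists B'; split; last first.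
    exists (prod_mod P Q), w, c; split; [exact: prod_projective|split=> //|].
      apply: lhom_inj => b; rewrite wE => -[jb0 b0].
      have /ip[a aE] : p b = 0 by apply: iCi; rewrite b0 lmap0.
      by rewrite -aE; move: jb0; rewrite -aE jE -[0](lmap0 iA) => /iAi->; exact: lmap0.
    move=> T pT h; have [u uE] := extA T pT (lhom_comp h i).
    have [|h' h'E] := lhom_factor (h := h - lhom_comp u j) ps.
      by move=> _ /ip[a <-] /=; rewrite jE uE subrr.
    have [v vE] := extC T pT h'.
    have [g gE] := copair_lhom u v; exists g => b.
    by rewrite gE wE /= vE h'E /= addrC subrK.
  exists A', C', i', p'; split=> //; split.
  + apply: lhom_inj => a'; have [x <-] := pAs a'; rewrite i'E /= inlE.
    move=> /wc[b]; rewrite wE => -[jb b0].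
    have /ip[a aE] : p b = 0 by apply: iCi; rewrite b0 lmap0.
    by rewrite -jb -aE jE (ses0 a sA).
  + move=> b'; split=> [|[a' <-]]; last first.
      by have [x <-] := pAs a'; rewrite i'E /= inlE p'E /= snd'E lmap0.
    have [[x y] <-] := cs b'; rewrite p'E /= snd'E /= => /iCp[z zE].
    have [b bE] := ps z; exists (pA (x - j b)); rewrite i'E /= inlE.
    have -> : (x - j b, 0) = ((x, y) : (P * Q)%type) - w b.
      by rewrite wE /= bE zE; congr pair; rewrite subrr.
    by rewrite lmapB (_ : c (w b) = 0) ?subr0 //; apply/wc; exists b.
  + move=> c'; have [y <-] := pCs c'; exists (c (0, y)).
    by rewrite p'E /= snd'E.
- move=> {A B C i p s gA gC} B [A [C [i [p [s gA gC]]]]].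
  have [A' [gA' [P [iA [pA [pP sA extA]]]]]] := gp_pred gA.
  have [C' [gC' [Q [iC [pC [pQ sC extC]]]]]] := gp_pred gC.
  have [ii ip ps] := s; have [iAi iAp pAs] := sA; have [iCi iCp pCs] := sC.
  have [t tE] := proj_lift pC pQ ps.
  have [q qE] := copair_lhom (lhom_comp i pA) t.
  have pq x : p (q x) = pC x.2.
    by rewrite qE /= lmapD (ses0 _ s) add0r tE.
  have qs : surj q.
    move=> b; have [y yE] := pCs (p b).
    have /ip[a aE] : p (b - t y) = 0 by rewrite lmapB tE yE subrr.
    have [x xE] := pAs a; exists (x, y).
    by rewrite qE /= xE aE subrK.
  have [K [j [ji jex]]] := kernel_ex q.
  have [pr1 pr1E] : exists f : lhom (P * Q)%type P, forall x, f x = x.1.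
    have [f fE] := copair_lhom (lhom_id P) (0 : lhom Q P); exists f => x.
    by rewrite fE addr0.
  have [pr2 pr2E] : exists f : lhom (P * Q)%type Q, forall x, f x = x.2.
    have [f fE] := copair_lhom (0 : lhom P Q) (lhom_id Q); exists f => x.
    by rewrite fE add0r.
  have [i' i'E] : exists i' : lhom A' K, forall x, j (i' x) = (iA x, 0).
    have [f fE] := pair_lhom iA (0 : lhom A' Q).
    have [x|i' i'E] := lhom_lift (h := f) ji.
      by apply/jex; rewrite fE qE /= (ses0 _ sA) !lmap0 addr0.
    by exists i' => x; rewrite i'E fE.
  have [p' p'E] : exists p' : lhom K C', forall x, iC (p' x) = (j x).2.
    have [x|p' p'E] := lhom_lift (h := lhom_comp pr2 j) iCi.
      apply/iCp; rewrite /= pr2E -pq (_ : q (j x) = 0) ?lmap0 //.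
      by apply/jex; exists x.
    by exists p' => x; rewrite p'E /= pr2E.
  have i'0 z : p' z = 0 <-> exists x, i' x = z.
    split=> [z0|[x <-]]; last by apply: iCi; rewrite p'E i'E lmap0.
    have y0 : (j z).2 = 0 by rewrite -p'E z0 lmap0.
    have : q (j z) = 0 by apply/jex; exists z.
    rewrite qE y0 lmap0 addr0 /= -[0](lmap0 i) => /ii /iAp[x xE].
    by exists x; apply: ji; rewrite i'E xE -y0 -surjective_pairing.
  have p's : surj p'.
    move=> y; have /ip[a aE] : p (t (iC y)) = 0 by rewrite tE (ses0 _ sC).
    have [x xE] := pAs a; have /jex[z zE] : q (- x, iC y) = 0.
      by rewrite qE /= !lmapN xE aE addNr.
    by exists z; apply: iCi; rewrite p'E zE.
  pose K' := Fgmod (fg_ext i'0 p's (fgmodP A') (fgmodP C')).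
  exists K'; split.
    exists A', C', i', p'; split=> //; split=> //.
    by apply: lhom_inj => x /(congr1 j); rewrite i'E lmap0 => -[]; rewrite -[0](lmap0 iA) => /iAi.
  exists (prod_mod P Q), j, q; split=> //; first exact: prod_projective.
  move=> T pT h; have [u uE] := extA T pT (lhom_comp h i').
  have [|h' h'E] := lhom_factor (h := h - lhom_comp u (lhom_comp pr1 j)) p's.
    by move=> _ /i'0[x <-] /=; rewrite pr1E i'E /= uE subrr.
  have [v vE] := extC T pT h'.
  have [g gE] := copair_lhom u v; exists g => x.
  by rewrite gE -p'E vE h'E /= pr1E addrC subrK.
Qed.

(** The syzygies of a direct summand G of M need not be summands of the given
    syzygies of M, but they are summands of extensions of them.  If M -> P -> N is
    a step and G' is the cokernel of G -> M -> P, then M -> G' + G -> N is exact, so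
    G' + G is Gorenstein projective; dually for the kernel K of P -> M -> G. *)
Lemma retract_gp (G M : fgmod R) (i : lhom G M) (r : lhom M G) :
  (forall x, r (i x) = x) -> gorenstein_projective M -> gorenstein_projective G.
Proof.
move=> ri gM; apply: (gp_of_steps (S := fun G => exists (M : fgmod R)
    (i : lhom G M) (r : lhom M G), (forall x, r (i x) = x) /\
    gorenstein_projective M)); last by exists M, i, r.
- move=> {G M i r ri gM} G [M [i [r [ri gM]]]].
  have [N [gN [P [io [p [pP sP ext]]]]]] := gp_succ gM; have [ioi iop ps] := sP.
  have [G' [c [ce cs]]] := cokernel_ex (lhom_comp io i : lhom G P).
  have [w wE] := pair_lhom (lhom_comp c io) r.
  have [|q qE] := lhom_factor (h := p) cs.
    by move=> _ /ce[x <-]; exact: ses0 sP.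
  have [fst' fstE] := copair_lhom q (0 : lhom G N).
  have gG'G : gorenstein_projective (prod_mod G' G).
    apply: (@gp_extension M (prod_mod G' G) N w fst') => //; split.
    + apply: lhom_inj => m; rewrite wE => -[/ce[x /= /ioi xm] rm].
      by rewrite -xm -(ri x) xm rm lmap0.
    + move=> [x' g]; rewrite fstE /= addr0; have [x <-] := cs x'; rewrite qE.
      split=> [/iop[m mE]|[m]].
        exists (m - i (r m) + i g); rewrite wE /=; congr pair; last first.
          by rewrite lmapD lmapB !ri subrr add0r.
        rewrite -mE -addrA lmapD lmapD -[RHS]addr0; congr (_ + _).
        by apply/ce; exists (g - r m); rewrite /= lmapB addrC.
      rewrite wE => -[cx _]; have /ce[y yE] : c (io m - x) = 0.
        by rewrite lmapB cx subrr.
      rewrite -[x](subKr (io m)) -yE lmapB (ses0 _ sP) /= (ses0 _ sP).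
      by rewrite subrr.
    + move=> y; have [x <-] := ps y; exists (c x, 0).
      by rewrite fstE /= qE addr0.
  exists G'; split.
    have [i' i'E] := pair_lhom (lhom_id G') (0 : lhom G' G).
    have [r' r'E] := copair_lhom (lhom_id G') (0 : lhom G G').
    by exists (prod_mod G' G), i', r'; split=> // x; rewrite r'E i'E addr0.
  exists P, (lhom_comp io i), c; split=> //.
    by split=> // x y /= /ioi /(congr1 r); rewrite !ri.
  move=> Q pQ h; have [u uE] := ext Q pQ (lhom_comp h r).
  by exists u => x; rewrite uE /= ri.
- move=> {G M i r ri gM} G [M [i [r [ri gM]]]].
  have [N [gN [P [io [p [pP sP ext]]]]]] := gp_pred gM; have [ioi iop ps] := sP.
  have [K [j [ji jex]]] := kernel_ex (lhom_comp r p : lhom P G).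
  have [a aE] : exists a : lhom N K, forall x, j (a x) = io x.
    by apply: lhom_lift => // x; apply/jex; rewrite /= (ses0 _ sP) lmap0.
  have [w wE] := pair_lhom a (0 : lhom N G).
  have [q qE] := copair_lhom (lhom_comp p j) i.
  have sw : ses w q.
    split.
    + apply: lhom_inj => x; rewrite wE => -[/(congr1 j)].
      by rewrite aE lmap0 -[0](lmap0 io) => /ioi.
    + move=> [x g]; rewrite qE /=; split=> [E|[y]]; last first.
        by rewrite wE => -[<- <-]; rewrite aE (ses0 _ sP) lmap0 addr0.
      have g0 : g = 0.
        have rpx : r (p (j x)) = 0 by apply/jex; exists x.
        by move/(congr1 r): E; rewrite lmapD rpx ri lmap0 add0r.
      move: E; rewrite g0 lmap0 addr0 => /iop[y yE]; exists y; rewrite wE.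
      by congr pair; apply: ji; rewrite aE.
    + move=> m; have [x xE] := ps (m - i (r m)).
      have /jex[z zE] : r (p x) = 0 by rewrite xE lmapB ri subrr.
      by exists (z, r m); rewrite qE /= zE xE subrK.
  have [i1 i1E] := pair_lhom (lhom_id K) (0 : lhom K G).
  have [r1 r1E] := copair_lhom (lhom_id K) (0 : lhom G K).
  have r1i1 x : r1 (i1 x) = x by rewrite r1E i1E addr0.
  have [wi wq qs] := sw.
  have fgKG := fg_ext wq qs (fgmodP N) (fgmodP M).
  have r1s : surj r1 by move=> x; exists (i1 x).
  pose K' := Fgmod (fg_surj r1s fgKG).
  exists K'; split.
    exists (prod_mod K' G), i1, r1; split=> //.
    exact: (@gp_extension N (prod_mod K' G) M w q).
  have rps : surj (lhom_comp r p).
    by move=> g; have [x xE] := ps (i g); exists x; rewrite /= xE ri.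
  exists P, j, (lhom_comp r p); split=> // Q pQ h.
  have [u uE] := ext Q pQ (lhom_comp h a).
  pose h2 := h - lhom_comp u j.
  have [w2 w2E] : exists w2 : lhom M Q, forall x, w2 (p (j x)) = h2 x.
    have [|h3 h3E] := lhom_factor (h := lhom_comp h2 r1) qs.
      move=> [x g] /wq[y]; rewrite wE => -[<- <-].
      by rewrite /= r1E addr0 /= aE uE subrr.
    exists h3 => x; have := h3E (x, 0).
    by rewrite qE /= lmap0 addr0 r1E addr0.
  exists (u + lhom_comp w2 p) => x.
  by rewrite /= w2E /= addrC subrK.
Qed.

End Gorenstein.

(** * Indecomposable summands and simple modules *)

Section ModuleCategory.
Variable R : nzRingType.
Implicit Types M N G : fgmod R.

Lemma zero_modP M : @zero_obj (modcat R) M <-> forall x : M, x = 0.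
Proof.
split=> [M0 x|M0]; last by apply: lhomP => x; exact: M0.
exact: (congr1 (fun u : lhom M M => u x) M0).
Qed.

Lemma indecomposable_neq0 M : @indecomposable (modcat R) M -> exists x : M, x <> 0.
Proof.
move=> [nz _]; apply: contrapT => no; apply/nz/zero_modP => x.
by apply: contrapT => x0; apply: no; exists x.
Qed.

Lemma iso_modP M N :
  @iso (modcat R) M N <-> exists f : lhom M N, injective f /\ surj f.
Proof.
split=> [[f [g [gf fg]]]|[f [fi fs]]].
  exists f; split=> [x y fxy|y].
    have gfE z : (g : lhom N M) ((f : lhom M N) z) = z :=
      congr1 (fun u : lhom M M => u z) gf.
    by rewrite -(gfE x) fxy gfE.
  by exists ((g : lhom N M) y); exact: (congr1 (fun u : lhom N N => u y) fg).
by have [g [gf fg]] := lhom_inv fi fs; exists f, g; split; apply: lhomP.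
Qed.

Lemma projective_retract (P Q : lmodType R^c) (i : lhom P Q) (r : lhom Q P) :
  (forall x, r (i x) = x) -> projective Q -> projective P.
Proof.
move=> ri pQ M N e es f.
have [g gE] := proj_lift (lhom_comp (f : lhom P N) r) pQ (es : surj (e : lhom M N)).
by exists (lhom_comp g i) => x; rewrite [LHS]gE /= ri.
Qed.

(** That G -> T -> G is bijective, rather than the identity, is what the Fitting
    lemma delivers. *)
Definition indec_summand_of (s : seq (fgmod R)) (T : fgmod R) : Prop :=
  forall G (u : lhom G T) (v : lhom T G), @indecomposable (modcat R) G ->
  (injective (lhom_comp v u) /\ surj (lhom_comp v u)) ->
  exists Y, List.In Y s /\ @iso (modcat R) G Y.

End ModuleCategory.

Section Summands.
Variables (k : comNzRingType) (L : algType k).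
Hypothesis hL : artin_algebra L.
Implicit Types M N G T : fgmod L.

(** If a and b were both nilpotent, then b, being 1 - a, would fix a nonzero
    element of the kernel of a. *)
Lemma local_end G (a b : lhom G G) : @indecomposable (modcat L) G ->
  (forall x, a x + b x = x) -> injective a /\ surj a \/ injective b /\ surj b.
Proof.
move=> indG ab; have [[n an]|] := fitting_mod hL a indG; last by left.
have [[m bm]|] := fitting_mod hL b indG; last by right.
have [x x0] := indecomposable_neq0 indG; case: x0.
elim: n an => [|n IH] an; first exact: (an x).
apply: IH => y; have := bm (iter n a y).
suff -> : iter m b (iter n a y) = iter n a y by [].
elim: m {bm} => //= m ->; rewrite -[RHS]ab.
by rewrite (an y : a (iter n a y) = 0) add0r.
Qed.

(** The identity of T is the sum of the two projections; use [local_end]. *)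
Lemma indec_summandD s1 s2 T (T1 T2 : fgmod L) : @is_biproduct (modcat L) T T1 T2 ->
  indec_summand_of s1 T1 -> indec_summand_of s2 T2 -> indec_summand_of (s1 ++ s2) T.
Proof.
move=> [i1 [i2 [p1 [p2 [_ _ _ _ one]]]]] S1 S2 G u v indG [wi ws].
have [w [wK Kw]] := lhom_inv wi ws.
have oneE x : (i1 : lhom T1 T) ((p1 : lhom T T1) x) + (i2 : lhom T2 T) ((p2 : lhom T T2) x) = x.
  exact: (congr1 (fun f : lhom T T => f x) one).
pose v1 : lhom T1 G := lhom_comp w (lhom_comp v i1).
pose v2 : lhom T2 G := lhom_comp w (lhom_comp v i2).
pose u1 : lhom G T1 := lhom_comp (p1 : lhom T T1) u.
pose u2 : lhom G T2 := lhom_comp (p2 : lhom T T2) u.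
have [|bij|bij] := @local_end G (lhom_comp v1 u1) (lhom_comp v2 u2) indG.
- by move=> x /=; rewrite -lmapD -lmapD oneE; exact: wK.
- have [Y [Ys GY]] := S1 G u1 v1 indG bij; exists Y; split=> //.
  by apply: List.in_or_app; left.
- have [Y [Ys GY]] := S2 G u2 v2 indG bij; exists Y; split=> //.
  by apply: List.in_or_app; right.
Qed.

(** A minimal direct summand violating the claim would be neither zero, nor
    indecomposable, nor decomposable into smaller summands. *)
Lemma finitely_many_summands T : exists s, indec_summand_of s T.
Proof.
apply: contrapT => nT.
pose P (U : T -> Prop) := exists (D : fgmod L) (i : lhom D T),
  [/\ injective i, (forall x, U x <-> exists y, i y = x)
    & ~ exists s, indec_summand_of s D].
have [|U [_ [D [i [ii iU nD]]] minU]] := dcc_min (P := P) (dcc_fg hL (fgmodP T)).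
  exists (fun _ => True); split; first by split.
  by exists T, (lhom_id T); split=> // x; split=> // _; exists x.
have small (T1 : fgmod L) (j : lhom T1 D) : injective j ->
    ~ (exists s, indec_summand_of s T1) -> surj j.
  move=> ji nT1 y.
  have [||_ [y' <-]||z] := minU (fun x => exists y, (lhom_comp i j) y = x) _ _ _ (i y).
  - exact/submodule_opsub/image_submodule.
  - exists T1, (lhom_comp i j); split=> //.
    by move=> a b /ii /ji.
  - by apply/iU; exists (j y').
  - by apply/iU; exists y.
  by move=> /ii; exists z.
apply: nD; have [indD|nind] := pselect (@indecomposable (modcat L) D).
  exists [:: D] => G u v indG [wi ws]; exists D; split; first by left.
  have [w [wK Kw]] := lhom_inv wi ws.
  pose e : lhom D D := lhom_comp u (lhom_comp w v).
  have ee : (e : @hom (modcat L) D D) \oc (e : @hom (modcat L) D D) = e.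
    by apply: lhomP => x /=; rewrite [in LHS](wK _ : w (v (u _)) = _).
  have [e0|e1] := indecomposable_idem (@modcat_split L) indD ee.
    have [x []] := indecomposable_neq0 indG; rewrite -(wK x) /=.
    have <- : w (v (u (w (v (u x))))) = w (v (u x)) by rewrite (wK _ : w (v (u _)) = _).
    by rewrite (_ : u _ = e (u x)) // e0 /= !lmap0.
  apply/iso_modP; exists u; split.
    by move=> x y uxy; apply: wi; rewrite /= uxy.
  by move=> x; exists (w (v x)); exact: (congr1 (fun f : lhom D D => f x) e1).
have [/zero_modP D0|nz] := pselect (@zero_obj (modcat L) D).
  exists [::] => G u v indG [wi _]; have [x []] := indecomposable_neq0 indG.
  by apply: wi; rewrite /= (D0 (u x)) lmap0 lmap0 lmap0.
apply: contrapT => nD; apply: nind; split=> // D1 D2 bip.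
have [i1 [i2 [p1 [p2 [e1 e2 e12 e21 _]]]]] := bip.
have E1 x : (p1 : lhom D D1) ((i1 : lhom D1 D) x) = x.
  exact: (congr1 (fun f : lhom D1 D1 => f x) e1).
have E2 x : (p2 : lhom D D2) ((i2 : lhom D2 D) x) = x.
  exact: (congr1 (fun f : lhom D2 D2 => f x) e2).
have E12 x : (p1 : lhom D D1) ((i2 : lhom D2 D) x) = 0.
  exact: (congr1 (fun f : lhom D2 D1 => f x) e12).
have E21 x : (p2 : lhom D D2) ((i1 : lhom D1 D) x) = 0.
  exact: (congr1 (fun f : lhom D1 D2 => f x) e21).
have [[s1 S1]|n1] := pselect (exists s, indec_summand_of s D1); last first.
  right; apply/zero_modP => x.
  have [|y yE] := small D1 i1 _ n1 ((i2 : lhom D2 D) x).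
    by move=> a b ab; rewrite -(E1 a) ab E1.
  by rewrite -(E2 x) -yE E21.
have [[s2 S2]|n2] := pselect (exists s, indec_summand_of s D2); last first.
  left; apply/zero_modP => x.
  have [|y yE] := small D2 i2 _ n2 ((i1 : lhom D1 D) x).
    by move=> a b ab; rewrite -(E2 a) ab E2.
  by rewrite -(E1 x) -yE E12.
by case: nD; exists (s1 ++ s2); exact: indec_summandD bip S1 S2.
Qed.

End Summands.

Definition simple_mod (R : nzRingType) (S : fgmod R) : Prop := (exists x : S, x <> 0) /\
  forall U : S -> Prop, submodule U -> (exists x, U x /\ x <> 0) -> forall x, U x.

Section SimpleModules.
Variables (k : comNzRingType) (L : algType k).
Hypothesis hL : artin_algebra L.
Implicit Types G S T : fgmod L.

(** Zorn's lemma for proper submodules; finite generation keeps the union of a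
    chain proper. *)
Lemma simple_quotient G : (exists x : G, x <> 0) ->
  exists S (q : lhom G S), simple_mod S /\ surj q.
Proof.
move=> [g g0]; have [n [v vP]] := fgmodP G.
pose closed (U : set G) := forall a x y, U x -> U y -> U (a *: x + y).
have closed0 U x : closed U -> U x -> U 0.
  by move=> UL Ux; rewrite -(addNr x) -scaleN1r; exact: UL.
(* The empty set is allowed, since it is the union of the empty chain. *)
pose P (U : set G) := closed U /\ ~ forall x, U x.
have [F FP Ftot|A [[AL Aprop] Amax]] := @Zorn_bigcup G P.
  split=> [a x y [X FX Xx] [Y FY Yy]|all].
    have [XY|YX] := Ftot X Y FX FY.
      by exists Y => //; have [YL _] := FP _ FY; apply: YL => //; exact: XY.
    by exists X => //; have [XL _] := FP _ FX; apply: XL => //; exact: YX.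
  have [X0 FX0 X00] := all 0.
  have H m : exists X, [/\ F X, X 0 & forall i : 'I_n, (i < m)%N -> X (v i)].
    elim: m => [|m [X [FX X0' XP]]]; first by exists X0.
    have [lt_mn|ge_mn] := ltnP m n; last first.
      by exists X; split=> // i _; apply: XP; exact: leq_trans (ltn_ord i) ge_mn.
    have [Y FY Yv] := all (v (Ordinal lt_mn)).
    have [XY|YX] := Ftot X Y FX FY.
      exists Y; split=> // [|i]; first exact: XY.
      rewrite ltnS leq_eqVlt => /orP[/eqP im|/XP /XY //].
      by rewrite (_ : i = Ordinal lt_mn) //; exact: val_inj.
    exists X; split=> // i; rewrite ltnS leq_eqVlt => /orP[/eqP im|/XP //].
    by rewrite (_ : i = Ordinal lt_mn); [exact: YX|exact: val_inj].
  have [X [FX X0' XP]] := H n; have [XL []] := FP _ FX => x; have [c ->] := vP x.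
  apply: (big_ind X) => //.
    by move=> y z Xy Xz; rewrite -[y]scale1r; exact: XL.
  by move=> i _; rewrite -[_ *: _]addr0; apply: XL => //; exact: XP.
have A0 : A 0.
  apply: contrapT => nA0; apply: (Amax (fun x => x = 0)).
    split; last by move=> /(_ 0 erefl).
    by move=> x Ax; case: nA0; exact: closed0 Ax.
  split; last by move=> /(_ g).
  by move=> a x y -> ->; rewrite scaler0 addr0.
have [Q [q [qs qA]]] := quot_ex A0 AL.
exists (Fgmod (fg_surj qs (fgmodP G))), q; split=> //; split.
  apply: contrapT => no; apply: Aprop => x; apply/qA.
  by apply: contrapT => qx0; apply: no; exists (q x).
move=> U [U0 UL] [y [Uy y0]] u; have [x <-] := qs u; have [z zE] := qs y.
have Uz : U (q z) by rewrite zE.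
have nAz : ~ A z by move/qA; rewrite zE.
apply: contrapT => nUx; apply: (Amax (fun x => U (q x))).
  split; first by move=> w /qA qw; rewrite /= qw.
  by move=> /(_ z Uz).
split; last by move=> /(_ x).
by move=> a w w' Uw Uw'; rewrite /= lmapP; exact: UL.
Qed.

Lemma regular_fg : finitely_generated ((L^c)^o : lmodType L^c).
Proof.
exists 1%N, (fun _ => 1) => x; exists (fun _ => x).
by rewrite big_ord1 /= -[RHS]/(x * 1) mulr1.
Qed.

Definition regular_mod : fgmod L := Fgmod regular_fg.

Lemma regular_lhom (M : lmodType L^c) (x : M) :
  exists f : lhom regular_mod M, forall a, f a = (a : L^c) *: x.
Proof.
by apply: lhom_ex => a y z; rewrite scalerDl -scalerA.
Qed.

Lemma regular_projective : projective regular_mod.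
Proof.
move=> M N e es f; have [y yE] := es (f 1).
have [g gE] := regular_lhom y; exists g => a.
rewrite [g a]gE -[LHS]/((e : lhom M N) _) lmapZ [e y]yE.
rewrite -[_ *: _](lmapZ (f : lhom regular_mod N)); congr (f _).
by rewrite -[LHS]/((a : L^c) * 1) mulr1.
Qed.

(** Choose maps from the regular module to simple modules with minimal
    intersection J of kernels.  A map h to any other simple module S vanishes
    on J, hence factors through one of the layers of the filtration by partial
    intersections, and so S is isomorphic to one of the chosen modules. *)
Lemma finitely_many_simples : exists s : seq (fgmod L),
  forall G, (exists x : G, x <> 0) ->
  exists S (q : lhom G S), [/\ List.In S s, simple_mod S & surj q].
Proof.
pose T := {S : fgmod L & lhom regular_mod S}.
pose J (s : seq T) (x : regular_mod) := forall t, List.In t s -> projT2 t x = 0.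
pose simples (s : seq T) := forall t, List.In t s -> simple_mod (projT1 t).
pose P (U : regular_mod -> Prop) := exists s, simples s /\ forall x, U x <-> J s x.
have [|U [_ [s [ss sJ]] Umin]] := dcc_min (P := P) (dcc_fg hL (fgmodP regular_mod)).
  exists (fun _ => True); split; first by [].
  by exists [::]; split=> [t []|x]; split=> // _ t [].
exists [seq projT1 t | t <- s] => G G0.
have [S [q [sS qs]]] := simple_quotient G0.
have [[x x0] Smin] := sS; have [h hE] := regular_lhom x.
have Jh y : J s y -> h y = 0.
  move=> Jy; have Jle : forall y, U y -> J (existT _ S h :: s) y.
    apply: Umin.
  - split=> [t _|a b Ja Jb t ts|c a Ja t ts]; first exact: lmap0.
      by rewrite lmapB Ja ?Jb ?subrr.
    by rewrite lmapZ Ja ?scaler0.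
  - exists (existT _ S h :: s); split=> // t [<- //|]; exact: ss.
  - by move=> z Jz; apply/sJ => t ts; apply: Jz; right.
  by apply: (Jle y _ (existT _ S h)); [exact/sJ|left].
suff [t [ts [f [fi fs]]]] : exists t, List.In t s /\
    exists f : lhom (projT1 t) S, injective f /\ surj f.
  have [g [gf fg]] := lhom_inv fi fs; exists (projT1 t), (lhom_comp g q); split.
  - exact: List.in_map.
  - exact: ss.
  - by move=> y; have [z zE] := qs (f y); exists z; rewrite /= zE gf.
suff H (N : regular_mod -> Prop) : submodule N -> (exists y, N y /\ h y <> 0) ->
    (forall y, N y -> J s y -> h y = 0) -> exists t, List.In t s /\
    exists f : lhom (projT1 t) S, injective f /\ surj f.
  apply: (H (fun _ => True)) => // [|y _]; last exact: Jh.
  by exists 1; split=> //; rewrite hE scale1r.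
elim: s ss {sJ Umin Jh} N => [|[T1 f] s IH] ss N [N0 NL] [y0 [Ny0 hy0]] Nh.
  by case: hy0; apply: Nh.
have [[y [Ny fy hy]]|no] := pselect (exists y, [/\ N y, f y = 0 & h y <> 0]).
  have ss' : simples s by move=> t ts; apply: ss; right.
  have [|||t [ts tP]] := IH ss' (fun z => N z /\ f z = 0).
  - split; first by rewrite lmap0.
    move=> a z w [Nz fz] [Nw fw]; split; first exact: NL.
    by rewrite lmapP fz fw scaler0 addr0.
  - by exists y.
  - by move=> z [Nz fz] Jz; apply: Nh => // t [<- //|]; exact: Jz.
  by exists t; split=> //; right.
have hf y : N y -> f y = 0 -> h y = 0.
  by move=> Ny fy; apply: contrapT => hy; apply: no; exists y.
have [[z0 z00] T1min] : simple_mod T1 by apply: (ss (existT _ T1 f)); left.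
have fN y : exists x, N x /\ f x = y.
  move: y; apply: T1min; last first.
    exists (f y0); split; first by exists y0.
    by move=> fy0; apply: hy0; exact: hf.
  split; first by exists 0; rewrite lmap0.
  move=> a _ _ [z [Nz <-]] [w [Nw <-]]; exists (a *: z + w); rewrite lmapP.
  by split=> //; exact: NL.
have hN y : exists x, N x /\ h x = y.
  move: y; apply: Smin; last by exists (h y0); split=> //; exists y0.
  split; first by exists 0; rewrite lmap0.
  move=> a _ _ [z [Nz <-]] [w [Nw <-]]; exists (a *: z + w); rewrite lmapP.
  by split=> //; exact: NL.
have [y|a _ _ _ _ [z [Nz <- <-]] [w [Nw <- <-]]|_ [z [Nz fz <-]]|g gP] :=
    @lhom_of_rel _ T1 S (fun u w => exists x, [/\ N x, f x = u & h x = w]).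
- by have [z [Nz zy]] := fN y; exists (h z), z.
- by exists (a *: z + w); rewrite !lmapP; split=> //; exact: NL.
- exact: hf.
have gE z : N z -> g (f z) = h z by move=> Nz; apply: gP; exists z.
exists (existT _ T1 f); split; first by left.
exists g; split; last by move=> y; have [z [Nz <-]] := hN y; exists (f z); exact: gE.
apply: lhom_inj => z gz; apply: contrapT => z1; apply: hy0.
rewrite -gE //; apply: (T1min (fun z => g z = 0)); last by exists z.
split; first exact: lmap0.
by move=> a u w gu gw; rewrite lmapP gu gw scaler0 addr0.
Qed.

End SimpleModules.

(** * G-semisimple algebras are CM-finite *)

Section CMFinite.
Variables (k : comNzRingType) (L : algType k).
Hypothesis hL : artin_algebra L.
Hypothesis hcf : @contravariantly_finite (modcat L) (@gorenstein_projective L).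
Hypothesis hss : G_semisimple L.
Implicit Types A B G S T X : fgmod L.

(** Iterating f = f g f puts arbitrary powers of g f on the right, which is what
    the nilpotent case of the Fitting lemma asks for. *)
Lemma stable_regular A B (f : lhom A B) :
  gorenstein_projective A -> gorenstein_projective B ->
  exists g : lhom B A, forall n, through_projective
    (f - (f : @hom (modcat L) A B) \oc cpow ((g : @hom (modcat L) B A) \oc f) n).
Proof.
move=> gA gB; pose A' : Gprj L := exist _ A gA; pose B' : Gprj L := exist _ B gB.
pose I := projective_ideal L; pose pi (X Y : Gprj L) (h : hom X Y) := @qpi _ I X Y h.
pose f' : @hom (Gprj L) A' B' := f.
pose F : @hom (stable_Gprj L) A' B' := pi A' B' f'.
have [g' gE] := semisimple_mod_regular F hss.
have [g gg'] : exists g, pi B' A' g = g' by exact: qpi_surj.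
exists g => n.
have cpowE m : cpow (g \oc f') m = cpow ((g : @hom (modcat L) B A) \oc f) m.
  by elim: m => //= m ->.
suff : pi A' B' f' = pi A' B' (f' \oc cpow (g \oc f') n) by move/(@qpiP _ I A' B'); rewrite cpowE.
have piM (X Y Z : Gprj L) (v : hom Y Z) (u : hom X Y) :
    (pi Y Z v : @hom (stable_Gprj L) Y Z) \oc (pi X Y u : @hom (stable_Gprj L) X Y)
    = pi X Z (v \oc u) by exact: qcompE.
have powE m : cpow (g' \oc F) m = pi A' A' (cpow (g \oc f') m).
  by elim: m => [//|m IH]; rewrite !cpowS IH -gg' /F !piM.
rewrite -piM -powE -/F.
by elim: n => [|n IH]; rewrite ?compm1 // cpowS !compA gE.
Qed.

(** Lifting b to G along q turns a factorization q = b a into an endomorphism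
    of G that fixes q, hence is not nilpotent. *)
Lemma projective_of_surj_through G S Q (q : lhom G S) (a : lhom G Q) (b : lhom Q S) :
  @indecomposable (modcat L) G -> surj q -> (exists x : S, x <> 0) ->
  projective Q -> (forall x, q x = b (a x)) -> projective G.
Proof.
move=> indG qs [s s0] pQ qba; have [v vE] := proj_lift b pQ qs.
have fixq n x : q (iter n (lhom_comp v a) x) = q x.
  by elim: n => //= n IH; rewrite vE -qba.
have [[n n0]|[vai vas]] := fitting_mod hL (lhom_comp v a) indG.
  by have [x xs] := qs s; case: s0; rewrite -xs -(fixq n) n0 lmap0.
have [w [wK _]] := lhom_inv vai vas.
by apply: (projective_retract (i := a) (r := lhom_comp w v)) pQ.
Qed.

Lemma iter_cpow (M : fgmod L) (f : lhom M M) n :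
  (forall x, iter n f x = 0) -> cpow (f : @hom (modcat L) M M) n = 0.
Proof. by move=> f0; apply: lhomP => x; rewrite cpow_iter. Qed.

Lemma indec_summand_sub s s' T : (forall Y, List.In Y s -> List.In Y s') ->
  indec_summand_of s T -> indec_summand_of s' T.
Proof.
move=> ss sT G u v indG bij; have [Y [Ys GY]] := sT G u v indG bij.
by exists Y; split=> //; exact: ss.
Qed.

Lemma approximation_summands (l : seq (fgmod L)) : exists s, forall S, List.In S l ->
  exists X (f : lhom X S), [/\ gorenstein_projective X, indec_summand_of s X
    & forall X' (f' : lhom X' S), gorenstein_projective X' ->
      exists g : lhom X' X, forall x, f (g x) = f' x].
Proof.
elim: l => [|S l [s sP]]; first by exists [::].
have [X [f [gX fP]]] := hcf S; have [s' s'X] := finitely_many_summands hL X.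
exists (s' ++ s) => S' [<-|/sP[X' [f' [gX' sX' f'P]]]].
  exists X, f; split=> //.
    by apply: indec_summand_sub s'X => Y Ys; apply: List.in_or_app; left.
  move=> X' f' gX'; have [g gE] := fP X' f' gX'; exists g => x.
  exact: (congr1 (fun u : lhom X' S => u x) gE).
exists X', f'; split=> //.
by apply: indec_summand_sub sX' => Y Ys; apply: List.in_or_app; right.
Qed.

(** A projective indecomposable module mapping onto the simple module S is a
    summand of the regular module, which maps onto S as well; a non-projective one
    is a summand of the chosen approximation of S. *)
Lemma cm_finite_list : exists s : seq (fgmod L), forall G,
  gorenstein_projective G -> @indecomposable (modcat L) G ->
  exists Y, List.In Y s /\ @iso (modcat L) G Y.
Proof.
have [simples simplesP] := finitely_many_simples hL.
have [s sP] := approximation_summands simples.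
have [s' s'L] := finitely_many_summands hL (regular_mod L).
exists (s ++ s') => G gG indG.
have [S [q [Sin [S0 Smin] qs]]] := simplesP G (indecomposable_neq0 indG).
have [pG|npG] := pselect (projective G).
  have [x x0] := S0; have [pi piE] := regular_lhom x.
  have pis : surj pi.
    apply: Smin; first exact: image_submodule.
    by exists x; split=> //; exists 1; rewrite piE scale1r.
  have [u uE] := proj_lift q pG pis.
  have [v vE] := proj_lift pi (@regular_projective _ L) qs.
  have [[n n0]|bij] := fitting_mod hL (lhom_comp v u) indG.
    have fixq m y : q (iter m (lhom_comp v u) y) = q y.
      by elim: m => //= m IH; rewrite vE uE.
    by have [y yx] := qs x; case: x0; rewrite -yx -(fixq n) n0 lmap0.
  have [Y [Ys GY]] := s'L G u v indG bij; exists Y; split=> //.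
  by apply: List.in_or_app; right.
have [X [f [gX sX fP]]] := sP S Sin; have [g gE] := fP G q gG.
have [g' g'P] := stable_regular g gG gX.
have [[n n0]|bij] := fitting_mod hL (lhom_comp g' g) indG; last first.
  have [Y [Ys GY]] := sX G g g' indG bij; exists Y; split=> //.
  by apply: List.in_or_app; left.
have [P [b [a [pP gab]]]] := g'P n.
case: npG; apply: (projective_of_surj_through (a := a) (b := lhom_comp f b)) qs S0 pP _ => //.
move=> x /=; rewrite -gE; congr (f _).
have cp0 := iter_cpow n0; move: gab; rewrite cp0 compm0 subr0 => gab.
exact: (congr1 (fun u : lhom G X => u x) gab).
Qed.

End CMFinite.

(** * Arrows of modules *)

Section Arrows.
Variable R : nzRingType.
Implicit Types X Y Z : morcat R.

Definition afun X : lhom (asrc X) (atgt X) := amap X.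
Definition asrc_map X Y (h : hom X Y) : lhom (asrc X) (asrc Y) := h.1.
Definition atgt_map X Y (h : hom X Y) : lhom (atgt X) (atgt Y) := h.2.

Lemma ahomE X Y (h : hom X Y) x : atgt_map h (afun X x) = afun Y (asrc_map h x).
Proof. exact: (congr1 (fun u : lhom _ _ => u x) (eqP (ahomP h))). Qed.

Lemma ahom_ex X Y (a : lhom (asrc X) (asrc Y)) (b : lhom (atgt X) (atgt Y)) :
  (forall x, b (afun X x) = afun Y (a x)) ->
  exists h : hom X Y, asrc_map h = a /\ atgt_map h = b.
Proof.
move=> ab; have abP : (a, b) \in @square (modcat R) X Y.
  by apply/eqP; apply: lhomP.
by exists (Ahom abP).
Qed.

Lemma ahom_eq X Y (h h' : hom X Y) : (forall x, asrc_map h x = asrc_map h' x) ->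
  (forall x, atgt_map h x = atgt_map h' x) -> h = h'.
Proof.
move=> e1 e2; apply: val_inj; rewrite [LHS]surjective_pairing [RHS]surjective_pairing.
by congr pair; apply: lhomP.
Qed.

Lemma iso_morP X Y : @iso (morcat R) X Y <->
  exists (a : lhom (asrc X) (asrc Y)) (b : lhom (atgt X) (atgt Y)),
    [/\ forall x, b (afun X x) = afun Y (a x), injective a /\ surj a
      & injective b /\ surj b].
Proof.
split=> [[f [g [gf fg]]]|[a [b [ab [ai asu] [bi bs]]]]].
  exists (asrc_map f), (atgt_map f); split; first exact: ahomE.
    have E x : asrc_map g (asrc_map f x) = x := congr1 (fun h => asrc_map h x) gf.
    split=> [x y xy|y]; first by rewrite -(E x) xy E.
    by exists (asrc_map g y); exact: (congr1 (fun h => asrc_map h y) fg).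
  have E x : atgt_map g (atgt_map f x) = x := congr1 (fun h => atgt_map h x) gf.
  split=> [x y xy|y]; first by rewrite -(E x) xy E.
  by exists (atgt_map g y); exact: (congr1 (fun h => atgt_map h y) fg).
have [a' [aK Ka]] := lhom_inv ai asu; have [b' [bK Kb]] := lhom_inv bi bs.
have [f [f1 f2]] := ahom_ex ab.
have [|g [g1 g2]] := @ahom_ex Y X a' b'.
  by move=> y; rewrite -{1}(Ka y) -ab bK.
exists f, g; split; apply: ahom_eq => x.
- by rewrite -[LHS]/(asrc_map g (asrc_map f x)) f1 g1 aK.
- by rewrite -[LHS]/(atgt_map g (atgt_map f x)) f2 g2 bK.
- by rewrite -[LHS]/(asrc_map f (asrc_map g x)) f1 g1 Ka.
- by rewrite -[LHS]/(atgt_map f (atgt_map g x)) f2 g2 Kb.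
Qed.

(** Compare a map to zero: the cokernel K of a component gives a map to K -> 0 or
    to the identity of K, which the epimorphism forces to vanish. *)
Lemma mor_epi_surj Y Z (e : hom Y Z) : epi e -> surj (asrc_map e) /\ surj (atgt_map e).
Proof.
move=> epie; split.
  have [K [c [ce cs]]] := cokernel_ex (asrc_map e).
  have [//|u [u1 u2]] := @ahom_ex Z (mor (0 : lhom K (zero_mod R))) c 0.
  have u0 : u = 0.
    apply: epie; rewrite comp0m; apply: ahom_eq => y.
      by rewrite -[LHS]/(asrc_map u (asrc_map e y)) u1; apply/ce; exists y.
    by rewrite -[LHS]/(atgt_map u (atgt_map e y)) u2.
  by move=> z; apply/ce; rewrite -u1 u0.
have [K [c [ce cs]]] := cokernel_ex (atgt_map e).
have [//|u [u1 u2]] := @ahom_ex Z (mor (lhom_id K)) (lhom_comp c (afun Z)) c.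
have u0 : u = 0.
  apply: epie; rewrite comp0m; apply: ahom_eq => y.
    rewrite -[LHS]/(asrc_map u (asrc_map e y)) u1 /= -ahomE.
    by apply/ce; exists (afun Y y).
  by rewrite -[LHS]/(atgt_map u (atgt_map e y)) u2; apply/ce; exists y.
by move=> z; apply/ce; rewrite -u2 u0.
Qed.

Lemma projective_mor_id (P : fgmod R) : projective P ->
  @projective_obj (morcat R) (mor (lhom_id P)).
Proof.
move=> pP Y Z e /mor_epi_surj[e1 e2] f.
have [g gE] := proj_lift (asrc_map f) pP e1.
have [//|h [h1 h2]] := @ahom_ex (mor (lhom_id P)) Y g (lhom_comp (afun Y) g).
exists h; apply: ahom_eq => x.
  by rewrite -[LHS]/(asrc_map e (asrc_map h x)) h1 gE.
rewrite -[LHS]/(atgt_map e (atgt_map h x)) h2 /= ahomE gE -ahomE.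
by rewrite -[in RHS]/(lhom_id P x).
Qed.

Lemma projective_mor_zero (P : fgmod R) : projective P ->
  @projective_obj (morcat R) (mor (0 : lhom (zero_mod R) P)).
Proof.
move=> pP Y Z e /mor_epi_surj[e1 e2] f.
have [g gE] := proj_lift (atgt_map f) pP e2.
have [|h [h1 h2]] := @ahom_ex (mor (0 : lhom (zero_mod R) P)) Y 0 g.
  by move=> x; rewrite /= !lmap0.
exists h; apply: ahom_eq => x.
  by rewrite -[LHS]/(asrc_map e (asrc_map h x)) (thinmx0 x) !lmap0.
by rewrite -[LHS]/(atgt_map e (atgt_map h x)) h2 gE.
Qed.

(** The image of an idempotent endomorphism of an arrow has source, target and
    cokernel retracts of the given ones; see [retract_gp]. *)
Lemma sgprj_split : idempotents_split (SGprj R).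
Proof.
move=> [X SX] e ee; pose e1 := asrc_map e; pose e2 := atgt_map e.
have e1e x : e1 (e1 x) = e1 x := congr1 (fun h : @hom (morcat R) X X => asrc_map h x) ee.
have e2e x : e2 (e2 x) = e2 x := congr1 (fun h : @hom (morcat R) X X => atgt_map h x) ee.
have ef x : e2 (afun X x) = afun X (e1 x) := ahomE e x.
have [fi gA gB [C [c [[fc cs] gC]]]] := SX.
have [K1 [p1 [i1 [p1s i1i ip1]]]] := image_ex e1.
have [K2 [p2 [i2 [p2s i2i ip2]]]] := image_ex e2.
have pi1 x : p1 (i1 x) = x.
  by apply: i1i; rewrite ip1; have [y <-] := p1s x; rewrite ip1 e1e.
have pi2 x : p2 (i2 x) = x.
  by apply: i2i; rewrite ip2; have [y <-] := p2s x; rewrite ip2 e2e.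
pose f' : lhom K1 K2 := lhom_comp p2 (lhom_comp (afun X) i1).
have if' x : i2 (f' x) = afun X (i1 x).
  by rewrite /= ip2 ef -ip1 pi1.
have pf' x : f' (p1 x) = p2 (afun X x).
  by rewrite /= ip1 -ef -ip2 pi2.
have SY : in_SGprj (mor f').
  split.
  - by move=> x y /(congr1 i2); rewrite !if' => /fi /i1i.
  - exact: retract_gp pi1 gA.
  - exact: retract_gp pi2 gB.
  have [C' [c' [f'c' c's]]] := cokernel_ex f'; exists C', c'; split; first by split.
  have [|i3 i3E] := lhom_factor (h := lhom_comp c i2) c's.
    by move=> _ /f'c'[x <-]; apply/fc; exists (i1 x); rewrite -if'.
  have [|p3 p3E] := lhom_factor (h := lhom_comp c' p2) cs.
    by move=> _ /fc[x <-]; apply/f'c'; exists (p1 x); rewrite pf'.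
  apply: (retract_gp (i := i3) (r := p3)) gC => x; have [y <-] := c's x.
  by rewrite i3E /= p3E /= pi2.
have [|i [i_1 i_2]] := @ahom_ex (mor f') X i1 i2; first by move=> x; exact: if'.
have [|p [p_1 p_2]] := @ahom_ex X (mor f') p1 p2; first by move=> x; rewrite -pf'.
exists (exist _ (mor f') SY), i, p; split; apply: ahom_eq => x.
- by rewrite -[LHS]/(asrc_map p (asrc_map i x)) i_1 p_1 pi1.
- by rewrite -[LHS]/(atgt_map p (atgt_map i x)) i_2 p_2 pi2.
- by rewrite -[LHS]/(asrc_map i (asrc_map p x)) i_1 p_1 ip1.
- by rewrite -[LHS]/(atgt_map i (atgt_map p x)) i_2 p_2 ip2.
Qed.

Lemma iso_sgprj (X Y : SGprj R) : @iso (morcat R) (sval X) (sval Y) <-> iso X Y.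
Proof. by split. Qed.

Lemma sgprj_neq0 (X : SGprj R) : ~ zero_obj X ->
  (forall x : asrc (sval X), x = 0) -> exists y : atgt (sval X), y <> 0.
Proof.
move=> nz x0; apply: contrapT => no; apply: nz.
apply: (@ahom_eq (sval X) (sval X)) => y; first by rewrite (x0 y) !lmap0.
by apply: contrapT => y0; apply: no; exists y => ya; apply: y0; rewrite ya !lmap0.
Qed.

End Arrows.

(** * Classification of the indecomposable objects *)

Section Classification.
Variables (k : comNzRingType) (L : algType k).
Hypothesis hL : artin_algebra L.
Implicit Types X : SGprj L.

Lemma fitting_sgprj X (a : lhom (asrc (sval X)) (asrc (sval X)))
    (b : lhom (atgt (sval X)) (atgt (sval X))) : indecomposable X ->
  (forall x, b (afun (sval X) x) = afun (sval X) (a x)) ->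
  (exists n, (forall x, iter n a x = 0) /\ (forall y, iter n b y = 0)) \/
  ((injective a /\ surj a) /\ (injective b /\ surj b)).
Proof.
move=> indX ab; have [h [h1 h2]] := ahom_ex ab.
have powE n : (forall x, asrc_map (cpow (h : @hom (morcat L) _ _) n) x = iter n a x) /\
    forall y, atgt_map (cpow (h : @hom (morcat L) _ _) n) y = iter n b y.
  elim: n => [|n [IH1 IH2]]; first by [].
  split=> x /=; first by rewrite -IH1 -h1.
  by rewrite -IH2 -h2.
have [||[n n0]|[g [gh hg]]] := @fitting_lemma (SGprj L) X k
  (fun c f => (karrow (sval X) c : @hom (morcat L) _ _) \oc f) _ _ h
  (@sgprj_split L) indX (dcc_end_arrow hL (X := sval X)).
- by move=> c u v; rewrite (@compA (morcat L)).
- move=> c u v; apply: ahom_eq => x.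
    exact: (esym (lmap_kact (asrc_map (u : @hom (morcat L) _ _)) c _)).
  exact: (esym (lmap_kact (atgt_map (u : @hom (morcat L) _ _)) c _)).
- left; exists n; have [P1 P2] := powE n.
  have z : cpow (h : @hom (morcat L) _ _) n = 0.
    by rewrite -n0; elim: (n) => //= m ->.
  by split=> x; rewrite -?P1 -?P2 z.
right; have g1 x : asrc_map (g : @hom (morcat L) _ _) (a x) = x.
  by rewrite -h1; exact: (congr1 (fun u : @hom (morcat L) _ _ => asrc_map u x) gh).
have g1' x : a (asrc_map (g : @hom (morcat L) _ _) x) = x.
  by rewrite -h1; exact: (congr1 (fun u : @hom (morcat L) _ _ => asrc_map u x) hg).
have g2 x : atgt_map (g : @hom (morcat L) _ _) (b x) = x.
  by rewrite -h2; exact: (congr1 (fun u : @hom (morcat L) _ _ => atgt_map u x) gh).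
have g2' x : b (atgt_map (g : @hom (morcat L) _ _) x) = x.
  by rewrite -h2; exact: (congr1 (fun u : @hom (morcat L) _ _ => atgt_map u x) hg).
split; split=> [x y xy|y].
- by rewrite -(g1 x) xy g1.
- by exists (asrc_map (g : @hom (morcat L) _ _) y).
- by rewrite -(g2 x) xy g2.
- by exists (atgt_map (g : @hom (morcat L) _ _) y).
Qed.

Lemma iter_idem (M : fgmod L) (e : lhom M M) n x :
  (forall x, e (e x) = e x) -> iter n e (e x) = e x.
Proof. by move=> ee; elim: n => //= n ->. Qed.

Lemma indecomposable_of_lhom_idem (M : fgmod L) : (exists x : M, x <> 0) ->
  (forall e : lhom M M, (forall x, e (e x) = e x) ->
    (forall x, e x = 0) \/ (forall x, e x = x)) ->
  @indecomposable (modcat L) M.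
Proof.
move=> [x x0] idM; apply: indecomposable_of_idem.
  by move=> /zero_modP M0; exact: x0.
move=> e ee; have [y|e0|e1] := idM e; last 2 first.
- by left; apply: lhomP.
- by right; apply: lhomP.
exact: (congr1 (fun u : lhom M M => u y) ee).
Qed.

Hypothesis hss : G_semisimple L.

(** The arrow f : A -> B with cokernel c : B -> C, under the dichotomy for its
    endomorphisms (a, b).  Idempotents of A, B or C lift to endomorphisms of f,
    so indecomposability passes to the module that determines f. *)
Section FittingArrow.
Variables (A B C : fgmod L) (f : lhom A B) (c : lhom B C).
Hypothesis fitAB : forall (a : lhom A A) (b : lhom B B),
  (forall x, b (f x) = f (a x)) ->
  (exists n, (forall x, iter n a x = 0) /\ (forall y, iter n b y = 0)) \/
  ((injective a /\ surj a) /\ (injective b /\ surj b)).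
Hypotheses (gA : gorenstein_projective A) (gB : gorenstein_projective B)
  (gC : gorenstein_projective C) (sfc : ses f c).

Lemma indecomposable_src : (exists x : A, x <> 0) -> surj f ->
  @indecomposable (modcat L) A.
Proof.
move=> A0 fs; have [fi _ _] := sfc; have [g [gf fg]] := lhom_inv fi fs.
apply: indecomposable_of_lhom_idem => // e ee.
have [x|[n [n0 _]]|[[ei _] _]] := @fitAB e (lhom_comp f (lhom_comp e g)).
- by rewrite /= gf.
- by left=> x; rewrite -(iter_idem n x ee) n0.
- by right=> x; apply: ei.
Qed.

Lemma indecomposable_tgt : (exists x : B, x <> 0) -> (forall x : A, x = 0) ->
  @indecomposable (modcat L) B.
Proof.
move=> B0 A0; apply: indecomposable_of_lhom_idem => // e ee.
have [x|[n [_ n0]]|[_ [ei _]]] := @fitAB 0 e.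
- by rewrite (A0 x) !lmap0.
- by left=> x; rewrite -(iter_idem n x ee) n0.
- by right=> x; apply: ei.
Qed.

Hypotheses (nfs : ~ surj f) (A0 : exists x : A, x <> 0).

Lemma coker_neq0 : ~ forall y, c y = 0.
Proof. by have [_ fc _] := sfc => c0; apply: nfs => y; exact/fc. Qed.

(** Von Neumann regularity of f modulo projectives, f ~ f g f, leaves two
    options for the endomorphism (g f, f g): an isomorphism would make f
    surjective, so it is nilpotent and f factors through a projective Q.  As
    Ext^1(C, Q) vanishes, the map from A to Q extends to B, which makes
    (1, b a') an endomorphism; it is not nilpotent, so B is a summand of Q. *)
Lemma projective_tgt : projective B.
Proof.
have [fi fc cs] := sfc; have [g gP] := stable_regular hss f gA gB.
have [//|[n [n0 _]]|[_ [_ fgs]]] := @fitAB (lhom_comp g f) (lhom_comp f g); last first.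
  by case: nfs => y; have [x <-] := fgs y; exists (g x).
have [Q [b [a [pQ fba]]]] := gP n.
move: fba; rewrite (iter_cpow n0) compm0 subr0 => fba.
have [a' a'E] := gp_extend a gC sfc pQ.
have fE x : b (a' (f x)) = f x.
  by rewrite a'E; exact: (congr1 (fun u : lhom A B => u x) (esym fba)).
have [//|[m [m0 _]]|[_ [ui us]]] := @fitAB (lhom_id A) (lhom_comp b a').
  have [x []] := A0; rewrite -[RHS](m0 x); by elim: m {m0} => //= m <-.
have [w [wK _]] := lhom_inv ui us.
exact: (projective_retract (i := a') (r := lhom_comp w b)) pQ.
Qed.

Lemma lift_endo (b : lhom B B) (e : lhom C C) : (forall x, c (b x) = e (c x)) ->
  exists a : lhom A A, forall x, b (f x) = f (a x).
Proof.
move=> be; have [fi fc cs] := sfc.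
have [x|a aE] := @lhom_lift _ _ _ _ f (lhom_comp b f) fi; last by exists a.
by apply/fc; rewrite /= be (ses0 x sfc) lmap0.
Qed.

Lemma iter_lift (b : lhom B B) (e : lhom C C) n x : (forall x, c (b x) = e (c x)) ->
  c (iter n b x) = iter n e (c x).
Proof. by move=> be; elim: n => //= n <-. Qed.

(** If c h is onto, a lift t of c through c h makes h t an endomorphism of B over
    C; a nilpotent one would give c = c (h t)^n = 0. *)
Lemma cover_coker : proj_cover c.
Proof.
have [fi fc cs] := sfc; split=> // [|M h chs]; first exact: projective_tgt.
have [t tE] := proj_lift c projective_tgt chs.
have cb x : c (lhom_comp h t x) = lhom_id C (c x) by exact: tE.
have [a aE] := lift_endo cb.
have [//|[n [_ n0]]|[_ [_ us]]] := @fitAB a (lhom_comp h t).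
  case: coker_neq0 => y; have <- : iter n (lhom_id C) (c y) = c y by elim: (n).
  by rewrite -(iter_lift _ _ cb) n0 lmap0.
by move=> y; have [x <-] := us y; exists (t x).
Qed.

Lemma indecomposable_coker : @indecomposable (modcat L) C.
Proof.
have [fi fc cs] := sfc; apply: indecomposable_of_lhom_idem => [|e ee].
  apply: contrapT => no; apply: coker_neq0 => y.
  by apply: contrapT => y0; apply: no; exists (c y).
have [b be] := proj_lift (lhom_comp e c) projective_tgt cs.
have [a aE] := lift_endo be.
have [//|[n [_ n0]]|[_ [_ us]]] := @fitAB a b.
  left=> y; rewrite -(iter_idem n y ee); have [z zE] := cs (e y).
  by rewrite -zE -(iter_lift _ _ be) n0 lmap0.
right=> y; have [x <-] := cs y; have [z <-] := us x.
by rewrite be /= ee.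
Qed.

(** A section s of c gives the endomorphism (0, s c) of f, which is neither
    nilpotent, as s c is a nonzero idempotent, nor injective on A. *)
Lemma nonprojective_coker : ~ projective C.
Proof.
move=> pC; have [fi fc cs] := sfc; have [s sE] := proj_lift (lhom_id C) pC cs.
have [x|[n [_ n0]]|[[a0 _] _]] := @fitAB 0 (lhom_comp s c).
- by rewrite /= (ses0 x sfc) !lmap0.
- have ee y : lhom_comp s c (lhom_comp s c y) = lhom_comp s c y.
    by rewrite /= [c (s _)]sE.
  case: coker_neq0 => y; rewrite -[c y]sE.
  have <- : iter n (lhom_comp s c) (s (c y)) = s (c y) := iter_idem n y ee.
  by rewrite n0 lmap0.
- by have [x []] := A0; exact: a0.
Qed.

End FittingArrow.

Lemma sgprj_classification X : indecomposable X ->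
  exists G : fgmod L,
    [/\ @indecomposable (modcat L) G, gorenstein_projective G
      & [\/ @iso (morcat L) (sval X) (mor (0 : lhom (zero_mod L) G)),
            @iso (morcat L) (sval X) (mor (lhom_id G))
          | ~ projective G /\
            exists (P Om : fgmod L) (p : lhom P G) (i : lhom Om P),
              [/\ proj_cover p, is_kernel i p & @iso (morcat L) (sval X) (mor i)]]].
Proof.
case: X => -[A B f0] SX indX; pose f : lhom A B := f0.
have fitAB (a : lhom A A) (b : lhom B B) : (forall x, b (f x) = f (a x)) ->
    (exists n, (forall x, iter n a x = 0) /\ (forall y, iter n b y = 0)) \/
    ((injective a /\ surj a) /\ (injective b /\ surj b)).
  exact: (@fitting_sgprj (exist _ (mor f) SX) a b indX).
have [fi gA gB [C [c [[fc cs] gC]]]] := SX.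
have sfc : ses f c by split.
have [fs|nfs] := pselect (surj f).
  have [A0|A0] := pselect (exists x : A, x <> 0).
    exists A; split=> //; first exact: indecomposable_src sfc A0 fs.
    apply: Or32; have [g [gf fg]] := lhom_inv (fi : injective f) fs.
    apply/iso_morP; exists (lhom_id A), g; split=> [x|//|].
    - exact: gf.
    - by split=> // x; exists x.
    split=> [x y xy|x]; first by rewrite -(fg x) xy fg.
    by exists (f x).
  have A0' (x : A) : x = 0 by apply: contrapT => x0; apply: A0; exists x.
  have [y []] := sgprj_neq0 indX.1 A0'.
  by have [x <-] := fs y; rewrite (A0' x) lmap0.
have [A0|A0] := pselect (exists x : A, x <> 0).
  exists C; split=> //; first exact: indecomposable_coker fitAB gA gB gC sfc nfs A0.
  apply: Or33; split; first exact: nonprojective_coker fitAB sfc nfs A0.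
  exists B, A, c, f; split=> //; last exact: iso_refl.
  exact: cover_coker fitAB gA gB gC sfc nfs A0.
have A0' (x : A) : x = 0 by apply: contrapT => x0; apply: A0; exists x.
exists B; split=> //.
  by apply: (indecomposable_tgt fitAB) => //; exact: sgprj_neq0 indX.1 A0'.
apply: Or31; apply/iso_morP; exists 0, (lhom_id B); split=> [x||].
- by rewrite /= (A0' x) !lmap0.
- split=> [x y _|x]; first by rewrite (A0' x) (A0' y).
  by exists 0; rewrite (thinmx0 x) lmap0.
- by split=> // x; exists x.
Qed.

End Classification.

(** * Modules over the triangular matrix ring *)

Section TriangularEntries.
Variable R : nzRingType.
Implicit Types s t : T2 R.

Definition e11 t : R := T2_val t 0 0.
Definition e12 t : R := T2_val t 0 1.
Definition e22 t : R := T2_val t 1 1.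

Lemma ord2E (i : 'I_2) : i = 0 \/ i = 1.
Proof. by case: i => -[|[|//]] ?; [left|right]; exact: val_inj. Qed.

Lemma T2_val10 t : T2_val t 1 0 = 0.
Proof. exact: (eqP (T2P t)). Qed.

Lemma T2_eq s t : e11 s = e11 t -> e12 s = e12 t -> e22 s = e22 t -> s = t.
Proof.
move=> h1 h2 h3; apply: val_inj; apply/matrixP => i j.
have [->|->] := ord2E i; have [->|->] := ord2E j => //.
by rewrite !T2_val10.
Qed.

Lemma big_ord2 (F : 'I_2 -> R) : \sum_i F i = F 0 + F 1.
Proof.
rewrite big_ord_recl big_ord1; congr (_ + F _); exact: val_inj.
Qed.

Lemma e11M s t : e11 (s * t) = e11 s * e11 t.
Proof.
rewrite /e11 -[T2_val (s * t)]/(T2_val s *m T2_val t) mxE big_ord2.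
by rewrite T2_val10 mulr0 addr0.
Qed.

Lemma e12M s t : e12 (s * t) = e11 s * e12 t + e12 s * e22 t.
Proof. by rewrite /e12 -[T2_val (s * t)]/(T2_val s *m T2_val t) mxE big_ord2. Qed.

Lemma e22M s t : e22 (s * t) = e22 s * e22 t.
Proof.
rewrite /e22 -[T2_val (s * t)]/(T2_val s *m T2_val t) mxE big_ord2.
by rewrite T2_val10 mul0r add0r.
Qed.

Lemma t2_subproof (a b c : R) :
  (\matrix_(i, j) if i == 0 then if j == 0 then a else b
                  else if j == 0 then 0 else c) \in @upper2 R.
Proof. by rewrite unfold_in /= mxE. Qed.

Definition t2 (a b c : R) : T2 R := MkT2 (t2_subproof a b c).

Lemma e11_t2 a b c : e11 (t2 a b c) = a. Proof. by rewrite /e11 mxE. Qed.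
Lemma e12_t2 a b c : e12 (t2 a b c) = b. Proof. by rewrite /e12 mxE. Qed.
Lemma e22_t2 a b c : e22 (t2 a b c) = c. Proof. by rewrite /e22 mxE. Qed.

Lemma e11_1 : e11 1 = 1. Proof. by rewrite /e11 mxE. Qed.
Lemma e12_1 : e12 1 = 0. Proof. by rewrite /e12 mxE. Qed.
Lemma e22_1 : e22 1 = 1. Proof. by rewrite /e22 mxE. Qed.
Lemma e11D s t : e11 (s + t) = e11 s + e11 t. Proof. by rewrite /e11 mxE. Qed.
Lemma e12D s t : e12 (s + t) = e12 s + e12 t. Proof. by rewrite /e12 mxE. Qed.
Lemma e22D s t : e22 (s + t) = e22 s + e22 t. Proof. by rewrite /e22 mxE. Qed.

Definition t2E := (e11M, e12M, e22M, e11_t2, e12_t2, e22_t2,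
  e11_1, e12_1, e22_1, e11D, e12D, e22D).

Lemma t2M a b c a' b' c' :
  t2 a b c * t2 a' b' c' = t2 (a * a') (a * b' + b * c') (c * c').
Proof. by apply: T2_eq; rewrite !t2E. Qed.

Lemma t2D a b c a' b' c' : t2 a b c + t2 a' b' c' = t2 (a + a') (b + b') (c + c').
Proof. by apply: T2_eq; rewrite !t2E. Qed.

Lemma t2_eta t : t = t2 (e11 t) (e12 t) (e22 t).
Proof. by apply: T2_eq; rewrite !t2E. Qed.

End TriangularEntries.

Section TriangularModule.
Variables (R : nzRingType) (A B : lmodType R^c) (f : lhom A B).

Definition tmod_type : Type := (A * B)%type.
HB.instance Definition _ := GRing.Zmodule.copy tmod_type (A * B)%type.

(** Right multiplication of the row (x, y) by t, where f carries A to B in the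
    off-diagonal entry. *)
Definition tscale (t : (T2 R)^c) (x : tmod_type) : tmod_type :=
  ((e11 t : R^c) *: x.1, (e12 t : R^c) *: f x.1 + (e22 t : R^c) *: x.2).

Lemma tscaleA s t x : tscale s (tscale t x) = tscale (s * t) x.
Proof.
rewrite /tscale /= lmapZ scalerDr !scalerA addrA -scalerDl.
congr ((_ : R^c) *: _, (_ : R^c) *: _ + (_ : R^c) *: _).
- by rewrite -[RHS]/(e11 ((t : T2 R) * s)) e11M.
- by rewrite -[RHS]/(e12 ((t : T2 R) * s)) e12M.
- by rewrite -[RHS]/(e22 ((t : T2 R) * s)) e22M.
Qed.

Lemma tscale1 : left_id 1 tscale.
Proof.
case=> x y; rewrite -[LHS]/((e11 (1 : T2 R) : R^c) *: x,
  (e12 (1 : T2 R) : R^c) *: f x + (e22 (1 : T2 R) : R^c) *: y).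
by rewrite e11_1 e12_1 e22_1 !scale1r scale0r add0r.
Qed.

Lemma tscaleDr : right_distributive tscale +%R.
Proof.
move=> t x y; rewrite /tscale /= scalerDr lmapD !scalerDr addrACA.
by [].
Qed.

Lemma tscaleDl x : {morph tscale^~ x : s t / s + t}.
Proof.
move=> s t; rewrite -[LHS]/((e11 ((s : T2 R) + t) : R^c) *: x.1,
  (e12 ((s : T2 R) + t) : R^c) *: f x.1 + (e22 ((s : T2 R) + t) : R^c) *: x.2).
rewrite e11D e12D e22D -[LHS]/(((e11 s : R^c) + e11 t) *: x.1,
  ((e12 s : R^c) + e12 t) *: f x.1 + ((e22 s : R^c) + e22 t) *: x.2).
by rewrite !scalerDl addrACA.
Qed.

HB.instance Definition _ := GRing.Zmodule_isLmodule.Build (T2 R)^c tmod_type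
  tscaleA tscale1 tscaleDr tscaleDl.

Definition tmod : lmodType (T2 R)^c := tmod_type.

End TriangularModule.

Lemma fg_fin (R : nzRingType) (V : lmodType R) (I : finType) (v : I -> V) :
  (forall x, exists c : I -> R, x = \sum_i c i *: v i) -> finitely_generated V.
Proof.
move=> vP; exists #|I|, (fun j => v (enum_val j)) => x; have [c ->] := vP x.
exists (fun j => c (enum_val j)).
by rewrite (reindex (@enum_val I predT)) //=; exact: onW_bij (@enum_val_bij I).
Qed.

Section TriangularTheory.
Variable R : nzRingType.
Implicit Types A B : lmodType R^c.

Lemma t2Z A B (f : lhom A B) (a b c : R) (x : A) (y : B) :
  (t2 a b c : (T2 R)^c) *: ((x, y) : tmod f) =
  ((a : R^c) *: x, (b : R^c) *: f x + (c : R^c) *: y).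
Proof.
rewrite -[LHS]/((e11 (t2 a b c) : R^c) *: x,
  (e12 (t2 a b c) : R^c) *: f x + (e22 (t2 a b c) : R^c) *: y).
by rewrite e11_t2 e12_t2 e22_t2.
Qed.

Lemma tmod_hom A B A' B' (f : lhom A B) (f' : lhom A' B') (a : lhom A A')
    (b : lhom B B') : (forall x, b (f x) = f' (a x)) ->
  exists h : lhom (tmod f) (tmod f'), forall x, h x = (a x.1, b x.2).
Proof.
move=> ab; apply: lhom_ex => t [x y] [x' y'].
rewrite (t2_eta t) !t2Z -[LHS]/(a (_ + _), b (_ + _)) !(lmapD, lmapZ) ab.
by [].
Qed.

Lemma tmod_hom_inv A B A' B' (f : lhom A B) (f' : lhom A' B')
    (h : lhom (tmod f) (tmod f')) : exists (a : lhom A A') (b : lhom B B'),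
  (forall x, b (f x) = f' (a x)) /\ forall x, h x = (a x.1, b x.2).
Proof.
pose inl (x : A) : tmod f := (x, 0); pose inr (y : B) : tmod f := (0, y).
have h1 x : h (inl x) = ((h (inl x)).1, 0).
  have {1}-> : inl x = (t2 1 0 0 : (T2 R)^c) *: inl x.
    by rewrite t2Z scale1r !scale0r addr0.
  by rewrite lmapZ; case: (h _) => u v; rewrite t2Z scale1r !scale0r addr0.
have h2 y : h (inr y) = (0, (h (inr y)).2).
  have {1}-> : inr y = (t2 0 0 1 : (T2 R)^c) *: inr y.
    by rewrite t2Z scale1r !scale0r add0r.
  by rewrite lmapZ; case: (h _) => u v; rewrite t2Z scale1r !scale0r add0r.
have [|a aE] := @lhom_ex R A A' (fun x => (h (inl x)).1).
  move=> r x x'; have -> : inl (r *: x + x') = (@t2 R r 0 0 : (T2 R)^c) *: inl x + inl x'.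
    by rewrite t2Z !scale0r addr0; congr pair; rewrite addr0.
  by rewrite lmapP h1 t2Z.
have [|b bE] := @lhom_ex R B B' (fun y => (h (inr y)).2).
  move=> r y y'; have -> : inr (r *: y + y') = (@t2 R 0 0 r : (T2 R)^c) *: inr y + inr y'.
    by rewrite t2Z !scale0r add0r; congr pair; rewrite addr0.
  by rewrite lmapP h2 t2Z !scale0r add0r.
exists a, b; split=> [x|[x y]].
  have E : inr (f x) = (t2 0 1 0 : (T2 R)^c) *: inl x.
    by rewrite t2Z !scale0r scale1r addr0.
  by rewrite bE E lmapZ h1 t2Z scale1r !scale0r addr0 aE.
have -> : h (x, y) = h (inl x + inr y).
  by congr (h _); rewrite -[RHS]/(x + 0, 0 + y) addr0 add0r.
rewrite lmapD h1 h2 -[LHS]/((h (inl x)).1 + 0, 0 + (h (inr y)).2).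
by rewrite addr0 add0r /= aE bE.
Qed.

Section Restriction.
Variable M : lmodType (T2 R)^c.

Definition rmod_type : Type := M.
HB.instance Definition _ := GRing.Zmodule.on rmod_type.

(** The restriction of scalars along the diagonal embedding of R. *)
Definition rscale (r : R^c) (x : rmod_type) : rmod_type :=
  (@t2 R r 0 r : (T2 R)^c) *: (x : M).

Lemma actA (s t : T2 R) (x : M) :
  (s : (T2 R)^c) *: ((t : (T2 R)^c) *: x) = ((t * s : T2 R) : (T2 R)^c) *: x.
Proof. exact: scalerA. Qed.

Lemma rscaleA r s x : rscale r (rscale s x) = rscale (r * s) x.
Proof. by rewrite /rscale actA t2M !(mulr0, mul0r) addr0. Qed.

Lemma t2_1 : t2 1 0 1 = 1 :> T2 R.
Proof. by apply: T2_eq; rewrite !t2E. Qed.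

Lemma rscale1 : left_id 1 rscale.
Proof. by move=> x; rewrite /rscale t2_1; exact: scale1r. Qed.

Lemma rscaleDr : right_distributive rscale +%R.
Proof. by move=> r x y; exact: scalerDr. Qed.

Lemma rscaleDl x : {morph rscale^~ x : r s / r + s}.
Proof.
move=> r s; rewrite /rscale -[RHS](scalerDl (x : M)); congr (_ *: _).
by apply: T2_eq; rewrite [RHS]t2E !t2E // addr0.
Qed.

HB.instance Definition _ := GRing.Zmodule_isLmodule.Build R^c rmod_type
  rscaleA rscale1 rscaleDr rscaleDl.

(** The Peirce decomposition of M for the two diagonal idempotents; the matrix
    unit off the diagonal acts as the map between the two parts. *)
Lemma tmod_ess_surj : exists (A B : lmodType R^c) (f : lhom A B)
  (h : lhom (tmod f) M), injective h /\ surj h.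
Proof.
pose E1 : (T2 R)^c := t2 1 0 0; pose E2 : (T2 R)^c := t2 0 0 1.
pose N : (T2 R)^c := t2 0 1 0.
have rZ (r : R^c) (x : rmod_type) : r *: x = (@t2 R r 0 r : (T2 R)^c) *: (x : M) by [].
have [||A [i1 [i1i i1P]]] := @submod_ex R rmod_type (fun x => E1 *: (x : M) = x).
- exact: scaler0.
- move=> r x y xE yE; change (E1 *: ((@t2 R r 0 r : (T2 R)^c) *: (x : M) + (y : M))
    = (@t2 R r 0 r : (T2 R)^c) *: (x : M) + (y : M)).
  rewrite scalerDr yE -[in RHS]xE !actA !t2M; congr (_ *: _ + _).
  by rewrite !(mulr0, mul0r, mulr1, mul1r, addr0).
have [||B [i2 [i2i i2P]]] := @submod_ex R rmod_type (fun x => E2 *: (x : M) = x).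
- exact: scaler0.
- move=> r x y xE yE; change (E2 *: ((@t2 R r 0 r : (T2 R)^c) *: (x : M) + (y : M))
    = (@t2 R r 0 r : (T2 R)^c) *: (x : M) + (y : M)).
  rewrite scalerDr yE -[in RHS]xE !actA !t2M; congr (_ *: _ + _).
  by rewrite !(mulr0, mul0r, mulr1, mul1r, addr0, add0r).
have i1E x : E1 *: (i1 x : M) = i1 x by apply/i1P; exists x.
have i2E x : E2 *: (i2 x : M) = i2 x by apply/i2P; exists x.
have [|n nE] := @lhom_ex R A rmod_type (fun x => N *: (i1 x : M)).
  move=> r x y; rewrite lmapP.
  change (N *: ((@t2 R r 0 r : (T2 R)^c) *: (i1 x : M) + (i1 y : M))
    = (@t2 R r 0 r : (T2 R)^c) *: (N *: (i1 x : M)) + N *: (i1 y : M)).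
  rewrite scalerDr !actA !t2M; congr (_ *: _ + _).
  by rewrite !(mulr0, mul0r, mulr1, mul1r, addr0, add0r).
have [|f fE] := lhom_lift (h := n) i2i.
  move=> x; apply/i2P; rewrite nE actA t2M; congr (_ *: _).
  by rewrite !(mulr0, mul0r, mulr1, mul1r, addr0, add0r).
have [|h hE] := @lhom_ex (T2 R) (tmod f) M (fun x => (i1 x.1 : M) + (i2 x.2 : M)).
  move=> t [x y] [x' y']; rewrite (t2_eta t) t2Z.
  set p := e11 t; set q := e12 t; set s := e22 t.
  rewrite -[LHS]/((i1 (_ + _) : M) + (i2 (_ + _) : M)) !lmapD !lmapZ fE nE.
  have hx : (t2 p q s : (T2 R)^c) *: (i1 x : M) =
      (t2 p 0 p : (T2 R)^c) *: (i1 x : M) + (t2 q 0 q : (T2 R)^c) *: (N *: (i1 x : M)).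
    rewrite -(i1E x) !actA -scalerDl; congr (_ *: _).
    rewrite !t2M -[RHS]/(t2 _ _ _ + t2 _ _ _ : T2 R) t2D.
    by rewrite !(mulr0, mul0r, mulr1, mul1r, addr0, add0r).
  have hy : (t2 p q s : (T2 R)^c) *: (i2 y : M) = (t2 s 0 s : (T2 R)^c) *: (i2 y : M).
    rewrite -(i2E y) !actA; congr (_ *: _).
    by rewrite !t2M !(mulr0, mul0r, mulr1, mul1r, addr0, add0r).
  change ((((t2 p 0 p : (T2 R)^c) *: (i1 x : M)) + (i1 x' : M)) +
     ((((t2 q 0 q : (T2 R)^c) *: (N *: (i1 x : M))) +
       ((t2 s 0 s : (T2 R)^c) *: (i2 y : M))) + (i2 y' : M)) =
    (t2 p q s : (T2 R)^c) *: ((i1 x : M) + (i2 y : M)) + ((i1 x' : M) + (i2 y' : M))).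
  by rewrite scalerDr hx hy [LHS]addrACA; congr (_ + _); rewrite addrA.
exists A, B, f, h; split.
  have ker x y : (i1 x : M) + (i2 y : M) = 0 -> x = 0.
    move=> xy0; apply: i1i; rewrite lmap0 -[LHS]i1E -[RHS](scaler0 M E1) -xy0.
    rewrite scalerDr -(i2E y) actA t2M !(mulr0, mul0r, addr0).
    have -> : t2 0 0 0 = 0 :> T2 R by apply: T2_eq; rewrite !t2E /e11 /e12 /e22 mxE.
    by rewrite scale0r addr0.
  apply: lhom_inj => -[x y]; rewrite hE /= => xy0; have x0 := ker x y xy0.
  rewrite x0 lmap0 add0r in xy0; rewrite x0.
  by congr pair; apply: i2i; rewrite lmap0.
move=> m; have /i1P[x xE] : E1 *: (E1 *: m) = E1 *: m.
  by rewrite actA t2M !(mulr0, mul0r, mulr1, addr0).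
have /i2P[y yE] : E2 *: (E2 *: m) = E2 *: m.
  by rewrite actA t2M !(mulr0, mul0r, mulr1, addr0).
exists (x, y); rewrite hE /= xE yE -scalerDl -[RHS]scale1r; congr (_ *: _).
by rewrite -[LHS]/(t2 1 0 0 + t2 0 0 1 : T2 R) t2D !(addr0, add0r); exact: t2_1.
Qed.

End Restriction.

Lemma tmod_fg A B (f : lhom A B) : finitely_generated A -> finitely_generated B ->
  finitely_generated (tmod f).
Proof.
move=> [n [u uP]] [m [v vP]].
apply: (@fg_fin _ _ ('I_n + 'I_m)%type (fun i => match i with inl i => (u i, 0)
  | inr j => (0, v j) end : tmod f)) => -[x y].
have [c ->] := uP x; have [d ->] := vP y.
exists (fun i => match i with inl i => @t2 R (c i) 0 0 | inr j => @t2 R 0 0 (d j) end).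
have H1 i : (@t2 R (c i) 0 0 : (T2 R)^c) *: ((u i, 0) : tmod f) = (c i *: u i, 0).
  by rewrite t2Z !scale0r addr0.
have H2 i : (@t2 R 0 0 (d i) : (T2 R)^c) *: ((0, v i) : tmod f) = (0, d i *: v i).
  by rewrite t2Z !scale0r add0r.
rewrite big_sumType /= (eq_bigr _ (fun i _ => H1 i)) (eq_bigr _ (fun i _ => H2 i)).
have E1 : \sum_(i < n) ((c i *: u i, 0) : tmod f) = (\sum_i c i *: u i, 0).
  by elim/big_rec2: _ => // i z w _ ->; rewrite -[LHS]/(_ + _, 0 + 0) addr0.
have E2 : \sum_(i < m) ((0, d i *: v i) : tmod f) = (0, \sum_i d i *: v i).
  by elim/big_rec2: _ => // i z w _ ->; rewrite -[LHS]/(0 + 0, _ + _) addr0.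
by rewrite E1 E2 -[RHS]/(_ + 0, 0 + _) addr0 add0r.
Qed.

Lemma tmod_fg_src A B (f : lhom A B) :
  finitely_generated (tmod f) -> finitely_generated A.
Proof.
move=> [n [v vP]]; exists n, (fun i => (v i).1) => x; have [c cE] := vP (x, 0).
exists (fun i => e11 (c i)); rewrite -[LHS]/((x, 0 : B).1) cE.
by rewrite (big_morph (fun z : tmod f => z.1) (fun _ _ => erefl) erefl).
Qed.

Lemma tmod_fg_tgt A B (f : lhom A B) :
  finitely_generated (tmod f) -> finitely_generated B.
Proof.
move=> [n [v vP]]; apply: (@fg_fin _ _ ('I_n + 'I_n)%type (fun i => match i with
  inl i => f (v i).1 | inr i => (v i).2 end)) => y; have [c cE] := vP (0, y).
exists (fun i => match i with inl i => e12 (c i) | inr i => e22 (c i) end).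
rewrite big_sumType /= -big_split -[LHS]/((0 : A, y).2) cE.
by rewrite (big_morph (fun z : tmod f => z.2) (fun _ _ => erefl) erefl).
Qed.

End TriangularTheory.

(** * Gorenstein projective modules over the triangular matrix ring *)

Section TriangularGorenstein.
Variable R : nzRingType.

Section Projectives.
Variables (A B : lmodType R^c) (f : lhom A B).

Lemma tmod_proj_lift (A' B' A'' B'' : lmodType R^c) (f' : lhom A' B')
    (f'' : lhom A'' B'') (p : lhom A' A'') (q : lhom B' B'') (a : lhom A A'')
    (b : lhom B B'') : projective (tmod f) ->
  (forall x, q (f' x) = f'' (p x)) -> surj p -> surj q ->
  (forall x, b (f x) = f'' (a x)) ->
  exists (u : lhom A A') (v : lhom B B'), [/\ forall x, v (f x) = f' (u x),
    forall x, p (u x) = a x & forall y, q (v y) = b y].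
Proof.
move=> pf pq ps qs ab; have [H HE] := tmod_hom ab; have [E EE] := tmod_hom pq.
have Es : surj E.
  by move=> [x y]; have [x' <-] := ps x; have [y' <-] := qs y; exists (x', y').
have [G GE] := proj_lift H pf Es; have [u [v [uv GE']]] := tmod_hom_inv G.
exists u, v; split=> // x.
  by have := GE (x, 0); rewrite GE' EE HE => -[].
by have := GE (0, x); rewrite GE' EE HE => -[].
Qed.

(** Evaluation of arrows at the target is left adjoint to taking N to its
    identity arrow, which preserves surjections.  The next lemmas use in the same
    way N -> 0 for the source and 0 -> N for the cokernel. *)
Lemma tmod_proj_tgt : projective (tmod f) -> projective B.
Proof.
move=> pf M N e es h.
have [u [v [_ _ vE]]] := @tmod_proj_lift _ _ _ _ (lhom_id M) (lhom_id N) e e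
  (lhom_comp h f) h pf (fun _ => erefl) es es (fun _ => erefl).
by exists v.
Qed.

Lemma tmod_proj_src : projective (tmod f) -> projective A.
Proof.
move=> pf M N e es h.
have [//|x|//|u [v [_ uE _]]] := @tmod_proj_lift _ _ _ _ (0 : lhom M (zero_mod R))
  (0 : lhom N (zero_mod R)) e (lhom_id _) h 0 pf _ es.
  by exists x.
by exists u.
Qed.

Lemma tmod_proj_coker (C : lmodType R^c) (c : lhom B C) :
  exact_at f c -> surj c -> projective (tmod f) -> projective C.
Proof.
move=> fc cs pf M N e es h.
have [||//||u [v [vf _ vE]]] := @tmod_proj_lift _ _ _ _ (0 : lhom (zero_mod R) M)
  (0 : lhom (zero_mod R) N) (lhom_id _) e 0 (lhom_comp h c) pf.
- by move=> x; rewrite /= lmap0.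
- by move=> x; exists x.
- by move=> x /=; rewrite (_ : c (f x) = 0) ?lmap0 //; apply/fc; exists x.
have [|g gE] := lhom_factor (h := v) cs.
  by move=> _ /fc[x <-]; rewrite vf.
by exists g => y; have [x <-] := cs y; rewrite gE [LHS]vE.
Qed.

(** Lift the identity of f along the surjection onto f from the split
    monomorphism A -> A x B. *)
Lemma tmod_proj_inj : projective (tmod f) -> injective f.
Proof.
move=> pf; have [i iE] := pair_lhom (lhom_id A) (0 : lhom A B).
have [q qE] := copair_lhom f (lhom_id B).
have [|||//|u [v [vf uE _]]] := @tmod_proj_lift _ _ _ _ i f (lhom_id A) q (lhom_id A)
  (lhom_id B) pf.
- by move=> x; rewrite qE iE /= addr0.
- by move=> x; exists x.
- by move=> y; exists (0, y); rewrite qE /= lmap0 add0r.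
apply: lhom_inj => x fx; have := vf x; rewrite fx lmap0 iE => -[ux].
by rewrite -[LHS]uE /= -ux.
Qed.

End Projectives.

(** Lifting against surjections of arrows is enough, since every module over the
    triangular ring comes from an arrow. *)
Lemma tmod_projective (A B : lmodType R^c) (f : lhom A B) :
  (forall (A' B' A'' B'' : lmodType R^c) (f' : lhom A' B') (f'' : lhom A'' B'')
      (p : lhom A' A'') (q : lhom B' B'') (a : lhom A A'') (b : lhom B B''),
    (forall x, q (f' x) = f'' (p x)) -> surj p -> surj q ->
    (forall x, b (f x) = f'' (a x)) ->
    exists (u : lhom A A') (v : lhom B B'), [/\ forall x, v (f x) = f' (u x),
      forall x, p (u x) = a x & forall y, q (v y) = b y]) ->
  projective (tmod f).
Proof.
move=> lift M N e es h.
have [A' [B' [f' [m [mi ms]]]]] := tmod_ess_surj M.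
have [A'' [B'' [f'' [n [ni ns]]]]] := tmod_ess_surj N.
have [n' [nK Kn]] := lhom_inv ni ns; have [m' [mK Km]] := lhom_inv mi ms.
pose E : lhom (tmod f') (tmod f'') := lhom_comp n' (lhom_comp (e : lhom M N) m).
pose H : lhom (tmod f) (tmod f'') := lhom_comp n' (h : lhom (tmod f) N).
have [p [q [pq pqE]]] := tmod_hom_inv E; have [a [b [ab abE]]] := tmod_hom_inv H.
have sE z : exists w, E w = z.
  have [y yE] := es (n z); have [w wE] := ms y; exists w.
  by rewrite /= wE [e y]yE nK.
have [||||u [v [uv uE vE]]] := lift _ _ _ _ f' f'' p q a b => //.
- by move=> x; have [[x' y']] := sE (x, 0); rewrite pqE => -[<- _]; exists x'.
- by move=> x; have [[x' y']] := sE (0, x); rewrite pqE => -[_ <-]; exists y'.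
have [g gE] := tmod_hom uv.
exists (lhom_comp m g) => z; rewrite -[LHS]Kn -[RHS]Kn; congr (n _).
by rewrite -[LHS]/(E (g z)) -[RHS]/(H z) pqE gE abE /= uE vE.
Qed.

Lemma tmod_projective_id (Q : lmodType R^c) : projective Q ->
  projective (tmod (lhom_id Q)).
Proof.
move=> pQ; apply: tmod_projective => A' B' A'' B'' f' f'' p q a b pq ps qs ab.
have [g gE] := proj_lift a pQ ps; exists g, (lhom_comp f' g); split=> // y.
by rewrite /= pq gE -ab.
Qed.

Lemma tmod_projective_zero (Q : lmodType R^c) : projective Q ->
  projective (tmod (0 : lhom (zero_mod R) Q)).
Proof.
move=> pQ; apply: tmod_projective => A' B' A'' B'' f' f'' p q a b pq ps qs ab.
have [g gE] := proj_lift b pQ qs; exists 0, g; split=> // x; rewrite /= ?lmap0 //.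
by rewrite (thinmx0 x) lmap0.
Qed.

Definition tfg (A B : fgmod R) (f : lhom A B) : fgmod (T2 R) :=
  Fgmod (tmod_fg f (fgmodP A) (fgmodP B)).

Lemma tfg_ess_surj (M : fgmod (T2 R)) : exists (A B : fgmod R) (f : lhom A B)
  (h : lhom M (tfg f)), injective h /\ surj h.
Proof.
have [A [B [f [h [hi hs]]]]] := tmod_ess_surj M; have [g [gh hg]] := lhom_inv hi hs.
have gs : surj g by move=> x; exists (h x); exact: gh.
have fgf := fg_surj gs (fgmodP M).
exists (Fgmod (tmod_fg_src fgf)), (Fgmod (tmod_fg_tgt fgf)), f, g; split=> //.
by move=> x y xy; rewrite -(hg x) xy hg.
Qed.

(** [gp_step] for modules over the triangular ring, written in terms of arrows. *)
Definition tstep (A B A' B' : fgmod R) (f : lhom A B) (f' : lhom A' B') : Prop :=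
  exists (P Q : fgmod R) (p : lhom P Q) (i1 : lhom A P) (i2 : lhom B Q)
    (q1 : lhom P A') (q2 : lhom Q B'),
    [/\ projective (tmod p),
      (forall x, i2 (f x) = p (i1 x)) /\ (forall x, q2 (p x) = f' (q1 x)),
      ses i1 q1, ses i2 q2
    & forall (S T : fgmod R) (s : lhom S T), projective (tmod s) ->
      forall (u : lhom A S) (v : lhom B T), (forall x, v (f x) = s (u x)) ->
      exists (u' : lhom P S) (v' : lhom Q T),
        [/\ forall x, v' (p x) = s (u' x), forall x, u' (i1 x) = u x
          & forall y, v' (i2 y) = v y]].

Lemma ses_components (A B A' B' A'' B'' : lmodType R^c) (f : lhom A B)
    (f' : lhom A' B') (f'' : lhom A'' B'') (i1 : lhom A A') (i2 : lhom B B')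
    (q1 : lhom A' A'') (q2 : lhom B' B'') (i : lhom (tmod f) (tmod f'))
    (q : lhom (tmod f') (tmod f'')) :
  (forall x, i x = (i1 x.1, i2 x.2)) -> (forall x, q x = (q1 x.1, q2 x.2)) ->
  ses i q -> ses i1 q1 /\ ses i2 q2.
Proof.
move=> iE qE [ii iq qs]; split; split.
- apply: lhom_inj => x x0; suff [] : ((x, 0) : tmod f) = 0 by [].
  by apply: ii; rewrite lmap0 iE /= x0 lmap0.
- move=> y; split=> [y0|[x <-]].
    have /iq[[x x'] /=] : q (y, 0) = 0 by rewrite qE /= y0 lmap0.
    by rewrite iE => -[<- _]; exists x.
  by have : q (i (x, 0)) = 0 by [apply/iq; exists (x, 0)]; rewrite qE iE => -[].
- by move=> y; have [[x x'] /=] := qs (y, 0); rewrite qE => -[<- _]; exists x.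
- apply: lhom_inj => x x0; suff [] : ((0, x) : tmod f) = 0 by [].
  by apply: ii; rewrite lmap0 iE /= x0 lmap0.
- move=> y; split=> [y0|[x <-]].
    have /iq[[x' x] /=] : q (0, y) = 0 by rewrite qE /= y0 lmap0.
    by rewrite iE => -[_ <-]; exists x.
  by have : q (i (0, x)) = 0 by [apply/iq; exists (0, x)]; rewrite qE iE => -[].
- by move=> y; have [[x' x] /=] := qs (0, y); rewrite qE => -[_ <-]; exists x.
Qed.

Lemma gp_step_tstep (A B A' B' : fgmod R) (f : lhom A B) (f' : lhom A' B') :
  gp_step (tfg f) (tfg f') -> tstep f f'.
Proof.
move=> [X [i [q [pX [ii iq qs] ext]]]].
have [P [Q [p [h [hi hs]]]]] := tfg_ess_surj X; have [h' [hK Kh]] := lhom_inv hi hs.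
have [i1 [i2 [i12 iE]]] := tmod_hom_inv (lhom_comp h i : lhom (tmod f) (tmod p)).
have [q1 [q2 [q12 qE]]] := tmod_hom_inv (lhom_comp q h' : lhom (tmod p) (tmod f')).
have sE : ses (lhom_comp h i : lhom (tmod f) (tmod p))
    (lhom_comp q h' : lhom (tmod p) (tmod f')).
  split.
  - by move=> x y /hi /ii.
  - move=> y; split=> [/iq[x xE]|[x <-]]; first by exists x; rewrite /= xE Kh.
    by rewrite /= hK; apply/iq; exists x.
  - by move=> y; have [x <-] := qs y; exists (h x); rewrite /= hK.
have [s1 s2] := ses_components iE qE sE.
exists P, Q, p, i1, i2, q1, q2; split=> //.
  exact: (projective_retract (i := h') (r := h)) pX.
move=> S T s ps u v uv; have [w wE] := tmod_hom uv.
have [g gE] := ext (tfg s) ps w.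
have [u' [v' [uv' gE']]] := tmod_hom_inv (lhom_comp g h' : lhom (tmod p) (tmod s)).
have E z : (u' (i1 z.1), v' (i2 z.2)) = (u z.1, v z.2) :> tmod s.
  rewrite -wE -gE -[in RHS](hK (i z)) -[RHS]/(lhom_comp g h' _) gE'.
  by rewrite -[h (i z)]/(lhom_comp h i z) iE.
exists u', v'; split=> // x.
  by have [] := E (x, 0).
by have [] := E (0, x).
Qed.

Definition tgp (A B : fgmod R) (f : lhom A B) := gorenstein_projective (tfg f).

Lemma gp_iso (S : nzRingType) (M N : fgmod S) (h : lhom M N) :
  injective h -> surj h -> gorenstein_projective M -> gorenstein_projective N.
Proof.
move=> hi hs; have [g [gh hg]] := lhom_inv hi hs.
exact: (retract_gp (i := g) (r := h)).
Qed.

Lemma gp_step_iso_tgt (S : nzRingType) (M N N' : fgmod S) (h : lhom N N') :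
  injective h -> surj h -> gp_step M N -> gp_step M N'.
Proof.
move=> hi hs [P [i [p [pP [ii ip ps] ext]]]]; exists P, i, (lhom_comp h p).
split=> //; split=> // [x|y]; last first.
  by have [z <-] := hs y; have [x <-] := ps z; exists x.
rewrite -ip /=; split=> [|->]; last exact: lmap0.
by rewrite -[0](lmap0 h) => /hi.
Qed.

Lemma gp_step_iso_src (S : nzRingType) (M M' N : fgmod S) (h : lhom M' M) :
  injective h -> surj h -> gp_step M N -> gp_step M' N.
Proof.
move=> hi hs [P [i [p [pP [ii ip ps] ext]]]]; exists P, (lhom_comp i h), p.
have [g [gh hg]] := lhom_inv hi hs.
split=> // [|Q pQ u]; last first.
  have [v vE] := ext Q pQ (lhom_comp u g); exists v => x.
  by rewrite /= vE /= gh.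
split=> // [x y /ii /hi //|y]; rewrite ip; split=> [[x <-]|[x <-]].
  by exists (g x); rewrite /= hg.
by exists (h x).
Qed.

Lemma tgp_succ (A B : fgmod R) (f : lhom A B) : tgp f ->
  exists (A' B' : fgmod R) (f' : lhom A' B'), tgp f' /\ tstep f f'.
Proof.
move=> /gp_succ[N [gN st]]; have [A' [B' [f' [h [hi hs]]]]] := tfg_ess_surj N.
exists A', B', f'; split; first exact: gp_iso hi hs gN.
exact/gp_step_tstep/(gp_step_iso_tgt hi hs).
Qed.

Lemma tgp_pred (A B : fgmod R) (f : lhom A B) : tgp f ->
  exists (A' B' : fgmod R) (f' : lhom A' B'), tgp f' /\ tstep f' f.
Proof.
move=> /gp_pred[N [gN st]]; have [A' [B' [f' [h [hi hs]]]]] := tfg_ess_surj N.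
exists A', B', f'; split; first exact: gp_iso hi hs gN.
have [g [gh hg]] := lhom_inv hi hs; apply: gp_step_tstep.
by apply: (gp_step_iso_src (h := g)) st; [exact: can_inj hg|move=> x; exists (h x)].
Qed.

(** The module of f embeds into that of an arrow p with projective module, and p is
    injective. *)
Lemma tgp_inj (A B : fgmod R) (f : lhom A B) : tgp f -> injective f.
Proof.
move=> /tgp_succ[A' [B' [f' [_ [P [Q [p [i1 [i2 [q1 [q2 [pp [i12 _] [ii _ _] _ _]]]]]]]]]]]].
apply: lhom_inj => x fx; apply: ii; apply: (tmod_proj_inj pp).
by rewrite -i12 fx !lmap0.
Qed.

(** Maps from the targets to S are maps of arrows to the identity of S, which is
    projective if S is; maps from the cokernels to S are maps to 0 -> S. *)
Lemma tstep_tgt (A B A' B' : fgmod R) (f : lhom A B) (f' : lhom A' B') :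
  tstep f f' -> gp_step B B'.
Proof.
move=> [P [Q [p [i1 [i2 [q1 [q2 [pp _ _ s2 ext]]]]]]]]; exists Q, i2, q2.
split=> // [|S pS h]; first exact: tmod_proj_tgt pp.
have [//|u' [v' [_ _ vE]]] := ext S S (lhom_id S) (tmod_projective_id pS) (lhom_comp h f) h.
by exists v'.
Qed.

(** Exactness on the left at the cokernels is the snake lemma; it needs f' to be
    injective. *)
Lemma tstep_coker (A B A' B' C C' : fgmod R) (f : lhom A B) (f' : lhom A' B')
    (c : lhom B C) (c' : lhom B' C') : injective f' ->
  is_cokernel f c -> is_cokernel f' c' -> tstep f f' -> gp_step C C'.
Proof.
move=> fi' [fc cs] [fc' cs'].
move=> [P [Q [p [i1 [i2 [q1 [q2 [pp [i12 q12] s1 s2 ext]]]]]]]].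
have [i1i iq1 q1s] := s1; have [i2i iq2 q2s] := s2.
have [K [d [pd ds]]] := cokernel_ex p.
have [|i iE] := lhom_factor (h := lhom_comp d i2) cs.
  by move=> _ /fc[x <-]; apply/pd; exists (i1 x); rewrite i12.
have [|q qE] := lhom_factor (h := lhom_comp c' q2) ds.
  by move=> _ /pd[x <-]; apply/fc'; exists (q1 x); rewrite q12.
exists K, i, q; split.
- exact: tmod_proj_coker pd ds pp.
- split.
  + apply: lhom_inj => z; have [y <-] := cs z; rewrite iE /= => /pd[x xE].
    have /iq1[w wE] : q1 x = 0.
      by apply: fi'; rewrite -q12 xE (ses0 _ s2) lmap0.
    apply/fc; exists w; apply: i2i; by rewrite i12 wE.
  + move=> z; have [y <-] := ds z; rewrite qE /=; split=> [/fc'[x xE]|[w wE]].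
      have [w wE] := q1s x; have /iq2[b bE] : q2 (y - p w) = 0.
        by rewrite lmapB q12 wE xE subrr.
      exists (c b); rewrite iE /= bE lmapB (_ : d (p w) = 0) ?subr0 //.
      by apply/pd; exists w.
    rewrite -[LHS]qE -wE; have [b <-] := cs w; rewrite iE /= qE /= (ses0 _ s2).
    exact: lmap0.
  + by move=> z; have [y <-] := cs' z; have [x <-] := q2s y; exists (d x).
move=> S pS h.
have [|u' [v' [vp _ vE]]] := ext (zero_mod R) S 0 (tmod_projective_zero pS) 0 (lhom_comp h c).
  by move=> x /=; rewrite (_ : c (f x) = 0) ?lmap0 //; apply/fc; exists x.
have [|g gE] := lhom_factor (h := v') ds.
  by move=> _ /pd[x <-]; rewrite vp.
by exists g => z; have [y <-] := cs z; rewrite iE /= gE vE.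
Qed.

(** A map A -> S first extends to B, because the cokernel of f is Gorenstein
    projective, and then the step extends it to the middle arrow. *)
Lemma tstep_src (A B A' B' C : fgmod R) (f : lhom A B) (f' : lhom A' B')
    (c : lhom B C) : ses f c -> gorenstein_projective C ->
  tstep f f' -> gp_step A A'.
Proof.
move=> sfc gC st; have [P [Q [p [i1 [i2 [q1 [q2 [pp [i12 q12] s1 s2 ext]]]]]]]] := st.
exists P, i1, q1; split=> //; first exact: tmod_proj_src pp.
move=> S pS h; have [h' h'E] := gp_extend h gC sfc pS.
have [//|u' [v' [vp uE _]]] := ext S S (lhom_id S) (tmod_projective_id pS) h h'.
by exists u'.
Qed.

End TriangularGorenstein.

Lemma mem_In (T : eqType) (x : T) (s : seq T) : x \in s -> List.In x s.
Proof. by elim: s => //= y s IH; rewrite inE => /orP[/eqP->|/IH]; [left|right]. Qed.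

(** The class of targets of Gorenstein projective arrows is closed under steps in
    both directions, and so are those of cokernels and of sources. *)
Section TriangularToArrows.
Variable R : nzRingType.

Lemma tgp_tgt (A B : fgmod R) (f : lhom A B) : tgp f -> gorenstein_projective B.
Proof.
move=> gf; apply: (gp_of_steps (S := fun G => exists (A : fgmod R) (f : lhom A G), tgp f));
  last by exists A, f.
- move=> G [A1 [f1 /tgp_succ[A' [B' [f' [gf' st]]]]]]; exists B'.
  by split; [exists A', f'|exact: tstep_tgt st].
- move=> G [A1 [f1 /tgp_pred[A' [B' [f' [gf' st]]]]]]; exists B'.
  by split; [exists A', f'|exact: tstep_tgt st].
Qed.

Lemma tgp_coker (A B C : fgmod R) (f : lhom A B) (c : lhom B C) :
  is_cokernel f c -> tgp f -> gorenstein_projective C.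
Proof.
move=> fc gf; apply: (gp_of_steps (S := fun G => exists (A B : fgmod R) (f : lhom A B)
  (c : lhom B G), tgp f /\ is_cokernel f c)); last by exists A, B, f, c.
- move=> G [A1 [B1 [f1 [c1 [gf1 fc1]]]]].
  have [A' [B' [f' [gf' st]]]] := tgp_succ gf1; have [G' [c' fc']] := cokernel_ex f'.
  exists G'; split; first by exists A', B', f', c'.
  exact: (tstep_coker (tgp_inj gf') fc1 fc' st).
- move=> G [A1 [B1 [f1 [c1 [gf1 fc1]]]]].
  have [A' [B' [f' [gf' st]]]] := tgp_pred gf1; have [G' [c' fc']] := cokernel_ex f'.
  exists G'; split; first by exists A', B', f', c'.
  exact: (tstep_coker (tgp_inj gf1) fc' fc1 st).
Qed.

Lemma tgp_src (A B : fgmod R) (f : lhom A B) : tgp f -> gorenstein_projective A.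
Proof.
have src_step (A1 B1 A2 B2 : fgmod R) (f1 : lhom A1 B1) (f2 : lhom A2 B2) :
    tgp f1 -> tstep f1 f2 -> gp_step A1 A2.
  move=> g1; have [C [c fc]] := cokernel_ex f1; have [fc1 fc2] := fc.
  by apply: (tstep_src (c := c)); [split=> //; exact: tgp_inj|exact: tgp_coker fc g1].
move=> gf; apply: (gp_of_steps (S := fun G => exists (B : fgmod R) (f : lhom G B), tgp f));
  last by exists B, f.
- move=> G [B1 [f1 gf1]]; have [A' [B' [f' [gf' st]]]] := tgp_succ gf1; exists A'.
  by split; [exists B', f'|exact: src_step gf1 st].
- move=> G [B1 [f1 gf1]]; have [A' [B' [f' [gf' st]]]] := tgp_pred gf1; exists A'.
  by split; [exists B', f'|exact: src_step gf' st].
Qed.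

Lemma tgp_sgprj (A B : fgmod R) (f : lhom A B) : tgp f -> in_SGprj (mor f).
Proof.
move=> gf; split; [exact: tgp_inj|exact: tgp_src gf|exact: tgp_tgt gf|].
by have [C [c fc]] := cokernel_ex f; exists C, c; split=> //; exact: tgp_coker fc gf.
Qed.

Lemma tfg_iso (A B A' B' : fgmod R) (f : lhom A B) (f' : lhom A' B') :
  @iso (morcat R) (mor f) (mor f') -> @iso (modcat (T2 R)) (tfg f) (tfg f').
Proof.
move=> /iso_morP[a [b [ab [ai asu] [bi bs]]]]; have [h hE] := tmod_hom ab.
apply/iso_modP; exists h; split=> [[x y] [x' y']|[x y]].
  by rewrite !hE => -[/ai-> /bi->].
have [x' <-] := asu x; have [y' <-] := bs y.
by exists (x', y'); rewrite hE.
Qed.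

Lemma tfg_indecomposable (A B : fgmod R) (f : lhom A B) (Sf : in_SGprj (mor f)) :
  @indecomposable (modcat (T2 R)) (tfg f) ->
  @indecomposable (SGprj R) (exist _ (mor f) Sf).
Proof.
move=> indM; apply: indecomposable_of_idem.
  move=> z; have [[x y] []] := indecomposable_neq0 indM.
  have x0 := congr1 (fun h : @hom (morcat R) (mor f) (mor f) => asrc_map h x) z.
  have y0 := congr1 (fun h : @hom (morcat R) (mor f) (mor f) => atgt_map h y) z.
  by rewrite -[x]/(lhom_id A x) [lhom_id A x]x0 -[y]/(lhom_id B y) [lhom_id B y]y0.
move=> e ee; pose e' : @hom (morcat R) (mor f) (mor f) := e.
have [h hE] := tmod_hom (fun x => ahomE e' x : atgt_map e' (f x) = f (asrc_map e' x)).
pose hM : @hom (modcat (T2 R)) (tfg f) (tfg f) := h.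
have hh : hM \oc hM = hM.
  apply: lhomP => -[x y]; rewrite -[LHS]/(h (h (x, y))) -[RHS]/(h (x, y)) !hE /=.
  congr pair.
    exact: (congr1 (fun h : @hom (morcat R) (mor f) (mor f) => asrc_map h x) ee).
  exact: (congr1 (fun h : @hom (morcat R) (mor f) (mor f) => atgt_map h y) ee).
have [h0|h1] := indecomposable_idem (@modcat_split (T2 R)) indM hh.
  have E z : h z = 0 := congr1 (fun u : lhom (tfg f) (tfg f) => u z) h0.
  left; apply: (@ahom_eq R (mor f) (mor f)) => x.
    by have := hE (x, 0); rewrite E => -[].
  by have := hE (0, x); rewrite E => -[].
have E z : h z = z := congr1 (fun u : lhom (tfg f) (tfg f) => u z) h1.
right; apply: (@ahom_eq R (mor f) (mor f)) => x.
  by have := hE (x, 0); rewrite E => -[].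
by have := hE (0, x); rewrite E => -[].
Qed.

End TriangularToArrows.

(** * Counting isomorphism classes *)

(** For each label that occurs choose one object carrying it. *)
Lemma finitely_many_labels (C : preadditive) (T : Type) (Q : C -> Prop) (s : seq T)
    (r : C -> T -> Prop) :
  (forall X, Q X -> indecomposable X -> exists t, List.In t s /\ r X t) ->
  (forall X Y t, r X t -> r Y t -> iso X Y) -> finitely_many_indec Q.
Proof.
move=> rX rI.
have [l lP] : exists l : seq C, forall X t, List.In t s -> r X t ->
    exists Y, List.In Y l /\ iso X Y.
  elim: (s) => [|t s' [l lP]]; first by exists [::].
  have [[Y rY]|no] := pselect (exists Y, r Y t).
    exists (Y :: l) => X t' [<-|ts'] rXt; first by exists Y; split; [left|exact: rI rY].
    by have [Z [Zl XZ]] := lP X t' ts' rXt; exists Z; split=> //; right.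
  exists l => X t' [<-|ts'] rXt; last exact: lP rXt.
  by case: no; exists X.
have [n [M MP]] : exists n (M : 'I_n -> C), forall Y, List.In Y l -> exists i, M i = Y.
  elim: l {lP} => [|Z l [n [M MP]]]; first by exists 0%N, (fun i : 'I_0 =>
    match i with Ordinal _ lt_i0 => False_rect C (notF lt_i0) end).
  exists n.+1, (fun i => if unlift ord0 i is Some j then M j else Z) => Y [<-|/MP[i <-]].
    by exists ord0; rewrite unlift_none.
  by exists (lift ord0 i); rewrite liftK.
exists n, M => X QX indX.
have [t [ts rXt]] := rX X QX indX; have [Y [Yl XY]] := lP X t ts rXt.
by have [i iE] := MP Y Yl; exists i; rewrite iE.
Qed.

(** A comparison map of projective covers is onto by essentiality and splits; the
    section is again onto by essentiality. *)
Lemma proj_cover_unique (R : nzRingType) (G P Om P' Om' : fgmod R) (p : lhom P G)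
    (i : lhom Om P) (p' : lhom P' G) (i' : lhom Om' P') :
  proj_cover p -> is_kernel i p -> proj_cover p' -> is_kernel i' p' ->
  @iso (morcat R) (mor i) (mor i').
Proof.
move=> [pP ps pe] [ii ip] [pP' ps' pe'] [ii' ip'].
have [t tE] := proj_lift p pP ps'.
have ts : surj t by apply: pe' => y; have [x <-] := ps y; exists x; exact: tE.
have [s sE] := proj_lift (lhom_id P') pP' ts.
have ss : surj s.
  apply: pe => y; have [x xE] := ps' y; exists x.
  by rewrite /= -tE sE.
have ti : injective t.
  by move=> x y; have [x' <-] := ss x; have [y' <-] := ss y; rewrite !sE /= => ->.
have [a aE] : exists a : lhom Om Om', forall x, i' (a x) = t (i x).
  apply: (lhom_lift (h := lhom_comp t i)) => // x; apply/ip'.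
  by rewrite tE; apply/ip; exists x.
apply/iso_morP; exists a, t; split=> //; split=> // [x y xy|y].
  by apply: ii; apply: ti; rewrite -[LHS]aE -[RHS]aE xy.
have [x xE] := ts (i' y); have /ip[z zE] : p x = 0.
  by rewrite -tE xE; apply/ip'; exists y.
by exists z; apply: ii'; rewrite aE zE.
Qed.

Lemma proj_cover_iso (R : nzRingType) (G G' P Om : fgmod R) (p : lhom P G)
    (i : lhom Om P) (h : lhom G G') : injective h -> surj h ->
  proj_cover p -> is_kernel i p ->
  proj_cover (lhom_comp h p) /\ is_kernel i (lhom_comp h p).
Proof.
move=> hi hs [pP ps pe] [ii ip]; split; split=> //.
- by move=> y; have [z <-] := hs y; have [x <-] := ps z; exists x.
- move=> M u us; apply: pe => y; have [x xE] := us (h y); exists x.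
  exact: hi xE.
- move=> y; rewrite -ip /=; split=> [|->]; last exact: lmap0.
  by rewrite -[0](lmap0 h) => /hi.
Qed.

Section Main.
Variables (k : comNzRingType) (L : algType k).
Hypothesis hL : artin_algebra L.
Hypothesis hcf : @contravariantly_finite (modcat L) (@gorenstein_projective L).
Hypothesis hss : G_semisimple L.

Lemma iso_mor_id (G G' : fgmod L) : @iso (modcat L) G G' ->
  @iso (morcat L) (mor (lhom_id G)) (mor (lhom_id G')).
Proof. by move=> /iso_modP[h [hi hs]]; apply/iso_morP; exists h, h. Qed.

Lemma iso_mor_zero (G G' : fgmod L) : @iso (modcat L) G G' ->
  @iso (morcat L) (mor (0 : lhom (zero_mod L) G)) (mor (0 : lhom (zero_mod L) G')).
Proof.
move=> /iso_modP[h [hi hs]]; apply/iso_morP; exists (lhom_id _), h; split=> // [x|].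
  by rewrite /= lmap0.
by split=> // x; exists x.
Qed.

(** The shape and the module G determine an arrow up to isomorphism; for the third
    shape this is uniqueness of projective covers. *)
Definition has_label (X : SGprj L) (t : nat * fgmod L) : Prop :=
  [\/ t.1 = 0%N /\ @iso (morcat L) (sval X) (mor (0 : lhom (zero_mod L) t.2)),
      t.1 = 1%N /\ @iso (morcat L) (sval X) (mor (lhom_id t.2))
    | t.1 = 2%N /\ exists (P Om : fgmod L) (p : lhom P t.2) (i : lhom Om P),
              [/\ proj_cover p, is_kernel i p & @iso (morcat L) (sval X) (mor i)]].

Lemma sgprj_finite : finite_representation_type (SGprj L).
Proof.
have [s sP] := cm_finite_list hL hcf hss.
pose lab (j : nat) := List.map (fun G : fgmod L => (j, G)) s.
apply: (@finitely_many_labels (SGprj L) (nat * fgmod L)%type (fun _ => True)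
  (lab 0%N ++ lab 1%N ++ lab 2%N) has_label).
  move=> X _ indX; have [G [indG gG cases]] := sgprj_classification hL hss indX.
  have [Y [Ys GY]] := sP G gG indG.
  have labY (j : nat) : List.In (j, Y) (lab j).
    exact: (List.in_map (fun G : fgmod L => (j, G))).
  case: cases => [XG|XG|[_ [P [Om [p [i [pc pk XG]]]]]]].
  - exists (0%N, Y); split; first by apply: List.in_or_app; left; exact: labY.
    by apply: Or31; split=> //; apply: iso_trans XG _; exact: iso_mor_zero.
  - exists (1%N, Y); split.
      by apply: List.in_or_app; right; apply: List.in_or_app; left; exact: labY.
    by apply: Or32; split=> //; apply: iso_trans XG _; exact: iso_mor_id.
  exists (2%N, Y); split.
    by apply: List.in_or_app; right; apply: List.in_or_app; right; exact: labY.
  apply: Or33; split=> //; have [h [hi hs]] := (iso_modP _ _).1 GY.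
  have [pc' pk'] := proj_cover_iso hi hs pc pk.
  by exists P, Om, (lhom_comp h p), i.
move=> X X' [j G]; rewrite /has_label /=.
move=> [[-> XG]|[-> XG]|[-> [P [Om [p [i [pc pk XG]]]]]]] [] [] // _.
- by move=> XG'; apply/iso_sgprj; apply: iso_trans XG (iso_sym XG').
- by move=> XG'; apply/iso_sgprj; apply: iso_trans XG (iso_sym XG').
- move=> [P' [Om' [p' [i' [pc' pk' XG']]]]]; apply/iso_sgprj.
  apply: iso_trans XG _; apply: iso_trans (iso_sym XG').
  exact: proj_cover_unique pc pk pc' pk'.
Qed.

Lemma triangular_cm_finite : CM_finite (T2 L).
Proof.
have [n [Z ZP]] := sgprj_finite.
apply: (@finitely_many_labels (modcat (T2 L)) 'I_n (@gorenstein_projective (T2 L))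
  (enum 'I_n) (fun M j =>
  exists (A B : fgmod L) (f : lhom A B), @iso (modcat (T2 L)) M (tfg f) /\
    @iso (morcat L) (mor f) (sval (Z j)))).
  move=> M gM indM; have [A [B [f [h [hi hs]]]]] := tfg_ess_surj M.
  have gf : tgp f by exact: gp_iso hi hs gM.
  have Mf : @iso (modcat (T2 L)) M (tfg f) by apply/iso_modP; exists h.
  have indf := tfg_indecomposable (tgp_sgprj gf) (indecomposable_iso Mf indM).
  have [j fZ] := ZP (exist _ (mor f) (tgp_sgprj gf)) I indf; exists j.
  by split; [apply: mem_In; rewrite mem_enum|exists A, B, f].
move=> M M' j [A [B [f [Mf fZ]]]] [A' [B' [f' [Mf' fZ']]]].
apply: iso_trans Mf _; apply: iso_trans (iso_sym Mf').
exact: tfg_iso (iso_trans fZ (iso_sym fZ')).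
Qed.

End Main.

Theorem proposition3p7 (k : comNzRingType) (L : algType k)
    (hL : artin_algebra L)
    (hcf : @contravariantly_finite (modcat L) (@gorenstein_projective L))
    (hss : G_semisimple L) :
  [/\ forall X : SGprj L,
        indecomposable X -> ~ @projective_obj (morcat L) (sval X) ->
        exists G : fgmod L,
          [/\ @indecomposable (modcat L) G, gorenstein_projective G,
              ~ projective G
            & [\/ @iso (morcat L) (sval X) (mor (0 : lhom (zero_mod L) G)),
                  @iso (morcat L) (sval X) (mor (lhom_id G))
                | exists (P Om : fgmod L) (p : lhom P G) (i : lhom Om P),
                    [/\ proj_cover p, is_kernel i p
                      & @iso (morcat L) (sval X) (mor i)]]],
      finite_representation_type (SGprj L)
    & CM_finite (T2 L)].
Proof.
split; [|exact: sgprj_finite hL hcf hss|exact: triangular_cm_finite hL hcf hss].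
move=> X indX npX; have [G [indG gG cases]] := sgprj_classification hL hss indX.
exists G; case: cases => [XG|XG|[npG XG]]; split=> //; try by [apply: Or33].
- by move=> pG; apply: npX; apply: projective_obj_iso XG (projective_mor_zero pG).
- exact: Or31.
- by move=> pG; apply: npX; apply: projective_obj_iso XG (projective_mor_id pG).
- exact: Or32.
Qed.
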